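(* (Weierstrass condition.) Let $t_0<t_1$, $0<\alpha\le 1$, $\beta>0$, $x_0,x_1\in\mathbb{R}^n$, and let $L=L(t,x,y)$ be a real function of $2n+1$ variables ($t\in\mathbb{R}$, $x,y\in\mathbb{R}^n$). Consider the problem ($P_2$): extremize $$J(x(\cdot))=\int_{t_0}^{t_1}(t_1-t)^{\beta-1}L\big(t,x(t),({}^{c}D^{\alpha}_{t_0+}x)(t)\big)\,dt,\qquad x(t_0)=x_0,\quad x(t_1)=x_1,$$ over $x\in PC^{\alpha}([t_0,t_1],\mathbb{R}^n)$. Let $E(t,x,y,z)=L(t,x,z)-L(t,x,y)-\langle L_y(t,x,y),z-y\rangle$ be the Weierstrass function. Let $x^0\in PC^{\alpha}([t_0,t_1],\mathbb{R}^n)$ be admissible, let $T$ be the set of continuity points of ${}^{c}D^{\alpha}_{t_0+}x^0$ in $[t_0,t_1]$, and suppose that $L,L_x,L_y$ are continuous in some neighborhood of the graph $\{(t,x^0(t),({}^{c}D^{\alpha}_{t_0+}x^0)(t)):t\in[t_0,t_1]\}$. (i) If $x^0$ provides a strong local minimum in ($P_2$), then $$E\big(\tau,x^0(\tau),({}^{c}D^{\alpha}_{t_0+}x^0)(\tau),({}^{c}D^{\alpha}_{t_0+}x^0)(\tau)+\xi\big)\ge 0$$ for all $\tau\in T$ and all $\xi\in\mathbb{R}^n$. (ii) If $x^0$ provides a weak local minimum in ($P_2$), then there exists $\delta>0$ such that the same inequality holds for all $\tau\in T$ and all $\xi\in\mathbb{R}^n$ with $\|\xi\|\le\frac{\delt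a}{2}$.
   Context: $PC([t_0,t_1],\mathbb{R}^n)$ is the set of piecewise continuous functions: continuous on $[t_0,t_1]$ except at finitely many points of $(t_0,t_1)$, where they have discontinuities of the first kind (finite one-sided limits). For $\alpha>0$: $(I^{\alpha}_{t_0+}\varphi)(t)=\frac{1}{\Gamma(\alpha)}\int_{t_0}^{t}(t-\tau)^{\alpha-1}\varphi(\tau)\,d\tau$. For $0<\alpha<1$ and continuous $\varphi$: $({}^{c}D^{\alpha}_{t_0+}\varphi)(t)=\frac{d}{dt}\big(I^{1-\alpha}_{t_0+}(\varphi(\cdot)-\varphi(t_0))\big)(t)$; for $\alpha=1$ it is the ordinary derivative. $PC^{\alpha}([t_0,t_1],\mathbb{R}^n)$ is the set of all continuous $\varphi$ with $\varphi(t)=\varphi(t_0)+(I^{\alpha}_{t_0+}\psi)(t)$ on $[t_0,t_1]$ for some $\psi\in PC([t_0,t_1],\mathbb{R}^n)$; then ${}^{c}D^{\alpha}_{t_0+}\varphi=\psi$ at the continuity points of $\psi$. Norm: $\|y\|_{PC^{\alpha}}=\|y\|_{C}+\|{}^{c}D^{\alpha}_{t_0+}y\|_{L^{\infty}}$. A function $x\in PC^{\alpha}([t_0,t_1],\mathbb{R}^n)$ is admissible if $x(t_0)=x_0$, $x(t_1)=x_1$. An admissible $x^0$ provides a strong (respectively weak) local minimum if there is $\delta>0$ such that $J(x(\cdot))\ge J(x^0(\cdot))$ for every admissible $x$ with $\|x-x^0\|_{C}<\delta$ (respectively $\|x-x^0\|_{PC^{\alpha}}<\delta$). $L_x,L_y$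 denote the gradients in $x$ and $y$; $\langle\cdot,\cdot\rangle$ is the scalar product.
   Formalization: In (i), L is also assumed continuous on a neighborhood of {(t,x⁰(t),y): t∈[t₀,t₁], y∈ℝⁿ}; the neighborhood of the graph is taken to contain also the points with the one-sided limits of the Caputo derivative of x⁰ at its jumps. *)

(* Defs.v *)
From HB Require Import structures.
From mathcomp Require Import all_boot all_order all_algebra.
From mathcomp Require Import all_classical all_reals all_analysis.
From mathcomp Require Import ess_sup_inf.

Set Implicit Arguments.
Unset Strict Implicit.
Unset Printing Implicit Defensive.

Import Order.TTheory GRing.Theory Num.Theory.
Import numFieldNormedType.Exports.

Local Open Scope classical_set_scope.
Local Open Scope ring_scope.

Section vectors.
Context (R : realType) (n : nat).
Implicit Types u v : 'rV[R]_n.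

Definition dotv u v : R := \sum_(i < n) u 0 i * v 0 i.

(* Euclidean norm; the library norm `|u| on 'rV[R]_n is the sup norm. *)
Definition normv u : R := Num.sqrt (dotv u u).

Definition grad (f : 'rV[R]_n -> R) (v : 'rV[R]_n) : 'rV[R]_n :=
  \row_i 'D_(delta_mx 0 i) f v.

Definition has_grad (f : 'rV[R]_n -> R) (v : 'rV[R]_n) : Prop :=
  forall i : 'I_n, derivable f v (delta_mx 0 i).

End vectors.

Section fractional_calculus.
Context (R : realType) (n : nat) (t0 t1 : R).
Local Notation mu := (@lebesgue_measure R).

(* Functions on [t0, t1] are represented by total functions on R, and only
   their values on [t0, t1] matter. In particular continuity and
   differentiability at t are relative to [t0, t1], hence one-sided at the
   endpoints. *)
Definition continuous_at_in (f : R -> 'rV[R]_n) (t : R) : Prop :=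
  f @ within `[t0, t1] (nbhs t) --> f t.

Definition derive_in (f : R -> 'rV[R]_n) (t : R) : 'rV[R]_n :=
  lim ((fun s : R => (s - t)^-1 *: (f s - f t)) @ within `[t0, t1] t^').

Definition PC (psi : R -> 'rV[R]_n) : Prop :=
  exists s : seq R,
    (forall t, t \in s ->
       [/\ t0 < t < t1, cvg (psi @ t^'-) & cvg (psi @ t^'+)]) /\
    (forall t, t0 <= t <= t1 -> t \notin s -> continuous_at_in psi t).

Definition Gamma (a : R) : R :=
  \int[mu]_(s in `]0, +oo[) (s `^ (a - 1) * expR (- s)).

Definition RLint (a : R) (phi : R -> 'rV[R]_n) (t : R) : 'rV[R]_n :=
  \row_i ((Gamma a)^-1 *
          \int[mu]_(s in `[t0, t]) ((t - s) `^ (a - 1) * phi s 0 i)).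

(* Where the derivative does not exist, the value is that of [lim] on a
   divergent filter and carries no meaning. *)
Definition caputo (alpha : R) (phi : R -> 'rV[R]_n) : R -> 'rV[R]_n :=
  if alpha == 1 then derive_in phi
  else derive_in (RLint (1 - alpha) (fun t => phi t - phi t0)).

Definition PCalpha (alpha : R) (phi : R -> 'rV[R]_n) : Prop :=
  (forall t, t0 <= t <= t1 -> continuous_at_in phi t) /\
  exists2 psi, PC psi &
    forall t, t0 <= t <= t1 -> phi t = phi t0 + RLint alpha psi t.

Definition normC (y : R -> 'rV[R]_n) : \bar R :=
  ereal_sup [set (normv (y t))%:E | t in `[t0, t1]].

Definition normLinfty (y : R -> 'rV[R]_n) : \bar R :=
  ess_sup mu (EFin \o ((fun t => normv (y t)) \_ `[t0, t1])).

Definition normPCalpha (alpha : R) (y : R -> 'rV[R]_n) : \bar R :=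
  (normC y + normLinfty (caputo alpha y))%E.

(* For phi in PC^alpha with density psi, the derivative in caputo alpha phi fails
   to exist exactly at the points where the one-sided limits of psi differ.
   Those are also one-sided limits of caputo alpha phi, so whatever value it
   takes at such a point, the point is not a continuity point. *)
Definition continuity_points (alpha : R) (phi : R -> 'rV[R]_n) : set R :=
  [set t | t0 <= t <= t1 /\ continuous_at_in (caputo alpha phi) t].

End fractional_calculus.

Section variational_problem.
Context (R : realType) (n : nat) (t0 t1 alpha beta : R) (x0 x1 : 'rV[R]_n).
Context (L : R -> 'rV[R]_n -> 'rV[R]_n -> R).
Local Notation mu := (@lebesgue_measure R).
Local Notation point := (R * 'rV[R]_n * 'rV[R]_n)%type.
Implicit Type x : R -> 'rV[R]_n.

Definition Lfun (p : point) : R := L p.1.1 p.1.2 p.2.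

Definition Lx (t : R) (x y : 'rV[R]_n) : 'rV[R]_n := grad (fun u => L t u y) x.

Definition Ly (t : R) (x y : 'rV[R]_n) : 'rV[R]_n := grad (fun v => L t x v) y.

Definition C1_at (p : point) : Prop :=
  [/\ has_grad (fun u => L p.1.1 u p.2) p.1.2,
      has_grad (fun v => L p.1.1 p.1.2 v) p.2,
      {for p, continuous Lfun},
      {for p, continuous (fun q : point => Lx q.1.1 q.1.2 q.2)} &
      {for p, continuous (fun q : point => Ly q.1.1 q.1.2 q.2)}].

Definition weierstrass (t : R) (x y z : 'rV[R]_n) : R :=
  L t x z - L t x y - dotv (Ly t x y) (z - y).

Definition admissible x : Prop :=
  [/\ PCalpha t0 t1 alpha x, x t0 = x0 & x t1 = x1].

Definition integrand x (t : R) : R :=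
  (t1 - t) `^ (beta - 1) * L t (x t) (caputo t0 t1 alpha x t).

(* The library integral is total; J x is meaningful when J_defined x holds. *)
Definition J_defined x : Prop :=
  mu.-integrable `[t0, t1] (EFin \o integrand x).

Definition J x : R := \int[mu]_(t in `[t0, t1]) integrand x t.

Definition strong_local_minimum x : Prop :=
  admissible x /\
  exists2 delta : R, 0 < delta &
    forall z, admissible z -> J_defined z ->
      (normC t0 t1 (z \- x)%R < delta%:E)%E -> J x <= J z.

Definition weak_local_minimum x : Prop :=
  admissible x /\
  exists2 delta : R, 0 < delta &
    forall z, admissible z -> J_defined z ->
      (normPCalpha t0 t1 alpha (z \- x)%R < delta%:E)%E -> J x <= J z.

Definition graph x : set point :=
  [set (t, x t, caputo t0 t1 alpha x t)
     | t in continuity_points t0 t1 alpha x].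

(* The closure adds to the graph the points (s, x s, l) with s a jump of the
   Caputo derivative and l either of its one-sided limits there. *)
Definition C1_near_graph x : Prop :=
  exists U : set point,
    [/\ open U, closure (graph x) `<=` U & forall p, U p -> C1_at p].

(* L is continuous on a neighbourhood of {(t, x t, y) : t in [t0, t1], y in R^n}.
   C1_near_graph gives nothing at (t, x t, caputo x t + xi) for large xi. *)
Definition continuous_over x : Prop :=
  exists V : set point,
    [/\ open V,
        forall t y, t0 <= t <= t1 -> V (t, x t, y) &
        forall p, V p -> {for p, continuous Lfun}].

End variational_problem.

(* Main.v *)
(* Perturb the Caputo derivative of x by xi on [tau, tau + h] and by - k xi on the adjacent
   interval of length N h, with k ~ 1 / N chosen so that the endpoint x(t1) does not move; such a
   variation is admissible. It displaces x by a function that is uniformly small and, because the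
   two parts cancel to first order, is o(h) in the L^1 norm with weight (t1 - t)^(beta - 1),
   despite the memory of the fractional integral. Hence the increment of J is
   h (t1 - tau)^(beta - 1) (E + o(1)), where the term <L_y, xi> of the Weierstrass function comes
   from the compensating part when N is large; no Euler-Lagrange equation is needed. The derivative
   of the variation is bounded by |xi|, which gives the weak version for small xi, and
   tau = t1 follows by continuity. *)
Require Import Defs.
From mathcomp Require Import all_boot all_order all_algebra.
From mathcomp Require Import all_classical all_reals all_analysis.
From mathcomp Require Import measurable_realfun ess_sup_inf ring lra.
Import Order.TTheory GRing.Theory Num.Theory.
Import numFieldNormedType.Exports.
Set Implicit Arguments.
Unset Strict Implicit.
Unset Printing Implicit Defensive.
Local Open Scope classical_set_scope.
Local Open Scope ring_scope.

(** * Power and beta integrals *)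

(** The obstacle is the memory of the fractional integral: a lone perturbation of the Caputo
    derivative on an interval of length h displaces x at every later time by an amount of order h,
    and the effect of this on J would be of the same order as the effect looked for. Requiring x(t1)
    to stay put forces N k -> 1 as h -> 0, since both intervals shrink to tau and the kernel (t1 -
    s)^(alpha - 1) is nearly constant on them; the same balance makes the displacement o(h) at each
    fixed later time. For alpha < 1 the balance fails just after the two intervals, where the kernel
    is singular, and only an estimate with an integrable singularity survives there: hence the
    weighted L^1 norm. The order of choices matters. N is fixed before h, large enough for D - k xi
    to lie where L is C1. The linearisation error on the second interval is proportional to k |xi|
    times the length N h, and N k <= 1, so a large N does not spoil it. Compactness of [t0, t1]
    supplies bounds for L and Lx in a tube of constant radius around the graph, although the graph
    is not closed at the jumps. *)

Section power_integrals.
Context {R : realType}.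
Notation mu := (@lebesgue_measure R).

(** Lebesgue measure is |k| times its image under x -> a + k x, because both measures agree on the
    intervals ]u, v]. For negative k the preimage of such an interval is closed on the left instead,
    hence the two cases. *)
Lemma ge0_integral_affine (f : R -> \bar R) (a k : R) : k != 0 ->
  measurable_fun [set: R] f -> (forall x, (0 <= f x)%E) ->
  (\int[mu]_x f x = `|k|%:E * \int[mu]_x f (a + k * x)%R)%E.
Proof.
move=> k0 mf f0.
have mphi : measurable_fun [set: R] ((fun x => a + k * x) : R -> measurableTypeR R).
  by apply: measurable_funD => //; exact: measurable_funM.
have [pf pfE] : {pf : {measure set (measurableTypeR R) -> \bar R} |
    pf = pushforward mu ((fun x => a + k * x) : R -> measurableTypeR R) :> (set _ -> _)}.
  by unshelve eexists (pushforward mu ((fun x => a + k * x) : R -> measurableTypeR R)).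
pose nu : {measure set (measurableTypeR R) -> \bar R} := mscale (NngNum (normr_ge0 k)) pf.
have munu : forall A, measurable A -> mu A = nu A.
  apply: lebesgue_measure_unique => /= _ [[u v]] _ <-.
  rewrite /nu /mscale /= pfE /pushforward.
  have [kp|kn|] := ltgtP k 0; last by move=> k0'; rewrite k0' eqxx in k0.
  - rewrite (_ : _ @^-1` _ = `[((v - a) / k), ((u - a) / k)[%classic); last first.
      apply/seteqP; split => x /=; rewrite !in_itv/=.
        by rewrite ler_ndivrMr// ltr_ndivlMr// => /andP[h1 h2]; apply/andP; split; lra.
      by rewrite ler_ndivrMr// ltr_ndivlMr// => /andP[h1 h2]; apply/andP; split; lra.
    rewrite /= !lebesgue_measure_itv/= !lte_fin ltr_nM2r ?invr_lt0// ltrD2r.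
    case: ifPn => uv; last by rewrite mule0.
    by rewrite ltr0_norm// -!EFinB -EFinM; congr EFin; field.
  - rewrite (_ : _ @^-1` _ = `]((u - a) / k), ((v - a) / k)]%classic); last first.
      apply/seteqP; split => x /=; rewrite !in_itv/=.
        by rewrite ler_pdivlMr// ltr_pdivrMr// => /andP[h1 h2]; apply/andP; split; lra.
      by rewrite ler_pdivlMr// ltr_pdivrMr// => /andP[h1 h2]; apply/andP; split; lra.
    rewrite /= !lebesgue_measure_itv/= !lte_fin ltr_pM2r ?invr_gt0// ltrD2r.
    case: ifPn => uv; last by rewrite mule0.
    by rewrite gtr0_norm// -!EFinB -EFinM; congr EFin; field.
transitivity (\int[nu]_x f x)%E.
  by apply: eq_measure_integral => A mA _; exact: munu.
rewrite ge0_integral_mscale//; congr (_ * _)%E; rewrite pfE.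
by rewrite ge0_integral_pushforward.
Qed.

Lemma powR_continuous_gt0 (q x : R) : 0 < x -> {for x, continuous (@powR R ^~ q)}.
Proof.
move=> x0; apply: differentiable_continuous; apply/derivable1_diffP.
by apply: derivable_powR; rewrite in_itv/= x0.
Qed.

(** For q < 1 the integrand is singular at 0, so the fundamental theorem is applied on
    [T / (n + 1), T] and the intervals are exhausted by monotone convergence. *)
Lemma integral_powR (q T : R) : 0 < q -> 0 <= T ->
  (\int[mu]_(u in `[0%R, T]) (u `^ (q - 1))%:E = (T `^ q / q)%:E)%E.
Proof.
move=> q0; rewrite le_eqVlt => /predU1P[<-|T0].
  by rewrite set_itv1 integral_set1 powR0 ?gt_eqF// mul0r.
pose d (n : nat) := T / n.+1%:R.
have d0 n : 0 < d n by rewrite divr_gt0.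
have mpow A : measurable_fun A (fun u : R => (u `^ (q - 1))%:E).
  by apply/measurable_EFinP/measurable_funTS; exact: measurable_powR.
rewrite -integral_itv_obnd_cbnd//.
have -> : `]0, T]%classic = \bigcup_n `[d n, T]%classic.
  apply/seteqP; split => [x /=|x [n _] /=]; rewrite !in_itv/=; last first.
    by move=> /andP[h1 ->]; rewrite (lt_le_trans (d0 n) h1).
  move=> /andP[x0 xT].
  exists (Num.truncn (T / x)) => //=; rewrite in_itv/= xT andbT /d.
  rewrite ler_pdivrMr// mulrC -ler_pdivrMr//.
  by apply: ltW; apply: truncnS_gt.
suff cv2 : (\int[mu]_(x in `[d n, T]) (x `^ (q - 1))%:E)%E @[n --> \oo] --> (T `^ q / q)%:E.
  have /(cvg_lim (@ereal_hausdorff R)) <- := cv2.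
  apply/esym/(cvg_lim (@ereal_hausdorff R)).
  apply: ge0_nondecreasing_set_cvg_integral => //.
  + apply/nondecreasing_seqP => n; apply/subsetPset => x /=; rewrite !in_itv/=.
    move=> /andP[h ->]; rewrite andbT; apply: le_trans h.
    by rewrite /d ler_pM2l// lef_pV2 ?posrE// ler_nat.
  + by move=> n; exact: mpow.
  + by move=> n x _; rewrite lee_fin powR_ge0.
have -> : (fun n => \int[mu]_(x in `[d n, T]) (x `^ (q - 1))%:E)%E =
    (fun n => ((T `^ q - d n `^ q) / q)%:E).
  (* For n = 0 the interval is the single point T, to which [continuous_FTC2] does not apply. *)
  apply/funext => -[|n].
    rewrite /d divr1 set_itv1 integral_set1 subrr mul0r//.
  have dT : d n.+1 < T by rewrite /d ltr_pdivrMr// ltr_pMr// ltr1n.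
  rewrite (@continuous_FTC2 _ _ (fun u => u `^ q / q))//.
  - by rewrite -EFinB -mulrBl.
  - apply: continuous_in_subspaceT => x; rewrite inE/= in_itv/= => /andP[h _].
    by apply: powR_continuous_gt0; exact: lt_le_trans h.
  - split.
    + move=> x; rewrite in_itv/= => /andP[h _].
      apply: derivableM => //; apply: derivable_powR.
      by rewrite in_itv/= (lt_trans _ h).
    + apply: cvg_at_right_filter; apply: cvgMr_tmp; exact: powR_continuous_gt0.
    + apply: cvg_at_left_filter; apply: cvgMr_tmp; exact: powR_continuous_gt0.
  - move=> x; rewrite in_itv/= => /andP[h _].
    have x0 : 0 < x by exact: lt_trans h.
    rewrite derive1E (_ : (fun u => u `^ q / q) = (q^-1 \o* @powR R ^~ q))//.
    rewrite deriveMr ?derive_val; last by apply: derivable_powR; rewrite in_itv/= x0.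
    have dq := is_derive1_powR q x0.
    by rewrite derive_val mulrA mulVf ?gt_eqF// mul1r.
apply/fine_cvgP; split; first by near=> n.
rewrite /comp/= (_ : T `^ q / q = (T `^ q - 0) / q); last by rewrite subr0.
apply: cvgMr_tmp; apply: cvgB; first exact: cvg_cst.
move/cvg_at_rightP: (powR_cvg0 q0); apply; split=> //.
by rewrite -[X in _ --> X](mulr0 T); apply: cvgMr; exact: cvg_harmonic.
Unshelve. all: by end_near. Qed.

Lemma integral_restrict_affine (f : R -> R) (a k : R) (A B : set R) : k != 0 ->
  measurable A -> measurable_fun [set: R] f -> (forall x, A x -> 0 <= f x) ->
  (forall x, A (a + k * x) <-> B x) ->
  (\int[mu]_(x in A) (f x)%:E = `|k|%:E * \int[mu]_(x in B) (f (a + k * x)%R)%:E)%E.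
Proof.
move=> k0 mA mf f0 AB; rewrite integral_mkcond.
rewrite (ge0_integral_affine a k0).
- rewrite [X in (_ = _ * X)%E]integral_mkcond; congr (_ * _)%E; apply: eq_integral => x _.
  rewrite !patchE; case: ifPn => [/set_mem/AB Bx|/negP Ax]; first by rewrite mem_set.
  by rewrite memNset// => /AB Bx; apply: Ax; exact: mem_set.
- by apply/(measurable_restrictT _ mA)/measurable_EFinP; exact: measurable_funTS.
- by apply: erestrict_ge0 => x Ax; rewrite lee_fin f0.
Qed.

Lemma integral_powR_right (q a t : R) : 0 < q -> a <= t ->
  (\int[mu]_(u in `[a, t]) ((t - u) `^ (q - 1))%:E = ((t - a) `^ q / q)%:E)%E.
Proof.
move=> q0 at_; rewrite -integral_powR ?subr_ge0//.
rewrite [RHS](@integral_restrict_affine _ t (-1) _ `[a, t]%classic)//.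
- by rewrite normrN1 mul1e; apply: eq_integral => x _; rewrite mulN1r.
- by move=> x _; exact: powR_ge0.
- by move=> x /=; rewrite !in_itv/=; split=> /andP[h1 h2]; apply/andP; split; lra.
Qed.

(** Euler's beta function B(p, q), in the extended reals until [betae_lty] makes it finite. *)
Definition betae (p q : R) : \bar R :=
  (\int[mu]_(u in `[0%R, 1%R]) ((1 - u) `^ (p - 1) * u `^ (q - 1))%:E)%E.

Lemma measurable_beta_kernel (p q r t : R) :
  measurable_fun [set: R] (fun s => (t - s) `^ (p - 1) * (s - r) `^ (q - 1)).
Proof.
apply: measurable_funM.
  by apply: (@measurableT_comp _ _ _ _ _ _ (@powR R ^~ (p - 1))) => //; exact: measurable_funB.
by apply: (@measurableT_comp _ _ _ _ _ _ (@powR R ^~ (q - 1))) => //; exact: measurable_funB.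
Qed.

(** The substitution s = r + (t - r) u moves all dependence on r and t into one power. For p = 1 -
    al and q = al its exponent is 0, which is what makes fractional integrals of orders 1 - al and
    al compose to a plain primitive. *)
Lemma integral_beta_kernel (p q r t : R) : r < t ->
  (\int[mu]_(s in `[r, t]) ((t - s) `^ (p - 1) * (s - r) `^ (q - 1))%:E =
   ((t - r) `^ (p + q - 1))%:E * betae p q)%E.
Proof.
move=> rt; have tr0 : 0 < t - r by rewrite subr_gt0.
have step := @integral_restrict_affine (fun s => (t - s) `^ (p - 1) * (s - r) `^ (q - 1))
  r (t - r) `[r, t]%classic `[0, 1]%classic.
rewrite {}step.
- rewrite (gtr0_norm tr0) /betae.
  pose g (x : R) := (1 - x) `^ (p - 1) * x `^ (q - 1).
  have mg : measurable_fun [set: R] g.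
    have := measurable_beta_kernel p q 0 1.
    by under eq_fun do rewrite subr0.
  have g0 x : 0 <= g x by rewrite mulr_ge0// powR_ge0.
  transitivity ((t - r)%:E * \int[mu]_(x in `[0%R, 1%R])
      (((t - r) `^ (p - 1) * (t - r) `^ (q - 1))%:E * (g x)%:E))%E.
    congr (_ * _)%E; apply: eq_integral => x.
    rewrite inE/= in_itv/= => /andP[x0 x1]; rewrite -EFinM /g; congr EFin.
    rewrite (_ : t - (r + (t - r) * x) = (t - r) * (1 - x)); last by ring.
    rewrite (_ : r + (t - r) * x - r = (t - r) * x); last by ring.
    have x1' : 0 <= 1 - x by rewrite subr_ge0.
    rewrite (powRM _ (ltW tr0) x1') (powRM _ (ltW tr0) x0); ring.
  have mEg : measurable_fun `[(0 : R), 1]%classic (fun x => (g x)%:E).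
    by apply/measurable_EFinP; exact: measurable_funTS.
  rewrite ge0_integralZl; [|exact: measurable_itv|exact: mEg| |]; last 2 first.
  + by move=> x _; rewrite lee_fin.
  + by rewrite lee_fin mulr_ge0// powR_ge0.
  rewrite muleA -EFinM; congr (_%:E * _)%E.
  (* The Jacobian t - r counts as a first power: 1 + (p - 1) + (q - 1) = p + q - 1. *)
  rewrite -{1}(powRr1 (ltW tr0)) -powRD; last by rewrite (gt_eqF tr0) implybT.
  rewrite -powRD; last by rewrite (gt_eqF tr0) implybT.
  congr (_ `^ _); ring.
- by rewrite gt_eqF.
- exact: measurable_itv.
- exact: measurable_beta_kernel.
- by move=> x _; rewrite mulr_ge0// powR_ge0.
- move=> x /=; rewrite !in_itv/=; split=> /andP[h1 h2]; apply/andP; split.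
  + by move: h1; rewrite lerDl pmulr_rge0.
  + by move: h2; rewrite addrC -lerBrDr -ler_pdivlMl// mulVf// gt_eqF.
  + by rewrite lerDl mulr_ge0// ltW.
  + by rewrite addrC -lerBrDr ler_piMr// ltW.
Qed.

(** On each side of 1/2 one factor is bounded by C and the other is an integrable power; adding the
    two bounds avoids splitting the integral. *)
Lemma betae_lty (p q : R) : 0 < p -> 0 < q -> (betae p q < +oo)%E.
Proof.
move=> p0 q0.
pose C := 1 + 2 `^ (1 - p) + 2 `^ (1 - q).
have C0 : 0 <= C by rewrite !addr_ge0// powR_ge0.
have aux (r u : R) : 0 < r -> 2^-1 <= u <= 1 -> u `^ (r - 1) <= 1 + 2 `^ (1 - r).
  move=> r0 /andP[u2 u1]; have u0 : 0 < u by apply: lt_le_trans u2; rewrite invr_gt0.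
  have [r1|r1] := leP 1 r.
    apply: le_trans (_ : 1 <= _); last by rewrite lerDl powR_ge0.
    by rewrite -[leRHS](powRr0 u); apply: ger_powR; rewrite ?u0 ?u1// subr_ge0.
  apply: le_trans (_ : 2 `^ (1 - r) <= _); last by rewrite lerDr.
  rewrite -[X in X <= _]invrK -powRN opprB.
  rewrite -[leRHS]invrK lef_pV2 ?posrE ?invr_gt0 ?powR_gt0// -powRN opprB.
  rewrite (_ : 2 `^ (r - 1) = (2^-1) `^ (1 - r)); last first.
    by rewrite -[X in _ = X `^ _]powR_inv1// -powRrM; congr (_ `^ _); ring.
  by apply: ge0_ler_powR; rewrite ?nnegrE ?subr_ge0 ?(ltW r1) ?(ltW u0) ?invr_ge0.
have bd : forall u : R, 0 <= u <= 1 -> (1 - u) `^ (p - 1) * u `^ (q - 1) <=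
    C * (1 - u) `^ (p - 1) + C * u `^ (q - 1).
  move=> u /andP[u0 u1].
  have [uh|uh] := leP u 2^-1.
    have h := aux p (1 - u) p0; rewrite -[leLHS]add0r lerD//.
      by rewrite mulr_ge0// powR_ge0.
    rewrite ler_wpM2r ?powR_ge0// (le_trans (h _)) ?lerDl ?powR_ge0//; apply/andP; split; lra.
  have h := aux q u q0; rewrite -[leLHS]addr0 lerD//; last first.
    by rewrite mulr_ge0// powR_ge0.
  rewrite mulrC ler_wpM2r ?powR_ge0// (le_trans (h _))//.
    by rewrite (ltW uh) u1.
  by rewrite /C addrAC lerDl powR_ge0.
have mp : measurable_fun `[(0 : R), 1]%classic (fun u : R => (C * (1 - u) `^ (p - 1))%:E).
  apply/measurable_EFinP/measurable_funTS; apply: measurable_funM => //.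
  by apply: (@measurableT_comp _ _ _ _ _ _ (@powR R ^~ (p - 1))) => //; exact: measurable_funB.
have mq : measurable_fun `[(0 : R), 1]%classic (fun u : R => (C * u `^ (q - 1))%:E).
  by apply/measurable_EFinP/measurable_funTS; exact: measurable_funM.
apply: (@le_lt_trans _ _ (\int[mu]_(u in `[0%R, 1%R])
  ((C * (1 - u) `^ (p - 1))%:E + (C * u `^ (q - 1))%:E))%E).
  apply: ge0_le_integral => //.
  - by move=> x _; rewrite lee_fin mulr_ge0// powR_ge0.
  - apply/measurable_EFinP/measurable_funTS.
    have := measurable_beta_kernel p q 0 1.
    by under eq_fun do rewrite subr0.
  - by apply: emeasurable_funD.
rewrite ge0_integralD//; last 2 first.
- by move=> x _; rewrite lee_fin mulr_ge0// powR_ge0.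
- by move=> x _; rewrite lee_fin mulr_ge0// powR_ge0.
under eq_integral do rewrite EFinM.
rewrite ge0_integralZl//; last 2 first.
- apply/measurable_EFinP/measurable_funTS.
  by apply: (@measurableT_comp _ _ _ _ _ _ (@powR R ^~ (p - 1))) => //; exact: measurable_funB.
- by move=> x _; rewrite lee_fin powR_ge0.
under [X in (_ + X)%E]eq_integral do rewrite EFinM.
rewrite ge0_integralZl//; last 2 first.
- by apply/measurable_EFinP/measurable_funTS; exact: measurable_powR.
- by move=> x _; rewrite lee_fin powR_ge0.
by rewrite integral_powR_right// integral_powR// -!EFinM -EFinD ltry.
Qed.

(** Both exponents are nonpositive, so the integrand is at least 1 inside the interval. This gives
    the positivity of the constant in [caputo_density]. *)
Lemma betae_ge1 (p q : R) : 0 < p <= 1 -> 0 < q <= 1 -> (1 <= betae p q)%E.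
Proof.
move=> /andP[p0 p1] /andP[q0 q1].
have -> : 1%E = (\int[mu]_(u in `[0%R, 1%R]) (cst 1%:E u))%E :> \bar R.
  by rewrite integral_cst//= lebesgue_measure_itv/= lte_fin ltr01 sube0 mul1e.
(* Both endpoints are removed first: [powR] sends 0 with a nonzero exponent to 0, so the pointwise
   bound can fail there. *)
rewrite -integral_itv_obnd_cbnd//.
rewrite -integral_itv_bndo_bndc//.
rewrite /betae -integral_itv_obnd_cbnd; last first.
  apply/measurable_EFinP/measurable_funTS; have := measurable_beta_kernel p q 0 1.
  by under eq_fun do rewrite subr0.
rewrite -integral_itv_bndo_bndc; last first.
  apply/measurable_EFinP/measurable_funTS; have := measurable_beta_kernel p q 0 1.
  by under eq_fun do rewrite subr0.
apply: ge0_le_integral => //.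
  apply/measurable_EFinP/measurable_funTS; have := measurable_beta_kernel p q 0 1.
  by under eq_fun do rewrite subr0.
move=> x /=; rewrite in_itv/= => /andP[x0 x1].
rewrite lee_fin -[leLHS]mulr1; apply: ler_pM => //.
  rewrite -[leLHS](powRr0 (1 - x)); apply: ger_powR; last lra.
  by apply/andP; split; lra.
rewrite -[leLHS](powRr0 x); apply: ger_powR; last lra.
by rewrite x0 ltW.
Qed.

(** [Gamma] is the [fine] part of an extended integral, which would be 0 if the integral were
    infinite; positivity therefore needs the upper bound [hi] as well as the lower bound [lo]. *)
Lemma Gamma_gt0 (a : R) : 0 < a <= 1 -> 0 < Gamma a.
Proof.
move=> /andP[a0 a1].
pose f (s : R) := s `^ (a - 1) * expR (- s).
have mf : measurable_fun [set: R] f.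
  apply: measurable_funM; first exact: measurable_powR.
  apply: (@measurableT_comp _ _ _ _ _ _ (@expR R)) => //; exact: measurable_oppr.
have f0 s : 0 <= f s by rewrite mulr_ge0 ?powR_ge0 ?expR_ge0.
have mEf (A : set R) : measurable_fun A (fun x => (f x)%:E).
  by apply/measurable_EFinP; exact: measurable_funTS.
have lo : ((expR (-1))%:E <= \int[mu]_(s in `]0%R, +oo[) (f s)%:E)%E.
  have -> : (expR (-1))%:E = (\int[mu]_(u in `[0%R, 1%R]) (cst (expR (-1))%:E u))%E :> \bar R.
    by rewrite integral_cst//= lebesgue_measure_itv/= lte_fin ltr01 sube0 mule1.
  rewrite -integral_itv_obnd_cbnd//.
  apply: (@le_trans _ _ (\int[mu]_(s in `]0%R, 1%R]) (f s)%:E)%E).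
    apply: ge0_le_integral => //; first by move=> x _; rewrite lee_fin expR_ge0.
      exact: mEf.
    move=> x /=; rewrite in_itv/= => /andP[x0 x1].
    rewrite lee_fin -[leLHS]mul1r /f; apply: ler_pM; rewrite ?expR_ge0//.
      rewrite -[leLHS](powRr0 x); apply: ger_powR; last lra.
      by rewrite x0.
    by rewrite ler_expR lerN2.
  apply: ge0_subset_integral => //; last by apply: subset_itvl; rewrite bnd_simp.
    exact: mEf.
  by move=> x _; rewrite lee_fin.
have hi : (\int[mu]_(s in `]0%R, +oo[) (f s)%:E < +oo)%E.
  (* Below 1 the power dominates the integrand, above 1 the exponential does, and the latter is the
     density of a probability law. *)
  rewrite (@itv_bndbnd_setU _ _ _ (BRight 1)) ?bnd_simp//.
  rewrite ge0_integral_setU//=; last 3 first.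
  - exact: mEf.
  - by move=> x _; rewrite lee_fin.
  - by apply/disj_setPS => y [/=]; rewrite !in_itv/= => /andP[_ h1] /andP[h2 _]; move: (le_lt_trans h1 h2); rewrite ltxx.
  apply: lte_add_pinfty.
    apply: (@le_lt_trans _ _ (\int[mu]_(s in `]0%R, 1%R]) (s `^ (a - 1))%:E)%E).
      apply: ge0_le_integral => //.
      - by move=> x _; rewrite lee_fin.
      - exact: mEf.
      - by apply/measurable_EFinP/measurable_funTS.
      move=> x /=; rewrite in_itv/= => /andP[x0 x1].
      by rewrite lee_fin /f ler_piMr ?powR_ge0// -expR0 ler_expR oppr_le0 ltW.
    rewrite integral_itv_obnd_cbnd; last first.
      by apply/measurable_EFinP/measurable_funTS; exact: measurable_powR.
    by rewrite integral_powR// ltry.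
  apply: (@le_lt_trans _ _ (\int[mu]_(s in `[1%R, +oo[) (expR (- s))%:E)%E).
    rewrite integral_itv_obnd_cbnd; last exact: mEf.
    apply: ge0_le_integral.
    - exact: measurable_itv.
    - by move=> x _; rewrite lee_fin.
    - exact: mEf.
    - apply/measurable_EFinP/measurable_funTS.
      by apply: (@measurableT_comp _ _ _ _ _ _ (@expR R)) => //; exact: measurable_oppr.
    move=> x /=; rewrite in_itv/= andbT => x1.
    rewrite lee_fin /f ler_piMl ?expR_ge0//.
    rewrite -[leRHS](powRr0 x); by apply: ler_powR => //; rewrite subr_le0.
  have mpdf : measurable_fun [set: R] (fun x => (exponential_pdf 1 x)%:E).
    by apply/measurable_EFinP; exact: measurable_exponential_pdf.
  have pdf_ge0 (x : R) : 0 <= exponential_pdf 1 x by exact: exponential_pdf_ge0.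
  apply: (@le_lt_trans _ _ (\int[mu]_s (exponential_pdf 1 s)%:E)%E); last first.
    by rewrite integral_exponential_pdf// ltry.
  apply: (@le_trans _ _ (\int[mu]_(s in `[1%R, +oo[) (exponential_pdf 1 s)%:E)%E).
    apply: ge0_le_integral.
    - exact: measurable_itv.
    - by move=> x _; rewrite lee_fin expR_ge0.
    - apply/measurable_EFinP/measurable_funTS.
      by apply: (@measurableT_comp _ _ _ _ _ _ (@expR R)) => //; exact: measurable_oppr.
    - exact: measurable_funTS.
    move=> x /=; rewrite in_itv/= andbT => x1.
      by rewrite exponential_pdfE ?(le_trans ler01)// mulN1r mul1r.
  apply: ge0_subset_integral; [exact: measurable_itv|exact: measurableT|exact: mpdf| |by []].
  by move=> x _; rewrite lee_fin.
suff : 0 < fine (\int[mu]_(s in `]0%R, +oo[) (f s)%:E)%E by [].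
apply: fine_gt0; apply/andP; split; last exact: hi.
by apply: lt_le_trans lo; rewrite lte_fin expR_gt0.
Qed.

End power_integrals.

(** * Riemann-Liouville integrals and Caputo derivatives *)

Section compactness.
Context {R : realType}.

(** Compactness of the segment for a property monotone in its bound: finitely many local bounds have
    a common upper bound. *)
Lemma segment_uniform (t0 t1 : R) (P : R -> R -> Prop) :
  (forall M M' s, M <= M' -> P M s -> P M' s) ->
  (forall t, t0 <= t <= t1 -> exists M, \forall s \near t, t0 <= s <= t1 -> P M s) ->
  exists2 M, 0 < M & forall s, t0 <= s <= t1 -> P M s.
Proof.
move=> Pmono Ploc.
have /compact_near_coveringP/near_covering_withinP cov := @segment_compact R t0 t1.
have [|M [Mreal hM]] := cov _ (+oo : set_system R) (fun M s => P M s) _.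
  move=> t; rewrite /= in_itv/= => tt; have [M hM] := Ploc t tt.
  exists ([set s | t0 <= s <= t1 -> P M s], [set M' | M <= M']) => /=.
    by split; [exact: hM|exists M; split; [exact: num_real|move=> x /ltW]].
  by move=> -[s M'] /= [h1 h2]; rewrite in_itv/= => /h1; exact: Pmono.
(* The filter at +oo gives the property strictly beyond M, hence M + 1; the maximum with 1 makes the
   bound positive. *)
exists (Num.max (M + 1) 1); first by rewrite lt_max ltr01 orbT.
move=> s sT; apply: (hM (Num.max (M + 1) 1)); last by rewrite /= in_itv.
by rewrite lt_max ltrDl ltr01.
Qed.

End compactness.

(** * Integrals against a power kernel and increments of primitives *)

Section weighted_integrals.
Context {R : realType}.
Notation mu := (@lebesgue_measure R).

Lemma integrable_powR_bounded (q a t M : R) (g : R -> R) : 0 < q ->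
  measurable_fun `[a, t] g -> (forall u, a <= u <= t -> `|g u| <= M) ->
  mu.-integrable `[a, t] (EFin \o (fun u => (t - u) `^ (q - 1) * g u)).
Proof.
move=> q0 mg gM.
have [at_|ta] := leP a t; last by rewrite set_itv_ge ?bnd_simp -?ltNge//; exact: integrable_set0.
have mp : measurable_fun [set: R] (fun u : R => (t - u) `^ (q - 1)).
  by apply: (@measurableT_comp _ _ _ _ _ _ (@powR R ^~ (q - 1))) => //; exact: measurable_funB.
have ip : mu.-integrable `[a, t] (EFin \o (fun u => (t - u) `^ (q - 1))).
  apply/integrableP; split; first by apply/measurable_EFinP; exact: measurable_funTS.
  under eq_integral do rewrite /= ger0_norm ?powR_ge0//.
  by rewrite integral_powR_right// ltry.
have iM : mu.-integrable `[a, t] (EFin \o (fun u => M * (t - u) `^ (q - 1))).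
  exact: (integrableZl _ M ip).
apply: le_integrable iM => //.
  apply/measurable_EFinP; apply: measurable_funM => //; exact: measurable_funTS.
move=> u /=; rewrite in_itv/= => ut.
by rewrite lee_fin !normrM mulrC ler_wpM2r// (le_trans (gM _ ut))// ler_norm.
Qed.

Lemma bounded_integrable (a t M : R) (g : R -> R) :
  measurable_fun `[a, t] g -> (forall u, a <= u <= t -> `|g u| <= M) ->
  mu.-integrable `[a, t] (EFin \o g).
Proof.
move=> mg gM; have := @integrable_powR_bounded 1 a t M g ltr01 mg gM.
by apply: eq_integrable => // u _; rewrite /= subrr powRr0 mul1r.
Qed.

Lemma le_Rintegral_sub (a t e l : R) (g : R -> R) : a <= t ->
  mu.-integrable `[a, t] (EFin \o g) ->
  (forall u, a <= u <= t -> `|g u - l| <= e) ->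
  `|\int[mu]_(u in `[a, t]) g u - (t - a) * l| <= e * (t - a).
Proof.
move=> at_ ig gl.
have ic (k : R) : mu.-integrable `[a, t] (EFin \o cst k).
  by apply: (@bounded_integrable _ _ `|k|) => //.
have cstE (k : R) : \int[mu]_(u in `[a, t]) (cst k u) = k * (t - a).
  rewrite Rintegral_cst//= lebesgue_measure_itv/= lte_fin.
  case: ltP => [_//|ta]; have -> : t = a by apply/eqP; rewrite eq_le ta at_.
  by rewrite subrr.
have -> : (t - a) * l = \int[mu]_(u in `[a, t]) (cst l u) by rewrite cstE mulrC.
have -> : \int[mu]_(u in `[a, t]) g u - \int[mu]_(u in `[a, t]) (cst l u)
  = \int[mu]_(u in `[a, t]) (g u - cst l u) by rewrite RintegralB.
have ib : mu.-integrable `[a, t] (EFin \o (fun u => g u - cst l u)).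
  exact: (integrableB _ ig (ic l)).
rewrite (le_trans (le_normr_Rintegral _ ib))//.
rewrite -cstE; apply: le_Rintegral => //.
  exact: (integrable_abse ib).
Qed.

(** Quantitative differentiability of a primitive at t. Both signs of s - t are treated, so that the
    derivative relative to [t0, t1] is covered at interior points and at the ends. *)
Lemma Rintegral_increment (t0 t1 s t e l : R) (g : R -> R) :
  mu.-integrable `[t0, t1] (EFin \o g) -> t0 <= s <= t1 -> t0 <= t <= t1 ->
  (forall u, t0 <= u <= t1 -> `|u - t| <= `|s - t| -> `|g u - l| <= e) ->
  `|\int[mu]_(u in `[t0, s]) g u - \int[mu]_(u in `[t0, t]) g u - (s - t) * l| <=
    e * `|s - t|.
Proof.
move=> ig.
have inc x y : t0 <= x -> x <= y -> y <= t1 ->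
    \int[mu]_(u in `[t0, y]) g u - \int[mu]_(u in `[t0, x]) g u = \int[mu]_(u in `[x, y]) g u.
  move=> tx xy yt; rewrite Rintegral_itvB ?bnd_simp//.
    rewrite Rintegral_itv_obnd_cbnd//.
    apply: integrableS ig => // u /=; rewrite !in_itv/= => /andP[h1 h2].
    by rewrite (le_trans tx (ltW h1)) (le_trans h2 yt).
  apply: integrableS ig => // u /=; rewrite !in_itv/= => /andP[-> h2].
  by rewrite (le_trans h2 yt).
have igS x y : t0 <= x -> y <= t1 -> mu.-integrable `[x, y] (EFin \o g).
  move=> tx yt; apply: integrableS ig => // u /=; rewrite !in_itv/= => /andP[h1 h2].
  by rewrite (le_trans tx h1) (le_trans h2 yt).
move=> /andP[s0 s1] /andP[tt0 tt1] gl.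
have [ts|st] := leP t s.
  have -> : `|s - t| = s - t by rewrite ger0_norm ?subr_ge0.
  rewrite inc//; apply: le_Rintegral_sub => //; first exact: igS.
  move=> u /andP[u1 u2]; apply: gl; first by rewrite (le_trans tt0 u1) (le_trans u2 s1).
  by rewrite !ger0_norm ?subr_ge0// lerD2r.
have st' := ltW st.
rewrite (_ : _ - _ - _ = - (\int[mu]_(u in `[t0, t]) g u - \int[mu]_(u in `[t0, s]) g u
   - (t - s) * l)); last by ring.
have -> : `|s - t| = t - s by rewrite distrC ger0_norm ?subr_ge0.
rewrite normrN inc//; apply: le_Rintegral_sub => //; first exact: igS.
move=> u /andP[u1 u2]; apply: gl; first by rewrite (le_trans s0 u1) (le_trans u2 tt1).
by rewrite distrC ger0_norm ?subr_ge0// distrC ger0_norm ?subr_ge0// lerD2l lerN2.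
Qed.

End weighted_integrals.

(** * Composition of Riemann-Liouville integrals *)

Section riemann_liouville.
Context {R : realType}.
Notation mu := (@lebesgue_measure R).

(** One coordinate of the Riemann-Liouville integral without its factor 1 / Gamma, which [RLintE]
    restores. *)
Definition RLreal (a t0 : R) (f : R -> R) (t : R) : R :=
  \int[mu]_(s in `[t0, t]) ((t - s) `^ (a - 1) * f s).

Lemma RLreal_eq (a t0 t1 t : R) (f g : R -> R) : t <= t1 ->
  (forall s, t0 <= s <= t1 -> f s = g s) -> RLreal a t0 f t = RLreal a t0 g t.
Proof.
move=> tt fg; apply: eq_Rintegral => s; rewrite inE/= in_itv/= => /andP[s0 st].
by rewrite fg// s0 (le_trans st tt).
Qed.

Lemma RLreal_fin (a t0 t1 t M : R) (f : R -> R) : 0 < a -> t <= t1 ->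
  measurable_fun `[t0, t1] f -> (forall u, t0 <= u <= t1 -> `|f u| <= M) ->
  (RLreal a t0 f t)%:E = (\int[mu]_(s in `[t0, t]) ((t - s) `^ (a - 1) * f s)%:E)%E.
Proof.
move=> a0 tt mf fM; rewrite fineK//; apply: integrable_fin_num => //.
apply: (@integrable_powR_bounded _ a t0 t M) => //.
  by apply: measurable_funS mf => // u /=; rewrite !in_itv/= => /andP[-> /le_trans->].
by move=> u /andP[u0 ut]; rewrite fM// u0 (le_trans ut tt).
Qed.

Lemma RLreal_lin (a t0 t1 t M N k l : R) (f g : R -> R) : 0 < a -> t <= t1 ->
  measurable_fun `[t0, t1] f -> (forall u, t0 <= u <= t1 -> `|f u| <= M) ->
  measurable_fun `[t0, t1] g -> (forall u, t0 <= u <= t1 -> `|g u| <= N) ->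
  RLreal a t0 (fun s => k * f s + l * g s) t = k * RLreal a t0 f t + l * RLreal a t0 g t.
Proof.
move=> a0 tt mf fM mg gN.
have int (h : R -> R) (K : R) : measurable_fun `[t0, t1] h -> (forall u, t0 <= u <= t1 -> `|h u| <= K) ->
    mu.-integrable `[t0, t] (EFin \o (fun s => (t - s) `^ (a - 1) * h s)).
  move=> mh hK; apply: (@integrable_powR_bounded _ a t0 t K) => //.
    by apply: measurable_funS mh => // u /=; rewrite !in_itv/= => /andP[-> /le_trans->].
  by move=> u /andP[u0 ut]; rewrite hK// u0 (le_trans ut tt).
have intf := int f M mf fM; have intg := int g N mg gN.
rewrite /RLreal -RintegralZl// -RintegralZl// -RintegralD//; last 2 first.
- exact: (integrableZl _ k intf).
- exact: (integrableZl _ l intg).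
apply: eq_Rintegral => s _; ring.
Qed.

Variables (al : R).
Hypotheses (al0 : 0 < al) (al1 : al < 1).

Let be := fine (betae (1 - al) al).

(** The semigroup law for orders al and 1 - al: Tonelli on the triangle t0 <= r <= s <= t, where
    integrating the two kernels in s gives the constant B(1 - al, al). The integrability claim is
    what allows differences to be taken for signed functions. *)
Lemma RLreal_comp_nonneg (t0 t M : R) (g : R -> R) : measurable_fun [set: R] g ->
  (forall x, 0 <= g x) -> (forall x, g x <= M) ->
  mu.-integrable `[t0, t] (EFin \o (fun s => (t - s) `^ (1 - al - 1) * RLreal al t0 g s)) /\
  RLreal (1 - al) t0 (RLreal al t0 g) t = be * \int[mu]_(r in `[t0, t]) g r.
Proof.
move=> mg g0 gM.
have gM' u : `|g u| <= M by rewrite ger0_norm.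
have be_fin : be%:E = betae (1 - al) al.
  rewrite fineK// ge0_fin_numE.
    by apply: betae_lty => //; rewrite subr_gt0.
  by apply: integral_ge0 => u _; rewrite lee_fin mulr_ge0// powR_ge0.
have RLE s : (RLreal al t0 g s)%:E =
    (\int[mu]_(r in `[t0, s]) ((s - r) `^ (al - 1) * g r)%:E)%E.
  apply: (@RLreal_fin _ t0 s s M) => //; exact: measurable_funTS.
(* With p = (s, r), the indicators extend the double integrand by 0 outside the triangle, so that
   Tonelli applies on the whole plane. *)
pose k (p : R * R) : R := \1_(`[t0, +oo[%classic : set R) p.2 * \1_(`[0, +oo[%classic : set R) (p.1 - p.2) *
  \1_(`]-oo, t]%classic : set R) p.1 *
  ((t - p.1) `^ (1 - al - 1) * ((p.1 - p.2) `^ (al - 1) * g p.2)).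
have k0 p : 0 <= k p.
  by rewrite /k !mulr_ge0// ?powR_ge0// indicE.
have mk : measurable_fun [set: R * R] k.
  have m1 : measurable_fun [set: R * R] (fun p => p.1 : R) by exact: measurable_fst.
  have m2 : measurable_fun [set: R * R] (fun p => p.2 : R) by exact: measurable_snd.
  have m12 : measurable_fun [set: R * R] (fun p => p.1 - p.2 : R) by exact: measurable_funB.
  have mt1 : measurable_fun [set: R * R] (fun p => t - p.1 : R) by exact: measurable_funB.
  have mind (A : set R) (h : R * R -> R) : measurable A -> measurable_fun [set: R * R] h ->
    measurable_fun [set: R * R] (fun p => \1_A (h p) : R).
    by move=> mA mh; apply: (@measurableT_comp _ _ _ _ _ _ (\1_A : R -> R)).
  have mpow q (h : R * R -> R) : measurable_fun [set: R * R] h ->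
    measurable_fun [set: R * R] (fun p => h p `^ q).
    by move=> mh; apply: (@measurableT_comp _ _ _ _ _ _ (@powR R ^~ q)).
  apply: measurable_funM; last first.
    apply: measurable_funM; first exact: mpow.
    apply: measurable_funM; first exact: mpow.
    exact: (@measurableT_comp _ _ _ _ _ _ g).
  apply: measurable_funM; last exact: mind.
  by apply: measurable_funM; apply: mind.
have mkE : measurable_fun [set: R * R] (fun p => (k p)%:E) by apply/measurable_EFinP.
have kE0 p : (0 <= (k p)%:E)%E by rewrite lee_fin.
have F1 s : `[t0, t]%classic s -> (\int[mu]_r (k (s, r))%:E =
    ((t - s) `^ (1 - al - 1) * RLreal al t0 g s)%:E)%E.
  rewrite /= in_itv/= => /andP[s0 st].
  rewrite EFinM RLE -ge0_integralZl; last 4 first.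
  - exact: measurable_itv.
  - apply/measurable_EFinP/measurable_funTS; apply: measurable_funM => //.
    by apply: (@measurableT_comp _ _ _ _ _ _ (@powR R ^~ (al - 1))) => //; exact: measurable_funB.
  - by move=> r _; rewrite lee_fin mulr_ge0// powR_ge0.
  - by rewrite lee_fin powR_ge0.
  rewrite [RHS]integral_mkcond; apply: eq_integral => r _.
  rewrite patchE mem_setE in_itv/= /k/= !indicE !mem_setE !in_itv/= !andbT st mulr1 subr_ge0.
  by case: (t0 <= r); case: (r <= s); rewrite ?mul1r ?mul0r.
have F2 s : ~ `[t0, t]%classic s -> (\int[mu]_r (k (s, r))%:E = 0)%E.
  rewrite /= in_itv/= => /negP st.
  apply: integral0_eq => r _; congr EFin.
  rewrite /k/= !indicE !mem_setE !in_itv/= !andbT subr_ge0.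
  have [h1|] := boolP (t0 <= r); rewrite ?mul0r//.
  have [h2|] := boolP (r <= s); rewrite ?mulr0 ?mul0r//.
  have [h3|] := boolP (s <= t); rewrite ?mulr0 ?mul0r//.
  by rewrite (le_trans h1 h2) h3 in st.
have G1 r : t0 <= r < t -> (\int[mu]_s (k (s, r))%:E = be%:E * (g r)%:E)%E.
  move=> /andP[r0 rt].
  have := integral_beta_kernel (1 - al) al rt.
  rewrite (_ : 1 - al + al - 1 = 0); last by ring.
  rewrite powRr0 mul1e -be_fin => <-.
  rewrite -ge0_integralZr; last 4 first.
  - exact: measurable_itv.
  - by apply/measurable_EFinP/measurable_funTS; exact: measurable_beta_kernel.
  - by move=> u _; rewrite lee_fin mulr_ge0// powR_ge0.
  - by rewrite lee_fin.
  rewrite [RHS]integral_mkcond; apply: eq_integral => s _.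
  rewrite patchE mem_setE in_itv/= /k/= !indicE !mem_setE !in_itv/= !andbT r0 mul1r subr_ge0.
  by case: (r <= s); case: (s <= t); rewrite /= ?mul1r ?mul0r// mulrA EFinM.
have G2 r : ~ (t0 <= r <= t) -> (\int[mu]_s (k (s, r))%:E = 0)%E.
  move=> /negP rt.
  apply: integral0_eq => s _; congr EFin.
  rewrite /k/= !indicE !mem_setE !in_itv/= !andbT subr_ge0.
  have [h1|] := boolP (t0 <= r); rewrite ?mul0r//.
  have [h2|] := boolP (r <= s); rewrite ?mulr0 ?mul0r//.
  have [h3|] := boolP (s <= t); rewrite ?mulr0 ?mul0r//.
  by rewrite h1 (le_trans h2 h3) in rt.
have ft : (\int[mu]_s \int[mu]_r (k (s, r))%:E = \int[mu]_r \int[mu]_s (k (s, r))%:E)%E.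
  exact: (@fubini_tonelli _ _ _ _ R mu mu _ mkE kE0).
(* The value r = t is excluded from [G1], whose beta integral needs r < t; there the section lives
   on the single point s = t. *)
have G3 : (\int[mu]_s (k (s, t))%:E = 0)%E.
  rewrite -[RHS](integral_set1 (fun s => (k (s, t))%:E) t) [RHS]integral_mkcond.
  apply: eq_integral => s _; rewrite patchE; case: ifPn => // /negP st.
  rewrite /k/= !indicE !mem_setE !in_itv/= !andbT subr_ge0.
  have [h2|] := boolP (t <= s); rewrite ?mulr0 ?mul0r//.
  have [h3|] := boolP (s <= t); rewrite ?mulr0 ?mul0r//.
  by exfalso; apply: st; apply/mem_set/eqP; rewrite eq_le h2 h3.
have L : (\int[mu]_s \int[mu]_r (k (s, r))%:E =
    \int[mu]_(s in `[t0, t]) ((t - s) `^ (1 - al - 1) * RLreal al t0 g s)%:E)%E.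
  rewrite [RHS]integral_mkcond; apply: eq_integral => s _.
  rewrite patchE; case: ifPn => [/set_mem /F1//|/negP st].
  by apply: F2 => /mem_set.
have ig : mu.-integrable `[t0, t] (EFin \o g).
  by apply: (@bounded_integrable _ _ _ M) => //; exact: measurable_funTS.
have Rr : (\int[mu]_r \int[mu]_s (k (s, r))%:E = be%:E * \int[mu]_(r in `[t0, t]) (g r)%:E)%E.
  rewrite -integral_itv_bndo_bndc; last by apply/measurable_EFinP; exact: measurable_funTS.
  rewrite -ge0_integralZl; last 4 first.
  - exact: measurable_itv.
  - by apply/measurable_EFinP; exact: measurable_funTS.
  - by move=> r _; rewrite lee_fin.
  - by rewrite be_fin; apply: integral_ge0 => u _; rewrite lee_fin mulr_ge0// powR_ge0.
  rewrite [RHS]integral_mkcond; apply: eq_integral => r _.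
  rewrite patchE mem_setE in_itv/=; case: ifPn => [/G1//|/negP rt].
  have [->//|rt'] := eqVneq r t; apply: G2 => /andP[h1 h2]; apply: rt.
  by rewrite h1 lt_neqAle rt' h2.
have mRL : measurable_fun `[t0, t] (fun s => (t - s) `^ (1 - al - 1) * RLreal al t0 g s).
  apply/measurable_EFinP.
  have mF : measurable_fun [set: R] (fun s => \int[mu]_r (k (s, r))%:E)%E.
    exact: (@measurable_fun_fubini_tonelli_F _ _ _ _ R mu _ mkE kE0).
  apply: eq_measurable_fun (measurable_funTS mF) => s /set_mem sT.
  exact: F1.
have RL0 s : 0 <= RLreal al t0 g s.
  by apply: Rintegral_ge0 => r _; rewrite mulr_ge0// powR_ge0.
have E : (\int[mu]_(s in `[t0, t]) ((t - s) `^ (1 - al - 1) * RLreal al t0 g s)%:E =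
   (be * \int[mu]_(r in `[t0, t]) g r)%:E)%E.
  rewrite -L ft Rr EFinM; congr (_ * _)%E.
  by rewrite /Rintegral fineK//; exact: integrable_fin_num.
split; last by rewrite /RLreal /Rintegral E.
apply/integrableP; split; first exact/measurable_EFinP.
under eq_integral do rewrite /= ger0_norm ?mulr_ge0 ?powR_ge0//.
by rewrite E ltry.
Qed.

(** On [t0, t1], f is the difference of the bounded nonnegative functions f + N and N, to which the
    nonnegative case applies; [g1] extends the first of them to the whole line. *)
Lemma RLreal_comp (t0 t1 t M : R) (f : R -> R) : t <= t1 ->
  measurable_fun `[t0, t1] f -> (forall u, t0 <= u <= t1 -> `|f u| <= M) ->
  mu.-integrable `[t0, t] (EFin \o (fun s => (t - s) `^ (1 - al - 1) * RLreal al t0 f s)) /\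
  RLreal (1 - al) t0 (RLreal al t0 f) t = be * \int[mu]_(r in `[t0, t]) f r.
Proof.
move=> tt mf fM; pose N : R := `|M|.
pose g1 := fun x => (f \_ `[t0, t1]) x + N.
have mg1 : measurable_fun [set: R] g1.
  apply: measurable_funD => //.
  by apply/(measurable_restrictT _ (measurable_itv _)).
have mg2 : measurable_fun [set: R] (cst N : R -> R) by [].
have fN u : `|(f \_ `[t0, t1]) u| <= N.
  rewrite patchE; case: ifPn => [|_]; last by rewrite normr0 normr_ge0.
  rewrite mem_setE in_itv/= => /fM /le_trans; apply; exact: ler_norm.
have g10 x : 0 <= g1 x.
  by rewrite /g1 -lerBlDr sub0r; move: (fN x); rewrite ler_norml => /andP[].
have g1N x : g1 x <= N + N.
  by rewrite /g1 lerD2r (le_trans _ (fN x))// ler_norm.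
have g20 x : 0 <= (cst N : R -> R) x by exact: normr_ge0.
have g2N x : (cst N : R -> R) x <= N by [].
have [i1 e1] := RLreal_comp_nonneg t0 t mg1 g10 g1N.
have [i2 e2] := RLreal_comp_nonneg t0 t mg2 g20 g2N.
have fE s : t0 <= s <= t1 -> f s = 1 * g1 s + (-1) * (cst N s).
  by move=> sT; rewrite /g1 patchE mem_set/= ?in_itv//=; ring.
have inner s : s <= t -> RLreal al t0 f s = RLreal al t0 g1 s - RLreal al t0 (cst N) s.
  move=> st; have st1 := le_trans st tt.
  rewrite (RLreal_eq al st1 fE) (@RLreal_lin al t0 t1 s (N + N) N)//.
  - by rewrite mul1r mulN1r.
  - exact: measurable_funTS.
  - by move=> u _; rewrite ger0_norm.
  - by move=> u _; rewrite ger0_norm.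
have ib1 : mu.-integrable `[t0, t] (EFin \o g1).
  apply: (@bounded_integrable _ _ _ (N + N)); first exact: measurable_funTS.
  by move=> u _; rewrite ger0_norm.
have ib2 : mu.-integrable `[t0, t] (EFin \o (cst N : R -> R)).
  by apply: (@bounded_integrable _ _ _ N) => // u _; rewrite ger0_norm.
split.
  apply: eq_integrable (integrableB _ i1 i2) => // s.
  rewrite inE/= in_itv/= => /andP[_ st].
  by rewrite inner// mulrBr EFinB.
transitivity (RLreal (1 - al) t0 (RLreal al t0 g1) t - RLreal (1 - al) t0 (RLreal al t0 (cst N)) t).
  rewrite /RLreal -RintegralB//; apply: eq_Rintegral => s.
  rewrite inE/= in_itv/= => /andP[_ st]; rewrite -mulrBr -inner//.
rewrite e1 e2 -mulrBr -RintegralB//; congr (_ * _); apply: eq_Rintegral => s.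
rewrite inE/= in_itv/= => /andP[s0 st]; by rewrite (fE s) ?s0 ?(le_trans st tt)// mul1r mulN1r.
Qed.

End riemann_liouville.

(** * Piecewise continuous functions and Caputo derivatives of their fractional integrals *)

Section piecewise_continuous.
Context {R : realType} {n : nat}.
Notation mu := (@lebesgue_measure R).
Implicit Types (psi : R -> 'rV[R]_n).

Lemma le_entry_mx_norm (v : 'rV[R]_n) i : `|v 0 i| <= `|v|.
Proof.
rewrite [leRHS]mx_normrE; exact: (@le_bigmax _ _ _ 0 (fun ij => `|v ij.1 ij.2|) (ord0, i)).
Qed.

Lemma mx_norm_le (v : 'rV[R]_n) e : 0 <= e -> (forall i, `|v 0 i| <= e) -> `|v| <= e.
Proof.
move=> e0 ve; rewrite [leLHS]mx_normrE; apply/bigmax_leP; split=> // -[i j] _ /=.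
by rewrite (ord1 i).
Qed.

Lemma norm_le_dist (v w : 'rV[R]_n) : `|v| <= `|w| + `|w - v|.
Proof. by rewrite -[v in leLHS](subKr w) ler_normB. Qed.

Lemma near_sides (t : R) (Q : set R) : (\forall s \near t^'-, Q s) ->
  (\forall s \near t^'+, Q s) -> Q t -> \forall s \near t, Q s.
Proof.
rewrite /at_left /at_right !near_withinE => h1 h2 Qt; near=> s.
have [st|ts|->//] := ltgtP s t.
- by move: st; near: s.
- by move: ts; near: s.
Unshelve. all: by end_near. Qed.

Lemma PC_bounded (t0 t1 : R) psi : PC t0 t1 psi ->
  exists M, forall t, t0 <= t <= t1 -> `|psi t| <= M.
Proof.
move=> [s [sP cP]].
have [||M M0 hM] := @segment_uniform R t0 t1 (fun M t => `|psi t| <= M) _ _; last by exists M.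
  by move=> M M' t MM' /le_trans; apply.
move=> t tT; have [ts|ts] := boolP (t \in s).
  have [_ /cvg_ex[l /cvgrPdist_le lP] /cvg_ex[r /cvgrPdist_le rP]] := sP _ ts.
  (* At an exceptional point the value of psi is unrelated to its one-sided limits, so three bounds
     are added. *)
  exists (`|psi t| + (`|l| + 1) + (`|r| + 1)).
  apply: near_sides => [||_].
  - near=> u => _; rewrite (le_trans (norm_le_dist _ l))//.
    have : `|l - psi u| <= 1 by near: u; exact: lP.
    have := normr_ge0 (psi t); have := normr_ge0 r; lra.
  - near=> u => _; rewrite (le_trans (norm_le_dist _ r))//.
    have : `|r - psi u| <= 1 by near: u; exact: rP.
    have := normr_ge0 (psi t); have := normr_ge0 l; lra.
  - have := normr_ge0 l; have := normr_ge0 r; lra.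
exists (`|psi t| + 1).
have /cvgrPdist_le/(_ 1 ltr01) := cP t tT ts.
rewrite near_withinE; apply: filterS => u h uT.
by rewrite (le_trans (norm_le_dist _ (psi t)))// lerD2l h//= in_itv.
Unshelve. all: by end_near. Qed.

Lemma measurable_fun_off_seq (A : set R) (s : seq R) (f : R -> R) : measurable A ->
  measurable_fun (A `\` [set` s]) f -> measurable_fun A f.
Proof.
move=> mA; elim: s => [|x s IH]; first by rewrite set_nil setD0.
move=> mf; apply: IH.
have mfin (s' : seq R) : measurable [set` s'].
  by apply: countable_measurable => //; exact/finite_set_countable/finite_seq.
apply: (@measurable_funS _ _ _ _ ((A `\` [set` x :: s]) `|` [set x])).
- by apply: measurableU => //; exact: measurableD.
- move=> u [/= Au us]; have [->|ux] := eqVneq u x; [by right|left; split=> //=].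
  by rewrite inE (negbTE ux).
- apply/measurable_funU => //; [exact: measurableD|split=> //].
  move=> _ Y mY; have [Yx|Yx] := pselect (Y (f x)).
    rewrite (_ : _ `&` _ = [set x]); first exact: measurable_set1.
    by apply/seteqP; split=> [u []//|u /= ->].
  by rewrite (_ : _ `&` _ = set0)//; apply/seteqP; split=> [u [/= ->]|].
Qed.

Lemma measurable_fun_cont_off (t0 t1 : R) (s : seq R) (f : R -> R) :
  (forall t, t0 <= t <= t1 -> t \notin s -> f @ within `[t0, t1] (nbhs t) --> f t) ->
  measurable_fun `[t0, t1] f.
Proof.
move=> cP; apply: (@measurable_fun_off_seq _ s) => //.
have mfin : measurable [set` s].
  by apply: countable_measurable => //; exact/finite_set_countable/finite_seq.
apply: subspace_continuous_measurable_fun; first exact: measurableD.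
apply/subspace_continuousP => t [/= tT ts].
apply: cvg_trans (cP t _ _); [|by rewrite in_itv/= in tT|by apply/negP].
by apply: cvg_app; apply: within_subset => u [].
Qed.

Lemma entry_continuous_in (t0 t1 : R) psi t i : continuous_at_in t0 t1 psi t ->
  (fun u => psi u 0 i) @ within `[t0, t1] (nbhs t) --> psi t 0 i.
Proof.
move=> c; apply: (@cvg_comp _ _ _ psi (fun v : 'rV[R]_n => v 0 i) _ (nbhs (psi t))) => //.
exact: coord_continuous.
Qed.

Lemma PC_measurable (t0 t1 : R) psi i : PC t0 t1 psi ->
  measurable_fun `[t0, t1] (fun t => psi t 0 i).
Proof.
move=> [s [_ cP]]; apply: (@measurable_fun_cont_off t0 t1 s) => t tT ts.
exact: entry_continuous_in (cP t tT ts).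
Qed.

(** [derive_in] is a [lim] along this filter; properness is what lets convergence determine its
    value. A nearby point is taken to the right of t, or to the left when t = t1. *)
Lemma within_dnbhs_proper (t0 t1 t : R) : t0 < t1 -> t0 <= t <= t1 ->
  ProperFilter (within `[t0, t1] t^').
Proof.
move=> t01 /andP[tt0 tt1]; apply: Build_ProperFilter.
case=> d /= d0 hd.
have [tlt|] := ltP t t1.
  pose m := Num.min d (t1 - t) / 2.
  have m0 : 0 < m by rewrite divr_gt0// lt_min d0 subr_gt0.
  have [md mt] : m < d /\ m < t1 - t.
    split; rewrite /m ltr_pdivrMr// ?mulr_natr ?mulr2n.
      by rewrite (@le_lt_trans _ _ d) ?ge_min ?lexx// ltrDl.
    by rewrite (@le_lt_trans _ _ (t1 - t)) ?ge_min ?lexx ?orbT// ltrDl subr_gt0.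
  apply: (hd (t + m)) => /=.
  - by rewrite opprD addNKr normrN gtr0_norm.
  - by rewrite -subr_eq0 addrC addKr gt_eqF.
  - by rewrite in_itv/=; apply/andP; split; lra.
move=> tge; have tE : t = t1 by apply/eqP; rewrite eq_le tt1.
pose m := Num.min d (t1 - t0) / 2.
have m0 : 0 < m by rewrite divr_gt0// lt_min d0 subr_gt0.
have [md mt] : m < d /\ m < t1 - t0.
  split; rewrite /m ltr_pdivrMr// ?mulr_natr ?mulr2n.
    by rewrite (@le_lt_trans _ _ d) ?ge_min ?lexx// ltrDl.
  by rewrite (@le_lt_trans _ _ (t1 - t0)) ?ge_min ?lexx ?orbT// ltrDl subr_gt0.
apply: (hd (t - m)) => /=.
- by rewrite opprB addrC subrK gtr0_norm.
- by rewrite -subr_eq0 addrC addKr oppr_eq0 gt_eqF.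
- by rewrite in_itv/=; apply/andP; split; lra.
Qed.

Lemma derive_in_primitive (t0 t1 c t : R) (psi G : R -> 'rV[R]_n) : t0 < t1 ->
  PC t0 t1 psi -> t0 <= t <= t1 -> continuous_at_in t0 t1 psi t ->
  (forall s i, t0 <= s <= t1 -> G s 0 i = G t0 0 i + c * \int[mu]_(r in `[t0, s]) psi r 0 i) ->
  derive_in t0 t1 G t = c *: psi t.
Proof.
move=> t01 PCpsi tT cpsi GE.
have pf := within_dnbhs_proper t01 tT.
apply: cvg_lim => //; apply/cvgrPdist_le => e e0.
have c1 : 0 < `|c| + 1 by rewrite ltr_wpDl.
(* The 1 keeps the denominator positive when c = 0. *)
pose e' := e / (`|c| + 1).
have e'0 : 0 < e' by rewrite divr_gt0.
have /cvgrPdist_le/(_ _ e'0) := cpsi.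
rewrite near_withinE => -[d /= d0 hd].
rewrite near_withinE /dnbhs near_withinE.
exists d => // s /= sd st; rewrite in_itv/= => sT.
have st0 : s - t != 0 by rewrite subr_eq0.
apply: mx_norm_le => [|i]; first exact: ltW.
have [M hM] := PC_bounded PCpsi.
have ig : mu.-integrable `[t0, t1] (EFin \o (fun r => psi r 0 i)).
  apply: (@bounded_integrable _ _ _ M); first exact: PC_measurable.
  by move=> u uT; rewrite (le_trans (le_entry_mx_norm _ _))// hM.
have loc u : t0 <= u <= t1 -> `|u - t| <= `|s - t| -> `|psi u 0 i - psi t 0 i| <= e'.
  move=> uT us; have ud : `|t - u| < d.
    by rewrite distrC (le_lt_trans us)// distrC.
  have := hd u ud; rewrite /= in_itv/= => /(_ uT); apply: le_trans.
  by rewrite distrC (le_trans _ (le_entry_mx_norm _ i))// !mxE.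
have := Rintegral_increment ig sT tT loc.
rewrite !mxE (GE s)// (GE t)//.
set A := Rintegral _ _ _; set B := Rintegral _ _ _; move=> AB.
(* The error of the difference quotient is a multiple of the increment bounded by
   [Rintegral_increment]. *)
rewrite (_ : _ - _ = - (c / (s - t)) * (A - B - (s - t) * psi t 0 i)); last by field.
rewrite normrM normrN normf_div -mulrA -[leRHS]mul1r.
have stp : 0 < `|s - t| by rewrite normr_gt0.
rewrite mul1r (@le_trans _ _ (`|c| * e'))//.
  by rewrite ler_wpM2l// ler_pdivrMl// [leRHS]mulrC.
rewrite /e' mulrCA ler_piMr ?(ltW e0)// ler_pdivrMr// mul1r lerDl//.
Qed.

Lemma RLintE (a t0 t : R) psi i : RLint t0 a psi t 0 i = (Gamma a)^-1 * RLreal a t0 (fun s => psi s 0 i) t.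
Proof. by rewrite mxE. Qed.

(* By the identity B(1 - al, al) = Gamma (1 - al) * Gamma al the constant is 1; only its
   positivity matters below. *)
Lemma caputo_density (al t0 t1 : R) : t0 < t1 -> 0 < al <= 1 ->
  exists2 c : R, 0 < c & forall phi psi, PC t0 t1 psi ->
    (forall t, t0 <= t <= t1 -> phi t = phi t0 + RLint t0 al psi t) ->
    forall t, t0 <= t <= t1 -> continuous_at_in t0 t1 psi t ->
    caputo t0 t1 al phi t = c *: psi t.
Proof.
move=> t01 al01; have Ga := Gamma_gt0 al01; have /andP[al0 al1] := al01.
rewrite /caputo; have [alE|aln] := eqVneq al 1.
  exists (Gamma al)^-1; first by rewrite invr_gt0.
  move=> phi psi PCpsi phiE t tT cpsi; apply: (derive_in_primitive t01 PCpsi) => // s i sT.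
  rewrite phiE// mxE RLintE; congr (_ + _ * _); apply: eq_Rintegral => r _.
  by rewrite alE subrr powRr0 mul1r.
have {}al1 : al < 1 by rewrite lt_neqAle aln.
have al01' : 0 < 1 - al <= 1 by rewrite subr_gt0 al1 lerBlDr lerDl ltW.
have Ga' := Gamma_gt0 al01'.
have be0 : 0 < fine (betae (1 - al) al).
  apply: fine_gt0; rewrite betae_lty ?subr_gt0// andbT.
  by rewrite (lt_le_trans _ (betae_ge1 al01' al01))// lte_fin ltr01.
exists ((Gamma (1 - al))^-1 * (Gamma al)^-1 * fine (betae (1 - al) al)).
  by rewrite !mulr_gt0// invr_gt0.
move=> phi psi PCpsi phiE t tT cpsi; apply: (derive_in_primitive t01 PCpsi) => // s i sT.
have [M hM] := PC_bounded PCpsi.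
have bd u : t0 <= u <= t1 -> `|psi u 0 i| <= M.
  by move=> uT; rewrite (le_trans (le_entry_mx_norm _ _))// hM.
have mpsi := PC_measurable i PCpsi.
(* By the composition law, the function differentiated by [caputo] is a constant multiple of the
   primitive of psi. *)
have main u : t0 <= u <= t1 -> RLint t0 (1 - al) (fun v => phi v - phi t0) u 0 i =
    (Gamma (1 - al))^-1 * (Gamma al)^-1 * fine (betae (1 - al) al) *
      \int[mu]_(r in `[t0, u]) psi r 0 i.
  move=> /andP[u0 u1]; rewrite RLintE -!mulrA; congr (_ * _).
  have [iR <-] := RLreal_comp al0 al1 u1 mpsi bd.
  rewrite -RintegralZl//.
  apply: eq_Rintegral => v; rewrite inE/= in_itv/= => /andP[v0 vu].
  by rewrite !mxE phiE ?v0 ?(le_trans vu)// mxE addrAC subrr add0r RLintE mulrCA.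
rewrite main// main; last by rewrite lexx ltW.
by rewrite set_itv1 Rintegral_set1 mulr0 add0r.
Qed.

End piecewise_continuous.

(** * Needles *)

Section power_bounds.
Context {R : realType}.
Implicit Types (x y u v q al : R).

Lemma le0_ler_powR q x y : q <= 0 -> 0 < x -> x <= y -> y `^ q <= x `^ q.
Proof.
move=> q0 x0 xy; have y0 := lt_le_trans x0 xy.
rewrite -[q]opprK !(powRN _ (- q)) lef_pV2 ?posrE ?powR_gt0//.
by apply: ge0_ler_powR; rewrite ?nnegrE ?oppr_ge0// ltW.
Qed.

(** Adding the two end values spares a discussion of the sign of q, which is unknown where this is
    used. *)
Lemma powR_between q x y z : 0 < x -> x <= y -> y <= z -> y `^ q <= x `^ q + z `^ q.
Proof.
move=> x0 xy yz; have y0 := lt_le_trans x0 xy; have z0 := lt_le_trans y0 yz.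
have [q0|q0] := leP 0 q.
  rewrite -[leLHS]add0r lerD ?powR_ge0//.
  by apply: ge0_ler_powR; rewrite ?nnegrE// ltW.
by rewrite -[leLHS]addr0 lerD ?powR_ge0// le0_ler_powR// ltW.
Qed.

Lemma powR_MVT al u v : 0 < v -> v <= u ->
  exists2 xi, v <= xi <= u & u `^ al - v `^ al = al * xi `^ (al - 1) * (u - v).
Proof.
move=> v0 vu; have pos x : v <= x -> 0 < x by exact: lt_le_trans.
have [||xi] := @MVT_segment R (@powR R ^~ al) (fun x => al * x `^ (al - 1)) v u vu.
- move=> x; rewrite in_itv/= => /andP[/ltW/pos x0 _]; exact: is_derive1_powR.
- apply: continuous_in_subspaceT => x; rewrite inE/= in_itv/= => /andP[/pos x0 _].
  exact: powR_continuous_gt0.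
by rewrite in_itv/= => xiv E; exists xi.
Qed.

(** Concavity of the power: its derivative is nonincreasing, so the slope is at most the one at v
    and, in [powR_sub_ge], at least the one at u. *)
Lemma powR_sub_le al u v : 0 < al <= 1 -> 0 < v -> v <= u ->
  u `^ al - v `^ al <= al * v `^ (al - 1) * (u - v).
Proof.
move=> /andP[al0 al1] v0 vu; have [xi /andP[v_xi xiu] ->] := powR_MVT al v0 vu.
rewrite ler_wpM2r ?subr_ge0// ler_wpM2l ?(ltW al0)//.
by rewrite le0_ler_powR// subr_le0.
Qed.

Lemma powR_sub_ge al u v : 0 < al <= 1 -> 0 < v -> v <= u ->
  al * u `^ (al - 1) * (u - v) <= u `^ al - v `^ al.
Proof.
move=> /andP[al0 al1] v0 vu; have [xi /andP[v_xi xiu] ->] := powR_MVT al v0 vu.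
rewrite ler_wpM2r ?subr_ge0// ler_wpM2l ?(ltW al0)//.
by rewrite le0_ler_powR// ?subr_le0// (lt_le_trans v0).
Qed.

(** A fraction in [0, 1] is at most its power al; applied to x / (x + y) and y / (x + y), whose sum
    is 1. *)
Lemma powR_subadditive al x y : 0 < al <= 1 -> 0 <= x -> 0 <= y ->
  (x + y) `^ al <= x `^ al + y `^ al.
Proof.
move=> /andP[al0 al1] x0 y0.
have [->|xn0] := eqVneq x 0; first by rewrite powR0 ?gt_eqF// !add0r.
have xp : 0 < x by rewrite lt_neqAle eq_sym xn0.
have s0 : 0 < x + y by rewrite ltr_wpDr.
have key z : 0 <= z <= x + y -> z / (x + y) * (x + y) `^ al <= z `^ al.
  move=> /andP[z0 zs]; have [->|zn0] := eqVneq z 0; first by rewrite !mul0r powR_ge0.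
  have zp : 0 < z by rewrite lt_neqAle eq_sym zn0.
  have -> : z `^ al = (z / (x + y)) `^ al * (x + y) `^ al.
    by rewrite -powRM ?divr_ge0 ?(ltW s0)// divfK ?gt_eqF.
  rewrite ler_wpM2r ?powR_ge0//; apply: ger1_powR => //.
  by rewrite divr_gt0//= ler_pdivrMr// mul1r.
rewrite (le_trans _ (lerD (key x _) (key y _))) ?x0 ?y0 ?lerDl ?lerDr//.
by rewrite -mulrDl -mulrDl divff ?gt_eqF// mul1r.
Qed.

(* Halving the exponent keeps the right-hand side integrable at x = 0 while gaining a positive
   power of l. *)
Lemma powR_pred_sub_le al x l : 0 < al <= 1 -> 0 < x -> 0 < l ->
  x `^ (al - 1) - (x + l) `^ (al - 1) <= l `^ (al / 2) * x `^ (al / 2 - 1).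
Proof.
move=> /andP[al0 al1] x0 l0; have y0 : 0 < x + l by exact: addr_gt0.
have -> : (x + l) `^ (al - 1) = x `^ (al - 1) * (x / (x + l)) `^ (1 - al).
  rewrite powRM ?invr_ge0 ?ltW// mulrA -powRD ?(gt_eqF x0) ?implybT//.
  rewrite (_ : al - 1 + (1 - al) = 0) ?powRr0 ?mul1r; last by ring.
  by rewrite -powR_inv1 ?ltW// -powRrM mulN1r opprB.
rewrite -[X in X - _]mulr1 -mulrBr.
have -> : l `^ (al / 2) * x `^ (al / 2 - 1) = x `^ (al - 1) * (l / x) `^ (al / 2).
  rewrite powRM ?invr_ge0 ?ltW// -[x^-1 in RHS]powR_inv1 ?ltW// -powRrM.
  rewrite mulrCA -powRD ?(gt_eqF x0) ?implybT//; congr (_ * _ `^ _).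
  by field.
rewrite ler_wpM2l ?powR_ge0//.
have xl1 : 0 < x / (x + l) <= 1.
  by rewrite divr_gt0//= ler_pdivrMr// mul1r lerDl ltW.
(* For rho = x / (x + l) one has 1 - rho^(1 - al) <= 1 - rho = l / (x + l); a number in [0, 1] only
   grows when raised to al / 2, and so does the fraction when x + l is replaced by x. *)
apply: (@le_trans _ _ (l / (x + l))).
  rewrite (_ : l / (x + l) = 1 - x / (x + l)); last by field; rewrite gt_eqF.
  rewrite lerD2l lerN2; apply: ger1_powR => //.
  by rewrite lerBlDr lerDl ltW.
apply: (@le_trans _ _ ((l / (x + l)) `^ (al / 2))).
  apply: ger1_powR; last by rewrite ler_pdivrMr// (le_trans al1)// mul1r ler1n.
  by rewrite divr_gt0//= ler_pdivrMr// mul1r lerDr ltW.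
apply: ge0_ler_powR; rewrite ?nnegrE ?divr_ge0 ?(ltW l0) ?(ltW y0) ?(ltW x0) ?(ltW al0)//.
by rewrite ler_wpM2l ?(ltW l0)// lef_pV2 ?posrE// lerDl ltW.
Qed.

(** Arithmetic closing [needle_small]: there x and y are the width h + N h to the powers al and al /
    2, and z is 1 - N k, all at most d. The summand 2 beside the bracket is kept so that d also
    satisfies 2 d <= e, for the sup bound. *)
Lemma weighted_sum_le (x y z d e W K C b1 b2 k : R) :
  0 <= W -> 0 <= K -> 0 <= k -> 0 <= C -> 0 <= b1 -> 0 <= b2 -> 0 <= d ->
  x <= d -> y <= d -> z <= d ->
  d * (2 + (2 * W * (1 + K) + k * C * b1 + k * C * b2)) = e ->
  2 * x * W * (1 + K) + k * C * (y * b1 + z * b2) <= e.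
Proof.
move=> W0 K0 k0 C0 b10 b20 d0 xd yd zd <-.
rewrite [leLHS](_ : _ = x * (2 * W * (1 + K)) + y * (k * C * b1) + z * (k * C * b2)); last by ring.
apply: (@le_trans _ _ (d * (2 * W * (1 + K)) + d * (k * C * b1) + d * (k * C * b2))).
  by rewrite !lerD// ler_wpM2r// !mulr_ge0// addr_ge0.
by rewrite -!mulrDr ler_wpM2l// lerDr.
Qed.

End power_bounds.

(** * The scalar needle and its weighted smallness *)

Section needle.
Context {R : realType}.
Notation mu := (@lebesgue_measure R).
Variables (al : R).
Hypothesis al01 : 0 < al <= 1.
Let al0 : 0 < al. Proof. by case/andP: al01. Qed.
Let al1 : al <= 1. Proof. by case/andP: al01. Qed.

(** The truncated power, up to a constant the fractional integral of a unit step at 0. The maximum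
    is explicit because [powR] does not vanish on negative bases. *)
Definition ppow (u : R) : R := (Num.max 0 u) `^ al.

Lemma ppow_ge0 u : 0 <= ppow u. Proof. exact: powR_ge0. Qed.

Lemma ppow_pos u : 0 <= u -> ppow u = u `^ al.
Proof. by move=> u0; rewrite /ppow max_r. Qed.

Lemma ppow_neg u : u <= 0 -> ppow u = 0.
Proof. by move=> u0; rewrite /ppow max_l// powR0// gt_eqF. Qed.

Lemma ppow_mono u v : u <= v -> ppow u <= ppow v.
Proof.
move=> uv; have m0 (w : R) : 0 <= Num.max 0 w by rewrite le_max lexx.
apply: ge0_ler_powR; rewrite ?nnegrE ?m0 ?(ltW al0)//.
by rewrite ge_max m0 le_max uv orbT.
Qed.

Lemma ppow_incr u h : 0 <= h -> 0 <= ppow (u + h) - ppow u <= h `^ al.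
Proof.
move=> h0; rewrite subr_ge0 ppow_mono ?lerDl//= lerBlDr.
have [u0|u0] := leP 0 u; first by rewrite !ppow_pos ?addr_ge0// addrC powR_subadditive.
rewrite (ppow_neg (ltW u0)) addr0 -(ppow_pos h0) ppow_mono// gerDr ltW//.
Qed.

Lemma ppow_continuous : continuous ppow.
Proof.
move=> u; have [u0|u0|->] := ltgtP u 0.
- rewrite /continuous_at ppow_neg ?ltW//; apply: cvg_near_cst.
  near=> v; rewrite ppow_neg// ltW//; near: v; exact: lt_nbhsl.
- have : {for u, continuous (@powR R ^~ al)} by exact: powR_continuous_gt0.
  rewrite /continuous_at /prop_for /= ppow_pos ?ltW//; apply: cvg_trans.
  apply: near_eq_cvg; near=> v; rewrite ppow_pos//; apply: ltW; near: v; exact: lt_nbhsr.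
- rewrite /continuous_at (ppow_neg (lexx 0)); apply/cvgrPdist_le => e e0.
  near=> v; rewrite sub0r normrN ger0_norm ?ppow_ge0//.
  (* The radius e^(1 / al) is the point where the power equals e. *)
  apply: (@le_trans _ _ (ppow (e `^ al^-1))).
    apply: ppow_mono; rewrite (le_trans (ler_norm _))//.
    near: v; exists (e `^ al^-1); first exact: powR_gt0.
    by move=> v /=; rewrite sub0r normrN => /ltW.
  by rewrite ppow_pos ?powR_ge0// -powRrM mulVf ?gt_eqF// powRr1 ?(ltW e0).
Unshelve. all: by end_near. Qed.

Variables (a t1 N : R).
Hypotheses (at1 : a < t1) (N0 : 0 < N).

(* Up to the factor 1 / (Gamma al * al), needle h is the Riemann-Liouville integral of order al
   of the density equal to 1 on [a, a + h[, to - needle_ratio h on [a + h, a + h + N * h[ and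
   to 0 elsewhere; the ratio is the one that makes it vanish at t1. *)
Definition needle_ratio (h : R) : R :=
  (ppow (t1 - a) - ppow (t1 - (a + h))) / (ppow (t1 - (a + h)) - ppow (t1 - (a + h + N * h))).

Definition needle (h t : R) : R :=
  ppow (t - a) - (1 + needle_ratio h) * ppow (t - (a + h)) +
  needle_ratio h * ppow (t - (a + h + N * h)).

Section fixed_width.
Variable h : R.
Hypotheses (h0 : 0 < h) (ct1 : a + h + N * h < t1).
Let b := a + h.
Let c := a + h + N * h.
Let k := needle_ratio h.
Let Nh0 : 0 < N * h. Proof. exact: mulr_gt0. Qed.
Let ab : a < b. Proof. by rewrite /b ltrDl. Qed.
Let bc : b < c. Proof. by rewrite /c ltrDl. Qed.

(** Beyond c all three arguments are positive, so concavity compares each increment with its length.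
    At t = t1 this controls the ratio, at later t < t1 the tail. *)
Lemma needle_increments t : c < t ->
  [/\ al * (t - a) `^ (al - 1) * h <= ppow (t - a) - ppow (t - b),
      ppow (t - a) - ppow (t - b) <= al * (t - b) `^ (al - 1) * h,
      al * (t - b) `^ (al - 1) * (N * h) <= ppow (t - b) - ppow (t - c) &
      ppow (t - b) - ppow (t - c) <= al * (t - c) `^ (al - 1) * (N * h)].
Proof.
move=> ct; have tc0 : 0 < t - c by rewrite subr_gt0.
have tb0 : 0 < t - b by rewrite subr_gt0 (lt_trans bc).
have ta0 : 0 < t - a by rewrite subr_gt0 (lt_trans ab)// -subr_gt0.
rewrite (ppow_pos (ltW ta0)) (ppow_pos (ltW tb0)) (ppow_pos (ltW tc0)).
have e1 : h = (t - a) - (t - b) by rewrite /b; ring.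
have e2 : N * h = (t - b) - (t - c) by rewrite /b /c; ring.
have l1 : t - b <= t - a by rewrite lerD2l lerN2 ltW.
have l2 : t - c <= t - b by rewrite lerD2l lerN2 ltW.
split.
- by have := powR_sub_ge al01 tb0 l1; rewrite -e1.
- by have := powR_sub_le al01 tb0 l1; rewrite -e1.
- by have := powR_sub_ge al01 tc0 l2; rewrite -e2.
- by have := powR_sub_le al01 tc0 l2; rewrite -e2.
Qed.

(** The kernel (t1 - s)^(al - 1) is nondecreasing in s, so a unit of length on the second interval
    weighs at least as much at t1 as on the first: hence N k <= 1. The lower bound tends to 1 with
    h. *)
Lemma needle_ratio_bounds :
  [/\ 0 < k, N * k <= 1 & (t1 - a) `^ (al - 1) / (t1 - c) `^ (al - 1) <= N * k].
Proof.
have [A1 A2 B1 B2] := needle_increments ct1.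
have tc0 : 0 < t1 - c by rewrite subr_gt0.
have tb0 : 0 < t1 - b by rewrite subr_gt0 (lt_trans bc).
have ta0 : 0 < t1 - a by rewrite subr_gt0.
have A0 : 0 < ppow (t1 - a) - ppow (t1 - b).
  by apply: lt_le_trans A1; rewrite !mulr_gt0// powR_gt0.
have B0 : 0 < ppow (t1 - b) - ppow (t1 - c).
  by apply: lt_le_trans B1; rewrite !mulr_gt0// powR_gt0.
rewrite /k /needle_ratio -/b -/c; split; first exact: divr_gt0.
  rewrite mulrA ler_pdivrMr// mul1r (le_trans _ B1)//.
  by rewrite [leRHS]mulrCA ler_pM2l.
rewrite mulrA ler_pdivrMr ?powR_gt0// mulrAC ler_pdivlMr//.
apply: (@le_trans _ _ ((t1 - a) `^ (al - 1) * (al * (t1 - c) `^ (al - 1) * (N * h)))).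
  by rewrite ler_wpM2l ?powR_ge0.
rewrite [leLHS](_ : _ = N * (al * (t1 - a) `^ (al - 1) * h) * (t1 - c) `^ (al - 1)).
  by rewrite ler_wpM2r ?powR_ge0// ler_wpM2l// ltW.
by ring.
Qed.

Lemma needle_end : needle h t1 = 0.
Proof.
have [A1 A2 B1 B2] := needle_increments ct1.
have tb0 : 0 < t1 - b by rewrite subr_gt0 (lt_trans bc).
have B0 : 0 < ppow (t1 - b) - ppow (t1 - c).
  by apply: lt_le_trans B1; rewrite !mulr_gt0// powR_gt0.
rewrite /needle /needle_ratio -/b -/c.
by field; rewrite gt_eqF.
Qed.

Lemma needle_zero t : t <= a -> needle h t = 0.
Proof.
move=> ta; rewrite /needle !ppow_neg ?mulr0 ?addr0 ?subr0// subr_le0//.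
  by rewrite (le_trans ta)// (le_trans (ltW ab))// ltW.
by rewrite (le_trans ta)// ltW.
Qed.

Lemma needle_sup t : 1 <= N -> `|needle h t| <= 2 * (h + N * h) `^ al.
Proof.
move=> N1; have [k0 Nk1 _] := needle_ratio_bounds.
have k1 : k <= 1 by rewrite (le_trans _ Nk1)// ler_peMl// ltW.
(* One increment per interval, each controlled by [ppow_incr]. *)
have -> : needle h t = (ppow (t - a) - ppow (t - b)) - k * (ppow (t - b) - ppow (t - c)).
  by rewrite /needle -/k -/b -/c; ring.
have := ppow_incr (t - b) (ltW h0); have := ppow_incr (t - c) (ltW Nh0).
have -> : t - b + h = t - a by rewrite /b; ring.
have -> : t - c + N * h = t - b by rewrite /b /c; ring.
move=> /andP[B0 B1] /andP[A0 A1].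
have h1 : h `^ al <= (h + N * h) `^ al.
  by apply: ge0_ler_powR; rewrite ?nnegrE ?addr_ge0 ?ltW// ltrDl.
have h2 : (N * h) `^ al <= (h + N * h) `^ al.
  by apply: ge0_ler_powR; rewrite ?nnegrE ?addr_ge0 ?ltW// ltrDr.
rewrite (le_trans (ler_normB _ _))// mulr_natl mulr2n lerD//.
  by rewrite ger0_norm// (le_trans A1).
rewrite ger0_norm; last by rewrite mulr_ge0// ltW.
rewrite (le_trans _ h2)// (le_trans _ B1)//; by rewrite ler_piMl.
Qed.

(* Beyond its support the density still acts through its memory: the two contributions, each of
   order h, cancel up to the increment of (t - .)^(al - 1) and the defect 1 - N * needle_ratio h. *)
Lemma needle_tail t : c < t -> `|needle h t| <= h * (al *
   ((h + N * h) `^ (al / 2) * (t - c) `^ (al / 2 - 1) + (1 - N * k) * (t - c) `^ (al - 1))).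
Proof.
move=> ct; have [k0 Nk1 _] := needle_ratio_bounds.
have [A1 A2 B1 B2] := needle_increments ct.
have tc0 : 0 < t - c by rewrite subr_gt0.
have tb0 : 0 < t - b by rewrite subr_gt0 (lt_trans bc).
have -> : needle h t = (ppow (t - a) - ppow (t - b)) - k * (ppow (t - b) - ppow (t - c)).
  by rewrite /needle -/k -/b -/c; ring.
set A := ppow _ - _ in A1 A2 *; set B := ppow _ - _ in B1 B2 *.
have B0 : 0 <= B by rewrite (le_trans _ B1)// !mulr_ge0// ?powR_ge0// ltW.
(* B / N is the second increment brought to the length h. It is at least A because the kernel is
   nondecreasing, and 1 - N * k >= 0, so both terms have a known sign. *)
rewrite (_ : A - k * B = - (B / N - A) + (1 - N * k) * (B / N)); last first.
  by field; rewrite gt_eqF.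
have AB : 0 <= B / N - A.
  rewrite subr_ge0 ler_pdivlMr// (le_trans _ B1)//.
  by rewrite [leRHS]mulrCA mulrC ler_wpM2l// ltW.
have BN : B / N <= al * (t - c) `^ (al - 1) * h.
  by rewrite ler_pdivrMr// (le_trans B2)// [leLHS]mulrCA mulrC.
rewrite (le_trans (ler_normD _ _))// normrN (ger0_norm AB) ger0_norm; last first.
  by rewrite mulr_ge0 ?subr_ge0// divr_ge0// ltW.
rewrite mulrDr mulrDr lerD//.
  apply: (@le_trans _ _ (al * (t - c) `^ (al - 1) * h - al * (t - a) `^ (al - 1) * h)).
    by rewrite lerB.
  rewrite -mulrBl -mulrBr [leLHS]mulrC ler_wpM2l ?(ltW h0)// ler_wpM2l ?(ltW al0)//.
  have -> : t - a = t - c + (h + N * h) by rewrite /c; ring.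
  by apply: powR_pred_sub_le => //; exact: addr_gt0.
rewrite (_ : h * _ = (1 - N * k) * (al * (t - c) `^ (al - 1) * h)); last by ring.
by rewrite ler_wpM2l// subr_ge0.
Qed.

End fixed_width.

Lemma needle_continuous h : continuous (needle h).
Proof.
have shift u : continuous (fun t => ppow (t - u)).
  move=> t; apply: (@continuous_comp _ _ _ (fun t => t - u) ppow); last exact: ppow_continuous.
  by apply: continuousB; [exact: cvg_id|exact: cst_continuous].
move=> t; rewrite /continuous_at /needle; apply: cvgD.
  by apply: cvgB; [exact: shift|apply: cvgM; [exact: cvg_cst|exact: shift]].
by apply: cvgM; [exact: cvg_cst|exact: shift].
Qed.

Variables (t0 be : R).
Hypotheses (t0a : t0 <= a) (be0 : 0 < be) (N1 : 1 <= N).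

(** Up to c the sup bound is multiplied by the length (1 + N) h. Beyond c the powers of t - c from
    [needle_tail] meet the weight in beta integrals, finite although both ends may be singular. *)
Lemma needle_weighted (h W C : R) : 0 < h -> a + h + N * h < t1 ->
  let c := a + h + N * h in
  (forall t, a <= t <= c -> (t1 - t) `^ (be - 1) <= W) ->
  (t1 - c) `^ (be + al / 2 - 1) <= C -> (t1 - c) `^ (be + al - 1) <= C ->
  (\int[mu]_(t in `[t0, t1]) ((t1 - t) `^ (be - 1) * `|needle h t|)%:E <=
   (h * (2 * (h + N * h) `^ al * W * (1 + N) +
     al * C * ((h + N * h) `^ (al / 2) * fine (betae be (al / 2)) +
       (1 - N * needle_ratio h) * fine (betae be al))))%:E)%E.
Proof.
move=> h0 ct1 c WP C1 C2.
have [k0 Nk1 _] := needle_ratio_bounds h0 ct1.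
have ac : a < c by rewrite /c -addrA ltrDl addr_gt0// mulr_gt0.
pose S := 2 * (h + N * h) `^ al; have S0 : 0 <= S by rewrite mulr_ge0 ?powR_ge0.
have W0 : 0 <= W by rewrite (le_trans _ (WP a _)) ?powR_ge0// lexx ltW.
pose k1 := h * (al * (h + N * h) `^ (al / 2)).
pose k2 := h * (al * (1 - N * needle_ratio h)).
have k10 : 0 <= k1 by rewrite mulr_ge0 ?(ltW h0)// mulr_ge0 ?powR_ge0// ltW.
have k20 : 0 <= k2 by rewrite mulr_ge0 ?(ltW h0)// mulr_ge0 ?(ltW al0)// subr_ge0.
pose w t := (t1 - t) `^ (be - 1).
have w0 t : 0 <= w t by exact: powR_ge0.
pose G q t := w t * (t - c) `^ (q - 1).
have G0 q t : 0 <= G q t by rewrite mulr_ge0 ?powR_ge0.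
have mG q : measurable_fun [set: R] (fun t => (G q t)%:E).
  by apply/measurable_EFinP; exact: measurable_beta_kernel.
(* The two majorants overlap at c, which is harmless since both are nonnegative. *)
pose F1 := (fun t => (S * W)%:E) \_ `[a, c].
pose F2 := (fun t => k1%:E * (G (al / 2) t)%:E + k2%:E * (G al t)%:E)%E \_ `[c, t1].
have mk q k : measurable_fun [set: R] (fun t => k%:E * (G q t)%:E)%E.
  by apply: emeasurable_funM.
have mF2' : measurable_fun `[c, t1] (fun t => k1%:E * (G (al / 2) t)%:E + k2%:E * (G al t)%:E)%E.
  by apply: emeasurable_funD; apply: measurable_funTS.
have mw : measurable_fun [set: R] w.
  by apply: (@measurableT_comp _ _ _ _ _ _ (@powR R ^~ (be - 1))) => //; exact: measurable_funB.
have mneedle : measurable_fun [set: R] (needle h).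
  by apply: continuous_measurable_fun; exact: needle_continuous.
have mF1 : measurable_fun [set: R] F1.
  by apply/(measurable_restrictT _ (measurable_itv _)).
have mF2 : measurable_fun [set: R] F2.
  by apply/(measurable_restrictT _ (measurable_itv _)).
have F10 t : (0 <= F1 t)%E.
  by apply: erestrict_ge0 => u _; rewrite lee_fin mulr_ge0.
have F20 t : (0 <= F2 t)%E.
  by apply: erestrict_ge0 => u _; rewrite adde_ge0// mule_ge0// lee_fin.
apply: (@le_trans _ _ (\int[mu]_(t in `[t0, t1]) (F1 t + F2 t))%E).
  apply: ge0_le_integral.
  - exact: measurable_itv.
  - by move=> t _; rewrite lee_fin; apply: mulr_ge0; [exact: w0|].
  - apply/measurable_EFinP/measurable_funTS; apply: measurable_funM => //.
    exact: measurableT_comp.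
  - by apply: emeasurable_funD; apply: measurable_funTS.
  move=> t /=; rewrite in_itv/= => /andP[t0t tt1].
  have [ta|ta] := leP t a.
    by rewrite (needle_zero h0 ta) normr0 mulr0 adde_ge0.
  have [tc|tc] := leP t c.
    rewrite -[leLHS]adde0 leeD//.
    rewrite /F1 patchE mem_set/= ?in_itv/= ?(ltW ta)// lee_fin mulrC.
    apply: ler_pM; [exact: normr_ge0|exact: powR_ge0|exact: (needle_sup h0 ct1 t N1)|].
    by apply: WP; rewrite (ltW ta).
  rewrite -[leLHS]add0e leeD//.
  rewrite /F2 patchE mem_set/= ?in_itv/= ?(ltW tc)// -!EFinM -EFinD lee_fin.
  apply: (@le_trans _ _ (w t * (h * (al *
   ((h + N * h) `^ (al / 2) * (t - c) `^ (al / 2 - 1) +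
     (1 - N * needle_ratio h) * (t - c) `^ (al - 1)))))).
    by apply: ler_wpM2l; [exact: w0|exact: (needle_tail h0 ct1 tc)].
  by rewrite /G /k1 /k2 le_eqVlt; apply/orP; left; apply/eqP; ring.
rewrite ge0_integralD//; last 2 first.
- exact: measurable_funTS.
- exact: measurable_funTS.
have I1 : (\int[mu]_(t in `[t0, t1]) F1 t = (S * W * (h + N * h))%:E)%E.
  rewrite -integral_mkcondr (_ : _ `&` _ = `[a, c]%classic); last first.
    apply/seteqP; split => [u []//|u /= uac]; split => //.
    move: uac; rewrite /= !in_itv/= => /andP[u1 u2].
    by rewrite (le_trans t0a u1) (le_trans u2 (ltW ct1)).
  rewrite integral_cst//= lebesgue_measure_itv/= lte_fin ac -EFinD -EFinM.
  by congr (_ * _)%:E; rewrite /c; ring.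
have beE q : 0 < q -> (fine (betae be q))%:E = betae be q.
  move=> q0; rewrite fineK// ge0_fin_numE ?betae_lty//.
  by apply: integral_ge0 => u _; rewrite lee_fin mulr_ge0// powR_ge0.
have IG q : 0 < q -> (\int[mu]_(t in `[c, t1]) (G q t)%:E =
    ((t1 - c) `^ (be + q - 1) * fine (betae be q))%:E)%E.
  by move=> q0; rewrite integral_beta_kernel// EFinM beE.
have be_ge0 q : 0 <= fine (betae be q).
  by apply: fine_ge0; apply: integral_ge0 => u _; rewrite lee_fin mulr_ge0// powR_ge0.
have al20 : 0 < al / 2 by rewrite divr_gt0.
have IkG q k : 0 <= k -> 0 < q -> (\int[mu]_(t in `[c, t1]) (k%:E * (G q t)%:E) =
    (k * ((t1 - c) `^ (be + q - 1) * fine (betae be q)))%:E)%E.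
  move=> kk q0; rewrite ge0_integralZl.
  - by rewrite IG.
  - exact: measurable_itv.
  - exact: (measurable_funTS (mG _)).
  - by move=> t _; rewrite lee_fin.
  - by rewrite lee_fin.
have I2 : (\int[mu]_(t in `[t0, t1]) F2 t <= (k1 * (C * fine (betae be (al / 2))) +
    k2 * (C * fine (betae be al)))%:E)%E.
  rewrite -integral_mkcondr (_ : _ `&` _ = `[c, t1]%classic); last first.
    apply/seteqP; split => [u []//|u /= uac]; split => //.
    move: uac; rewrite /= !in_itv/= => /andP[u1 ->].
    by rewrite (le_trans t0a (le_trans (ltW ac) u1)).
  rewrite ge0_integralD//; last 4 first.
  - by move=> t _; rewrite mule_ge0// lee_fin.
  - exact: (measurable_funTS (mk _ _)).
  - by move=> t _; rewrite mule_ge0// lee_fin.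
  - exact: (measurable_funTS (mk _ _)).
  by rewrite !IkG// lee_fin lerD// ler_wpM2l// ler_wpM2r.
apply: (le_trans (leeD (le_refl _) I2)); rewrite I1 -EFinD lee_fin.
by rewrite le_eqVlt /S /k1 /k2; apply/orP; left; apply/eqP; ring.
Qed.

Lemma powR_width_cvg0 (s : R) : 0 < s -> (h + N * h) `^ s @[h --> 0^'+] --> 0.
Proof.
move=> s0; rewrite -[X in _ --> X](mulr0 ((1 + N) `^ s)).
apply: (@cvg_trans _ ((1 + N) `^ s * h `^ s @[h --> 0^'+])); last first.
  by apply: cvgM; [exact: cvg_cst|exact: powR_cvg0].
apply: near_eq_cvg; near=> h; rewrite -powRM ?addr_ge0 ?(ltW N0)//.
by rewrite mulrDl mul1r.
Unshelve. all: by end_near. Qed.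

(** Here N is fixed and only h tends to 0. All bounds used later are collected for one h, with an
    L^1 bound h * e that is o(h) because e is arbitrary. *)
Lemma needle_small (e : R) : 0 < e -> \forall h \near 0^'+,
  [/\ a + h + N * h < t1, 1 - e <= N * needle_ratio h, (forall t, `|needle h t| <= e) &
   (* The weight makes this bound usable directly in J. *)
   (\int[mu]_(t in `[t0, t1]) ((t1 - t) `^ (be - 1) * `|needle h t|)%:E <= (h * e)%:E)%E].
Proof.
(* Once c < t1 - m, every t1 - t with t in [a, c] lies in [m, t1 - a], so the constants W and C do
   not depend on h. *)
move=> e0; pose m := (t1 - a) / 2.
have ta0 : 0 < t1 - a by rewrite subr_gt0.
have m0 : 0 < m by rewrite divr_gt0.
pose W := m `^ (be - 1) + (t1 - a) `^ (be - 1).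
pose Cs s := m `^ s + (t1 - a) `^ s.
pose C := Cs (be + al / 2 - 1) + Cs (be + al - 1).
have Cs0 s : 0 <= Cs s by rewrite addr_ge0 ?powR_ge0.
have C0 : 0 <= C by rewrite addr_ge0.
have W0 : 0 <= W by rewrite addr_ge0 ?powR_ge0.
have B0 q : 0 <= fine (betae be q).
  by apply: fine_ge0; apply: integral_ge0 => u _; rewrite lee_fin mulr_ge0// powR_ge0.
pose K1 := 2 * W * (1 + N); pose K2 := al * C * fine (betae be (al / 2)).
pose K3 := al * C * fine (betae be al).
have K10 : 0 <= K1 by rewrite !mulr_ge0// addr_ge0// ltW.
have K20 : 0 <= K2 by rewrite !mulr_ge0// ltW.
have K30 : 0 <= K3 by rewrite !mulr_ge0// ltW.
pose K := 2 + (K1 + K2 + K3).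
have K2' : 2 <= K by rewrite lerDl !addr_ge0.
have K0 : 0 < K by exact: lt_le_trans K2'.
pose d := e / K; have d0 : 0 < d by rewrite divr_gt0.
have dK : d * K = e by rewrite divfK// gt_eqF.
have al20 : 0 < al / 2 by rewrite divr_gt0.
have ratio_cvg : (t1 - a) `^ (al - 1) / (t1 - (a + h + N * h)) `^ (al - 1) @[h --> 0^'+] --> (1 : R).
  rewrite -[X in _ --> X](@divff _ ((t1 - a) `^ (al - 1))) ?gt_eqF ?powR_gt0//.
  apply: cvgM; first exact: cvg_cst.
  apply: cvgV; first by rewrite gt_eqF// powR_gt0.
  apply: cvg_at_right_filter.
  have -> : (t1 - a) `^ (al - 1) = (t1 - (a + 0 + N * 0)) `^ (al - 1).
    by rewrite mulr0 !addr0.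
  apply: (@continuous_comp _ _ _ (fun h => t1 - (a + h + N * h)) (fun u => u `^ (al - 1))).
    apply: cvgB; first exact: cvg_cst.
    apply: cvgD; last by apply: cvgM; [exact: cvg_cst|exact: cvg_id].
    by apply: cvgD; [exact: cvg_cst|exact: cvg_id].
  by apply: powR_continuous_gt0; rewrite mulr0 !addr0.
near=> h.
have h0 : 0 < h by near: h; exact: nbhs_right_gt.
have hm : a + h + N * h < t1 - m.
  have : h < m / (1 + N) by near: h; apply: nbhs_right_lt; rewrite divr_gt0// addr_gt0.
  rewrite ltr_pdivlMr ?addr_gt0// mulrDr mulr1 (mulrC h N) => hm.
  by rewrite -addrA -ltrBrDl (lt_le_trans hm)// le_eqVlt; apply/orP; left; apply/eqP; rewrite /m; field.
have ct1 : a + h + N * h < t1 by rewrite (lt_trans hm)// ltrBlDr ltrDl.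
have [k0 Nk1 klow] := needle_ratio_bounds h0 ct1.
have r1 : 1 - N * needle_ratio h <= d.
  rewrite lerBlDr addrC -lerBlDr (le_trans _ klow)// lerBlDr -lerBlDl.
  rewrite (le_trans (ler_norm _))//; near: h.
  by move/cvgrPdist_le : ratio_cvg; exact.
have s1 : (h + N * h) `^ al <= d.
  rewrite (le_trans (ler_norm _))// -normrN -sub0r; near: h.
  by move/cvgrPdist_le : (powR_width_cvg0 al0); exact.
have s2 : (h + N * h) `^ (al / 2) <= d.
  rewrite (le_trans (ler_norm _))// -normrN -sub0r; near: h.
  by move/cvgrPdist_le : (powR_width_cvg0 al20); exact.
have de : 2 * d <= e by rewrite -dK mulrC ler_wpM2l// ltW.
have between s t : a <= t <= a + h + N * h -> (t1 - t) `^ s <= Cs s.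
  move=> /andP[at_ tc]; apply: powR_between => //.
    by rewrite lerBrDr addrC -lerBrDr (le_trans tc)// ltW.
  by rewrite lerD2l lerN2.
split=> //.
- rewrite lerBlDr addrC -lerBlDr (le_trans r1)// (le_trans _ de)//.
  by rewrite ler_peMl ?ler1n// ltW.
- move=> t; rewrite (le_trans (needle_sup h0 ct1 t N1))// (le_trans _ de)//.
  by rewrite ler_wpM2l.
apply: (le_trans (@needle_weighted h W C h0 ct1 _ _ _)).
- by move=> t; exact: between.
- rewrite (le_trans (between _ _ _)) ?lerDl// lexx andbT -addrA lerDl.
  by rewrite addr_ge0 ?mulr_ge0// ltW.
- rewrite (le_trans (between _ _ _)) ?lerDr// lexx andbT -addrA lerDl.
  by rewrite addr_ge0 ?mulr_ge0// ltW.
rewrite lee_fin; apply: ler_wpM2l; first exact: ltW.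
exact: (weighted_sum_le W0 (ltW N0) (ltW al0) C0 (B0 _) (B0 _) (ltW d0) s1 s2 r1 dK).
Unshelve. all: by end_near. Qed.

End needle.

(** * Increments of a function with a nearly constant gradient *)

Section gradient.
Context {R : realType} {n : nat}.
Implicit Types (f : 'rV[R]_n -> R) (u v w p : 'rV[R]_n).

(** The mean value theorem for the restriction of f to a line; the condition on |s| covers both
    signs of b. *)
Lemma MVT_directional f w (d : 'rV[R]_n) (b : R) :
  (forall s, `|s| <= `|b| -> derivable f (w + s *: d) d) ->
  exists2 s, `|s| <= `|b| & f (w + b *: d) - f w = 'D_d f (w + s *: d) * b.
Proof.
move=> df; pose chi (s : R) := f (w + s *: d).
have dchi (s : R) : `|s| <= `|b| -> is_derive s (1 : R) chi ('D_d f (w + s *: d)).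
  move=> sb; have := df s sb; rewrite /derivable /derive.
  have -> : (fun h : R => h^-1 *: ((f \o shift (w + s *: d)) (h *: d) - f (w + s *: d))) =
      (fun h : R => h^-1 *: ((chi \o shift s) (h *: (1 : R)) - chi s)).
    apply/funext => h /=; rewrite /chi /shift/= [h%:A]mulr1.
    by rewrite scalerDl addrCA addrC.
  by move=> c; split.
have cchi : {in [pred s | `|s| <= `|b|], forall s, {for s, continuous chi}}.
  move=> s sb; apply: differentiable_continuous; apply/derivable1_diffP.
  by apply: ex_derive; exact: dchi.
have [b0|b0] := leP 0 b.
  have inb s : 0 <= s <= b -> `|s| <= `|b|.
    by move=> /andP[s0 sb]; rewrite !ger0_norm.
  have [||s] := @MVT_segment R chi (fun s => 'D_d f (w + s *: d)) 0 b b0.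
  - move=> s; rewrite in_itv/= => /andP[/ltW s0 /ltW sb]; apply: dchi; apply: inb.
    by rewrite s0.
  - by apply: continuous_in_subspaceT => s; rewrite inE/= in_itv/= => /inb; exact: cchi.
  rewrite in_itv/= subr0 => /inb sb E; exists s => //.
  by rewrite -E /chi scale0r addr0.
have inb s : b <= s <= 0 -> `|s| <= `|b|.
  by move=> /andP[sb s0]; rewrite (ler0_norm s0) (ltr0_norm b0) lerN2.
have [||s] := @MVT_segment R chi (fun s => 'D_d f (w + s *: d)) b 0 (ltW b0).
- move=> s; rewrite in_itv/= => /andP[/ltW s0 /ltW sb]; apply: dchi; apply: inb.
  by rewrite s0.
- by apply: continuous_in_subspaceT => s; rewrite inE/= in_itv/= => /inb; exact: cchi.
rewrite in_itv/= sub0r => /inb sb E; exists s => //.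
apply: oppr_inj; rewrite opprB -mulrN -E /chi scale0r addr0//.
Qed.

(** Only partial derivatives are available, so u is added one coordinate at a time and the
    increments telescope; n is the number of coordinates. The intermediate points stay in the ball
    because the norm is the sup norm, which truncation does not increase. *)
Lemma grad_increment f v p u (r e : R) : `|u| <= r ->
  (forall w, `|w - v| <= r -> has_grad f w /\ forall i, `|grad f w 0 i - p 0 i| <= e) ->
  `|f (v + u) - f v - dotv p u| <= n%:R * e * `|u|.
Proof.
move=> ur fP.
pose tr (k : nat) : 'rV[R]_n := \row_i (if (i < k)%N then u 0 i else 0).
have tr0 : tr 0%N = 0 by apply/rowP => i; rewrite !mxE.
have trn : tr n = u by apply/rowP => i; rewrite !mxE ltn_ord.
have trS (k : 'I_n) : tr k.+1 = tr k + u 0 k *: delta_mx 0 k.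
  apply/rowP => i; rewrite !mxE eqxx/= ltnS leq_eqVlt -val_eqE/=.
  have [/eqP/val_inj->|ik] := boolP (i == k :> nat).
    by rewrite ltnn ?eqxx add0r mulr1.
  by rewrite /= ?(negbTE ik) mulr0 addr0.
have trb (k : 'I_n) s : `|s| <= `|u 0 k| -> `|tr k + s *: delta_mx 0 k| <= r.
  move=> su; apply: le_trans ur; apply: mx_norm_le => // i; rewrite !mxE eqxx/= -val_eqE/=.
  have [/eqP/val_inj->|ik] := boolP (i == k :> nat).
    by rewrite ltnn ?eqxx add0r mulr1 (le_trans su)// le_entry_mx_norm.
  rewrite ?(negbTE ik) mulr0 addr0; case: ifP => _; first exact: le_entry_mx_norm.
  by rewrite normr0.
have step (k : 'I_n) : `|f (v + tr k.+1) - f (v + tr k) - p 0 k * u 0 k| <= e * `|u|.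
  have [|s su] := @MVT_directional f (v + tr k) (delta_mx 0 k) (u 0 k).
    move=> s su; have [|hg _] := fP (v + tr k + s *: delta_mx 0 k); last exact: hg.
    by rewrite -(addrA v) addrAC subrr add0r trb.
  rewrite trS addrA => ->.
  have [|_ /(_ k)] := fP (v + tr k + s *: delta_mx 0 k).
    by rewrite -(addrA v) addrAC subrr add0r trb.
  rewrite mxE => h; rewrite -mulrBl normrM ler_pM// le_entry_mx_norm//.
have -> : f (v + u) - f v - dotv p u =
    \sum_(k < n) (f (v + tr k.+1) - f (v + tr k) - p 0 k * u 0 k).
  rewrite sumrB; congr (_ - _).
  rewrite -(big_mkord xpredT (fun k => f (v + tr k.+1) - f (v + tr k))).
  by rewrite telescope_sumr// trn tr0 addr0.
rewrite (le_trans (ler_norm_sum _ _ _))//.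
apply: (@le_trans _ _ (\sum_(k < n) (e * `|u|))); first exact: ler_sum.
by rewrite sumr_const card_ord -mulrA mulr_natl.
Qed.

Lemma le_mx_norm_normv u : `|u| <= normv u.
Proof.
apply: mx_norm_le => [|i]; first exact: sqrtr_ge0.
rewrite /normv /dotv -sqrtr_sqr ler_wsqrtr// (bigD1 i)//= -expr2 lerDl.
by apply: sumr_ge0 => j _; rewrite -expr2 sqr_ge0.
Qed.

Lemma normvZ (k : R) u : normv (k *: u) = `|k| * normv u.
Proof.
rewrite /normv /dotv -sqrtr_sqr -sqrtrM ?sqr_ge0//; congr Num.sqrt.
by rewrite mulr_sumr; apply: eq_bigr => i _; rewrite !mxE; ring.
Qed.

Lemma normv_ge0 u : 0 <= normv u. Proof. exact: sqrtr_ge0. Qed.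

Lemma dotvZr (k : R) p u : dotv p (k *: u) = k * dotv p u.
Proof. by rewrite /dotv mulr_sumr; apply: eq_bigr => i _; rewrite !mxE mulrCA. Qed.

End gradient.

(** * Needle variations of an extremal *)

Section needle_density.
Context {R : realType} {n : nat}.
Notation mu := (@lebesgue_measure R).
Implicit Types (psi : R -> 'rV[R]_n).

Lemma cvg_left_of_in (t0 t1 t : R) (T : topologicalType) (f : R -> T) (l : T) :
  t0 < t <= t1 -> f @ within `[t0, t1] (nbhs t) --> l -> f @ t^'- --> l.
Proof.
move=> /andP[t0t tt1] fl P /fl; rewrite /= !nbhs_simpl/= => -[d /= d0 hd].
near=> s; have st : s < t by near: s; exact: nbhs_left_lt.
apply: hd => /=.
- rewrite gtr0_norm ?subr_gt0// ltrBlDr addrC -ltrBlDr.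
  by near: s; apply: nbhs_left_gt; rewrite ltrBlDr ltrDl.
- rewrite in_itv/=; apply/andP; split; last by rewrite (le_trans _ tt1)// ltW.
  by apply: ltW; near: s; apply: nbhs_left_gt.
Unshelve. all: by end_near. Qed.

Lemma cvg_right_of_in (t0 t1 t : R) (T : topologicalType) (f : R -> T) (l : T) :
  t0 <= t < t1 -> f @ within `[t0, t1] (nbhs t) --> l -> f @ t^'+ --> l.
Proof.
move=> /andP[t0t tt1] fl P /fl; rewrite /= !nbhs_simpl/= => -[d /= d0 hd].
near=> s; have ts : t < s by near: s; exact: nbhs_right_gt.
apply: hd => /=.
- rewrite distrC gtr0_norm ?subr_gt0// ltrBlDr addrC.
  by near: s; apply: nbhs_right_lt; rewrite ltrDl.
- rewrite in_itv/=; apply/andP; split; first by rewrite (le_trans t0t)// ltW.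
  by apply: ltW; near: s; apply: nbhs_right_lt.
Unshelve. all: by end_near. Qed.

Lemma PC_add (t0 t1 : R) psi1 psi2 : PC t0 t1 psi1 -> PC t0 t1 psi2 ->
  PC t0 t1 (fun t => psi1 t + psi2 t).
Proof.
(* A jump of one summand may be a continuity point of the other, whose one-sided limits then come
   from continuity. *)
have lims (s : seq R) psi t : (forall t, t \in s ->
       [/\ t0 < t < t1, cvg (psi @ t^'-) & cvg (psi @ t^'+)]) ->
    (forall t, t0 <= t <= t1 -> t \notin s -> continuous_at_in t0 t1 psi t) ->
    t0 < t < t1 -> cvg (psi @ t^'-) /\ cvg (psi @ t^'+).
  move=> h1 h2 /andP[tt0 tt1]; have [/h1[_ ? ?]//|ts] := boolP (t \in s).
  have c : continuous_at_in t0 t1 psi t by apply: h2 => //; rewrite !ltW.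
  split; apply/cvg_ex; exists (psi t).
    by apply: (cvg_left_of_in (t0 := t0) (t1 := t1)) => //; rewrite tt0 ltW.
  by apply: (cvg_right_of_in (t0 := t0) (t1 := t1)) => //; rewrite tt1 ltW.
move=> [s1 [l1 c1]] [s2 [l2 c2]]; exists (s1 ++ s2); split => t.
  move=> ts; have tT : t0 < t < t1.
    by move: ts; rewrite mem_cat => /orP[/l1[]|/l2[]].
  have [/cvg_ex[a1 ha1] /cvg_ex[b1 hb1]] := lims s1 psi1 t l1 c1 tT.
  have [/cvg_ex[a2 ha2] /cvg_ex[b2 hb2]] := lims s2 psi2 t l2 c2 tT.
  split; first exact: tT.
    by apply/cvg_ex; exists (a1 + a2); exact: cvgD.
  by apply/cvg_ex; exists (b1 + b2); exact: cvgD.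
rewrite mem_cat negb_or => tT /andP[n1 n2]; rewrite /continuous_at_in.
by apply: cvgD; [exact: c1|exact: c2].
Qed.

Definition jump (a : R) (v : 'rV[R]_n) : R -> 'rV[R]_n := fun t => if a <= t then v else 0.

Lemma jump_near (a t : R) v : t != a -> \forall s \near t, jump a v s = jump a v t.
Proof.
move=> ta; rewrite /jump; have [at_|ta'] := leP a t.
  have lt_at : a < t by rewrite lt_neqAle eq_sym ta.
  by near=> s; rewrite ifT//; apply: ltW; near: s; exact: lt_nbhsr.
by near=> s; rewrite ifF//; apply: lt_geF; near: s; exact: lt_nbhsl.
Unshelve. all: by end_near. Qed.

(** [PC] admits no jump at t0; for a = t0 the step is constant on [t0, t1], and the list of jumps is
    empty. *)
Lemma PC_jump (t0 t1 a : R) v : t0 <= a < t1 -> PC t0 t1 (jump a v).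
Proof.
move=> /andP[t0a at1].
have cont t : t != a -> continuous_at_in t0 t1 (jump a v) t.
  move=> ta; apply: cvg_within_filter; apply: cvg_near_cst.
  by apply: filterS (jump_near v ta).
have right : \forall s \near a^'+, jump a v s = v.
  by near=> s; rewrite /jump ifT//; apply: ltW; near: s; exact: nbhs_right_gt.
move: t0a; rewrite le_eqVlt => /predU1P[t0a|t0a].
  exists [::]; split=> // t /andP[tt0 tt1] _.
  have [->|] := eqVneq t a; last exact: cont.
  apply: cvg_near_cst; rewrite near_withinE; near=> s => /=; rewrite in_itv/= => /andP[s0 _].
  by rewrite /jump lexx -t0a s0.
exists [:: a]; split=> t; rewrite inE; last by move=> _; exact: cont.
move=> /eqP->; split; first by rewrite t0a.
  apply/cvg_ex; exists 0; apply: cvg_near_cst.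
  by near=> s; rewrite /jump ifF//; apply: lt_geF; near: s; exact: nbhs_left_lt.
by apply/cvg_ex; exists v; exact: cvg_near_cst.
Unshelve. all: by end_near. Qed.

Lemma RLreal_jump (al t0 t1 a t : R) (k : R) : 0 < al <= 1 -> t0 <= a -> t <= t1 ->
  RLreal al t0 (fun s => (if a <= s then k else 0)) t = k / al * ppow al (t - a).
Proof.
move=> al01 t0a tt1; have /andP[al0 _] := al01.
have -> : RLreal al t0 (fun s => (if a <= s then k else 0)) t =
    \int[mu]_(s in `[t0, t] `&` `[a, +oo[) ((t - s) `^ (al - 1) * k).
  rewrite Rintegral_mkcondr; apply: eq_Rintegral => s _.
  by rewrite patchE mem_setE in_itv/= andbT; case: ifP => // _; rewrite mulr0.
have -> : `[t0, t]%classic `&` `[a, +oo[%classic = `[a, t]%classic.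
  apply/seteqP; split=> s /=; rewrite !in_itv/= andbT; first by move=> [/andP[_ ->] ->].
  by move=> /andP[as_ ->]; rewrite (le_trans t0a as_).
have [at_|ta] := leP a t; last first.
  rewrite (ppow_neg al01) ?subr_le0 ?(ltW ta)// mulr0.
  by rewrite set_itv_ge ?Rintegral_set0// bnd_simp -ltNge.
rewrite RintegralZr//; last first.
  rewrite (_ : (fun u => (t - u) `^ (al - 1)) = (fun u => (t - u) `^ (al - 1) * cst 1 u)).
    by apply: (@integrable_powR_bounded R al a t 1) => // u _; rewrite normr1.
  by apply/funext => u; rewrite /= mulr1.
by rewrite /Rintegral integral_powR_right//= ppow_pos ?subr_ge0//; ring.
Qed.

Lemma RLint_add (al t0 t1 t : R) psi1 psi2 : 0 < al -> t <= t1 ->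
  PC t0 t1 psi1 -> PC t0 t1 psi2 ->
  RLint t0 al (fun s => psi1 s + psi2 s) t = RLint t0 al psi1 t + RLint t0 al psi2 t.
Proof.
move=> al0 tt1 P1 P2; apply/rowP => i; rewrite [RHS]mxE !RLintE -mulrDr; congr (_ * _).
have [M1 hM1] := PC_bounded P1; have [M2 hM2] := PC_bounded P2.
have bd psi M : (forall t, t0 <= t <= t1 -> `|psi t| <= M) ->
    forall u, t0 <= u <= t1 -> `|psi u 0 i| <= M.
  by move=> h u uT; rewrite (le_trans (le_entry_mx_norm _ _))// h.
have := @RLreal_lin R al t0 t1 t M1 M2 1 1 (fun s => psi1 s 0 i) (fun s => psi2 s 0 i) al0 tt1
  (PC_measurable i P1) (bd _ _ hM1) (PC_measurable i P2) (bd _ _ hM2).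
rewrite !mul1r => <-; apply: eq_Rintegral => s _; rewrite mxE !mul1r//.
Qed.

Lemma RLint_jump (al t0 t1 a t : R) v : 0 < al <= 1 -> t0 <= a -> t <= t1 ->
  RLint t0 al (jump a v) t = ((Gamma al)^-1 / al * ppow al (t - a)) *: v.
Proof.
move=> al01 t0a tt1; apply/rowP => i; rewrite RLintE [RHS]mxE.
have -> : (fun s => jump a v s 0 i) = (fun s => if a <= s then v 0 i else 0).
  by apply/funext => s; rewrite /jump; case: ifP => // _; rewrite mxE.
by rewrite (RLreal_jump _ al01 t0a tt1); ring.
Qed.

Variables (al a t1 N h : R).

Local Notation k := (needle_ratio al a t1 N h).

(** A sum of three steps, so that its fractional integral follows by linearity; [needle_densityE]
    gives the form by cases. *)
Definition needle_density (zeta : 'rV[R]_n) : R -> 'rV[R]_n := fun t =>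
  jump a zeta t + (jump (a + h) (- (1 + k) *: zeta) t + jump (a + h + N * h) (k *: zeta) t).

Hypotheses (al01 : 0 < al <= 1) (h0 : 0 < h) (N0 : 0 < N) (ct1 : a + h + N * h < t1).
Let al0 : 0 < al. Proof. by case/andP: al01. Qed.
Let Nh0 : 0 < N * h. Proof. exact: mulr_gt0. Qed.
Let ab : a < a + h. Proof. by rewrite ltrDl. Qed.
Let bc : a + h < a + h + N * h. Proof. by rewrite ltrDl. Qed.

Lemma PC_needle_density t0 zeta : t0 <= a -> PC t0 t1 (needle_density zeta).
Proof.
move=> t0a; apply: PC_add; last apply: PC_add; apply: PC_jump.
- by rewrite t0a (lt_trans ab)// (lt_trans bc).
- by rewrite (le_trans t0a (ltW ab)) (lt_trans bc).
- by rewrite (le_trans t0a (ltW (lt_trans ab bc))).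
Qed.

Lemma RLint_needle_density t0 zeta t : t0 <= a -> t <= t1 ->
  RLint t0 al (needle_density zeta) t =
  ((Gamma al)^-1 / al * needle al a t1 N h t) *: zeta.
Proof.
move=> t0a tt1.
have Pa : PC t0 t1 (jump a zeta) by apply: PC_jump; rewrite t0a (lt_trans ab)// (lt_trans bc).
have Pb : PC t0 t1 (jump (a + h) (- (1 + k) *: zeta)).
  by apply: PC_jump; rewrite (le_trans t0a (ltW ab)) (lt_trans bc).
have Pc : PC t0 t1 (jump (a + h + N * h) (k *: zeta)).
  by apply: PC_jump; rewrite (le_trans t0a (ltW (lt_trans ab bc))).
rewrite (RLint_add al0 tt1 Pa (PC_add Pb Pc)) (RLint_add al0 tt1 Pb Pc).
have t0b := le_trans t0a (ltW ab); have t0c := le_trans t0b (ltW bc).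
rewrite (RLint_jump _ al01 t0a tt1) (RLint_jump _ al01 t0b tt1) (RLint_jump _ al01 t0c tt1).
by rewrite !scalerA -!scalerDl; congr (_ *: _); rewrite /needle; ring.
Qed.

Lemma needle_density_near zeta t : t != a -> t != a + h -> t != a + h + N * h ->
  \forall s \near t, needle_density zeta s = needle_density zeta t.
Proof.
move=> ta tb tc; near=> s; rewrite /needle_density.
by congr (_ + (_ + _)); near: s; exact: jump_near.
Unshelve. all: by end_near. Qed.

Lemma needle_densityE zeta t : needle_density zeta t =
  (if t < a then 0 else if t < a + h then 1 else if t < a + h + N * h then - k else 0) *: zeta.
Proof.
rewrite /needle_density /jump.
have [ta|ta] := ltP t a.
  by rewrite !ifF ?addr0 ?scale0r//; apply: lt_geF; rewrite (lt_trans ta)// (lt_trans ab).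
have [tb|tb] := ltP t (a + h).
  by rewrite ifF ?addr0 ?add0r ?scale1r// lt_geF// (lt_trans tb).
have [tc|tc] := ltP t (a + h + N * h).
  by rewrite addr0 -{1}[zeta]scale1r -scalerDl; congr (_ *: _); ring.
by rewrite -{1}[zeta]scale1r -!scalerDl; congr (_ *: _); ring.
Qed.

End needle_density.

Section variation.
Context {R : realType} {n : nat}.
Notation mu := (@lebesgue_measure R).

Lemma near_notin_seq (s : seq R) (t : R) : t \notin s -> \forall u \near t, u \notin s.
Proof.
elim: s => [_|x s IH]; first by near=> u.
rewrite inE negb_or => /andP[tx ts]; near=> u; rewrite inE negb_or; apply/andP; split.
  near: u; have [xt|tx'|E] := ltgtP x t; last by rewrite E eqxx in tx.
    by near=> u; rewrite gt_eqF//; near: u; exact: lt_nbhsr.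
  by near=> u; rewrite lt_eqF//; near: u; exact: lt_nbhsl.
by near: u; exact: IH.
Unshelve. all: by end_near. Qed.

Lemma near_dnbhs_notin_seq (s : seq R) (t : R) : \forall u \near t^', u \notin s.
Proof.
have : \forall u \near t, u \notin [seq x <- s | x != t].
  by apply: near_notin_seq; rewrite mem_filter eqxx.
rewrite /dnbhs near_withinE; apply: filterS => u + ut; apply: contra => us.
by rewrite mem_filter us andbT.
Qed.

Lemma near_left_notin_seq (s : seq R) (t : R) : \forall u \near t^'-, u \notin s.
Proof.
move: (near_dnbhs_notin_seq s t); rewrite /dnbhs /at_left !near_withinE.
by apply: filterS => u h ut; apply: h; rewrite lt_eqF.
Qed.

Lemma near_right_notin_seq (s : seq R) (t : R) : \forall u \near t^'+, u \notin s.
Proof.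
move: (near_dnbhs_notin_seq s t); rewrite /dnbhs /at_right !near_withinE.
by apply: filterS => u h ut; apply: h; rewrite gt_eqF.
Qed.

End variation.

Section weighted.
Context {R : realType} {n : nat}.
Notation mu := (@lebesgue_measure R).

(** Stated for a neighbourhood B, it serves both to compose with functions of three variables and to
    reach closure points of the graph. *)
Lemma cvg_triple (F : set_system R) (y v : R -> 'rV[R]_n) (t : R) (yt vt : 'rV[R]_n)
    (B : set (R * 'rV[R]_n * 'rV[R]_n)) : Filter F ->
  F --> t -> y @ F --> yt -> v @ F --> vt -> nbhs (t, yt, vt) B ->
  \forall s \near F, B (s, y s, v s).
Proof.
move=> FF Ft yF vF /nbhs_ballP[r /= r0 hr].
near=> s; apply: hr; split; [split|]; rewrite -ball_normE /ball_/=; near: s.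
- by move/cvgrPdist_lt : Ft; exact.
- by move/cvgrPdist_lt : yF; exact.
- by move/cvgrPdist_lt : vF; exact.
Unshelve. all: by end_near. Qed.

Lemma measurable_seq (s : seq R) : measurable ([set` s] : set (measurableTypeR R)).
Proof. by apply: countable_measurable => //; exact/finite_set_countable/finite_seq. Qed.

Lemma lebesgue_measure_seq (s : seq R) : mu [set` s] = 0%E.
Proof. exact/countable_lebesgue_measure0/finite_set_countable/finite_seq. Qed.

(** At a jump the Caputo derivative carries no meaningful value, so f is replaced by 0 on the null
    set s, where nothing bounds it. *)
Lemma integrable_powR_off_seq (q t0 t1 M : R) (s : seq R) (f : R -> R) : 0 < q ->
  (forall t, t0 <= t <= t1 -> t \notin s -> f @ within `[t0, t1] (nbhs t) --> f t) ->
  (forall t, t0 <= t <= t1 -> t \notin s -> `|f t| <= M) ->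
  mu.-integrable `[t0, t1] (EFin \o (fun t => (t1 - t) `^ (q - 1) * f t)).
Proof.
move=> q0 cf fM; pose f' t := if t \in s then 0 else f t.
have ff' t : t \notin s -> f' t = f t by move=> ts; rewrite /f' (negbTE ts).
have mf : measurable_fun `[t0, t1] f by exact: measurable_fun_cont_off cf.
have mf' : measurable_fun `[t0, t1] f'.
  apply: (@measurable_fun_cont_off R t0 t1 s) => t tT ts; rewrite ff'//.
  apply: cvg_trans (cf t tT ts); apply: near_eq_cvg; apply: cvg_within.
  by apply: filterS (near_notin_seq ts) => u /ff'.
have mw : measurable_fun `[t0, t1] (fun t => (t1 - t) `^ (q - 1)).
  apply: measurable_funTS.
  by apply: (@measurableT_comp _ _ _ _ _ _ (@powR R ^~ (q - 1))) => //; exact: measurable_funB.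
have i' : mu.-integrable `[t0, t1] (EFin \o (fun t => (t1 - t) `^ (q - 1) * f' t)).
  apply: (@integrable_powR_bounded R q t0 t1 `|M|) => // u uT.
  rewrite /f'; case: ifPn => us; first by rewrite normr0.
  by rewrite (le_trans (fM u uT us))// ler_norm.
have s0 := lebesgue_measure_seq s; have ms := measurable_seq s.
apply/(negligible_integrable ms _ _ s0) => //.
  by apply/measurable_EFinP; exact: measurable_funM.
have mwf' : measurable_fun `[t0, t1] (EFin \o (fun t => (t1 - t) `^ (q - 1) * f' t)).
  by apply/measurable_EFinP; exact: measurable_funM.
have id' := (negligible_integrable ms (measurable_itv _) mwf' s0).1 i'.
apply: eq_integrable id' => //; first exact: measurableD.
by move=> t; rewrite inE => -[_ /= /negP ts]; rewrite ff'.
Qed.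

Lemma le_Rintegral_off_seq (t0 t1 : R) (s : seq R) (f g : R -> R) :
  mu.-integrable `[t0, t1] (EFin \o f) -> mu.-integrable `[t0, t1] (EFin \o g) ->
  (forall t, t0 <= t <= t1 -> t \notin s -> f t <= g t) ->
  \int[mu]_(t in `[t0, t1]) f t <= \int[mu]_(t in `[t0, t1]) g t.
Proof.
move=> intf intg fg.
have s0 := lebesgue_measure_seq s; have ms := measurable_seq s.
rewrite /Rintegral (negligible_integral ms _ intf s0)// (negligible_integral ms _ intg s0)//.
apply: le_Rintegral.
- exact: measurableD.
- by apply: integrableS intf => //; exact: measurableD.
- by apply: integrableS intg => //; exact: measurableD.
- by move=> t [/= + ts]; rewrite in_itv/= => tT; apply: fg => //; apply/negP.
Qed.

End weighted.

(** * Bounds near the graph and the increment of J *)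

Section extremal.
Context {R : realType} {n : nat}.
Notation mu := (@lebesgue_measure R).
Variables (t0 t1 al c0 : R) (L : R -> 'rV[R]_n -> 'rV[R]_n -> R) (x psi : R -> 'rV[R]_n).
Variables (S : seq R) (U : set (R * 'rV[R]_n * 'rV[R]_n)).
Hypotheses (ht : t0 < t1) (c00 : 0 < c0).
(** The conclusion of [caputo_density]: one constant c0 serves x, the needle and their sum. *)
Hypothesis capE : forall phi psi : R -> 'rV[R]_n, PC t0 t1 psi ->
  (forall t, t0 <= t <= t1 -> phi t = phi t0 + RLint t0 al psi t) ->
  forall t, t0 <= t <= t1 -> continuous_at_in t0 t1 psi t ->
  caputo t0 t1 al phi t = c0 *: psi t.
Hypothesis cx : forall t, t0 <= t <= t1 -> continuous_at_in t0 t1 x t.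
Hypothesis xE : forall t, t0 <= t <= t1 -> x t = x t0 + RLint t0 al psi t.
Hypothesis SP : forall t, t \in S ->
  [/\ t0 < t < t1, cvg (psi @ t^'-) & cvg (psi @ t^'+)].
Hypothesis Scont : forall t, t0 <= t <= t1 -> t \notin S -> continuous_at_in t0 t1 psi t.
Hypotheses (oU : open U) (graphU : closure (graph t0 t1 al x) `<=` U)
  (UC1 : forall p, U p -> C1_at L p).

Local Notation D := (caputo t0 t1 al x).
Local Notation T := (continuity_points t0 t1 al x).

Lemma PC_psi : PC t0 t1 psi. Proof. by exists S. Qed.

Lemma caputo_off_jumps t : t0 <= t <= t1 -> t \notin S -> D t = c0 *: psi t.
Proof. by move=> tT tS; apply: (capE PC_psi) => //; exact: Scont. Qed.

(** S is finite, so D agrees with c0 psi near t in [t0, t1] and inherits continuity. Conversely S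
    may contain points of T, where the one-sided limits of psi agree. *)
Lemma continuity_off_jumps t : t0 <= t <= t1 -> t \notin S -> T t.
Proof.
move=> tT tS; split=> //; rewrite /continuous_at_in caputo_off_jumps//.
apply: (@cvg_trans _ ((fun s => c0 *: psi s) @ within `[t0, t1] (nbhs t))).
  apply: near_eq_cvg; rewrite near_withinE; apply: filterS (near_notin_seq tS) => s sS.
  by rewrite /= in_itv/= => sT; rewrite caputo_off_jumps.
by apply: cvgZl_tmp; exact: Scont.
Qed.

Lemma near_left_T t : t0 < t <= t1 -> \forall s \near t^'-, t0 <= s <= t1 /\ s \notin S.
Proof.
move=> /andP[tt0 tt1]; near=> s; split; last by near: s; exact: near_left_notin_seq.
apply/andP; split; first by apply: ltW; near: s; exact: nbhs_left_gt.
by rewrite (le_trans _ tt1)// ltW//; near: s; exact: nbhs_left_lt.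
Unshelve. all: by end_near. Qed.

Lemma near_right_T t : t0 <= t < t1 -> \forall s \near t^'+, t0 <= s <= t1 /\ s \notin S.
Proof.
move=> /andP[tt0 tt1]; near=> s; split; last by near: s; exact: near_right_notin_seq.
apply/andP; split; last by apply: ltW; near: s; exact: nbhs_right_lt.
by rewrite (le_trans tt0)// ltW//; near: s; exact: nbhs_right_gt.
Unshelve. all: by end_near. Qed.

(** The closure in [C1_near_graph] acts here: one-sided limits of D at a jump are limits along
    points of the graph. *)
Lemma limit_in_U (F : set_system R) t l : ProperFilter F -> F --> t ->
  (\forall s \near F, T s) -> x @ F --> x t -> D @ F --> l -> U (t, x t, l).
Proof.
move=> FF Ft FT xF DF; apply: graphU => B.
move=> /(cvg_triple _ Ft xF DF) FB.
have [s [Ts Bs]] := filter_ex (filterI FT FB).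
by exists (s, x s, D s); split=> //; exists s.
Qed.

Lemma C1_ball q : U q -> exists r M : R, [/\ 0 < r, 0 < M & forall s y v,
  `|s - q.1.1| < r -> `|y - q.1.2| < r -> `|v - q.2| < r ->
  [/\ U (s, y, v), `|L s y v| <= M & `|Lx L s y v| <= M]].
Proof.
move=> Uq; have [_ _ cL cLx _] := UC1 Uq.
have nU : nbhs q U by exact: open_nbhs_nbhs.
pose M : R := `|Defs.Lfun L q| + `|Lx L q.1.1 q.1.2 q.2| + 1.
have nL : \forall p \near q, `|Defs.Lfun L p| <= M.
  move/cvgrPdist_le : cL => /(_ 1 ltr01); apply: filterS => p h.
  have := ler_normB (Defs.Lfun L q) (Defs.Lfun L q - Defs.Lfun L p); rewrite subKr.
  by have := normr_ge0 (Lx L q.1.1 q.1.2 q.2); rewrite /M; lra.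
have nLx : \forall p \near q, `|Lx L p.1.1 p.1.2 p.2| <= M.
  move/cvgrPdist_le : cLx => /(_ 1 ltr01); apply: filterS => p h.
  have := norm_le_dist (Lx L p.1.1 p.1.2 p.2) (Lx L q.1.1 q.1.2 q.2).
  by have := normr_ge0 (Defs.Lfun L q); rewrite /M; lra.
have [r /= r0 hr] := (nbhs_ballP _ _).1 (filterI nU (filterI nL nLx)).
exists r, M; split=> //.
  by rewrite /M; have := normr_ge0 (Defs.Lfun L q); have := normr_ge0 (Lx L q.1.1 q.1.2 q.2); lra.
move=> s y v sr yr vr.
have [|h1 [h2 h3]] := hr (s, y, v); last by split.
by split; [split|]; rewrite -ball_normE /ball_/= distrC.
Qed.

(** One number M is both the bound and the inverse of the radius, so that the property is monotone
    in M as [segment_uniform] requires. The filter F may be one-sided, relative to the segment, or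
    concentrated at t. *)
Lemma bounds_along (F : set_system R) t l : Filter F -> F --> t ->
  x @ F --> x t -> D @ F --> l -> U (t, x t, l) ->
  exists M : R, 0 < M /\ \forall s \near F, forall y v,
    `|y - x s| <= M^-1 -> `|v - D s| <= M^-1 ->
  [/\ U (s, y, v), `|L s y v| <= M & `|Lx L s y v| <= M].
Proof.
move=> FF Ft xF DF /C1_ball[r [M [r0 M0 hr]]].
have r20 : 0 < r / 2 by rewrite divr_gt0.
(* The new radius is below r / 2, and the other half of r absorbs the variation of x and D along
   F. *)
pose M' := M + (r / 4)^-1.
have M'0 : 0 < M' by rewrite addr_gt0// invr_gt0 divr_gt0.
have M'r : M'^-1 < r / 2.
  apply: (@le_lt_trans _ _ (r / 4)); last by rewrite ltr_pM2l// ltf_pV2 ?posrE// ltr_nat.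
  rewrite -[leRHS]invrK lef_pV2 ?posrE ?invr_gt0 ?divr_gt0//.
  by rewrite /M' lerDr ltW.
have MM' : M <= M' by rewrite /M' lerDl invr_ge0 divr_ge0// ltW.
exists M'; split=> //; near=> s => y v yM vM.
have [] := hr s y v.
- rewrite distrC; near: s; move/cvgrPdist_lt : Ft; exact.
- rewrite (le_lt_trans (ler_distD (x s) _ _))// [ltRHS](splitr r) ltrD// ?(le_lt_trans yM)//.
  by rewrite distrC; near: s; move/cvgrPdist_lt : xF; exact.
- rewrite (le_lt_trans (ler_distD (D s) _ _))// [ltRHS](splitr r) ltrD// ?(le_lt_trans vM)//.
  by rewrite distrC; near: s; move/cvgrPdist_lt : DF; exact.
move=> h1 h2 h3; split=> //; [exact: le_trans h2 _|exact: le_trans h3 _].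
Unshelve. all: by end_near. Qed.

(** Compactness is used on [t0, t1] instead of the closed graph. At a point of S the left limit, the
    right limit and the point itself give three bounds, which are added. *)
Lemma bounds_near_graph : exists2 M : R, 0 < M & forall s y v, T s ->
    `|y - x s| <= M^-1 -> `|v - D s| <= M^-1 ->
  [/\ U (s, y, v), `|L s y v| <= M & `|Lx L s y v| <= M].
Proof.
pose P (M s : R) := 0 < M /\ (T s -> forall y v,
    `|y - x s| <= M^-1 -> `|v - D s| <= M^-1 ->
  [/\ U (s, y, v), `|L s y v| <= M & `|Lx L s y v| <= M]).
have Pmono M M' s : M <= M' -> P M s -> P M' s.
  move=> MM' [M0 h]; have M'0 := lt_le_trans M0 MM'; split=> // Ts y v yM vM.
  have inv : M'^-1 <= M^-1 by rewrite lef_pV2 ?posrE.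
  have [h1 h2 h3] := h Ts y v (le_trans yM inv) (le_trans vM inv).
  by split=> //; [exact: le_trans h2 _|exact: le_trans h3 _].
have at_pt t : T t -> exists M, P M t.
  move=> Tt; have Ut : U (t, x t, D t).
    by apply/graphU/subset_closure; exists t.
  (* The principal filter at t turns the statement along a filter into one at t alone. *)
  have [|||M [M0 hM]] := @bounds_along (globally [set t]) t (D t) _ _ _ _ Ut.
  - by move=> B /nbhs_singleton Bt s ->.
  - by move=> B /nbhs_singleton Bt s ->.
  - by move=> B /nbhs_singleton Bt s ->.
  by exists M; split=> // _; exact: hM.
have [|M M0 hM] := @segment_uniform R t0 t1 P Pmono _; last first.
  by exists M => // s y v Ts; have [_ /(_ Ts)] := hM s Ts.1; exact.
move=> t tT; have [tS|tS] := boolP (t \in S); last first.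
  have Tt := continuity_off_jumps tT tS; have [_ DT] := Tt.
  have Ut : U (t, x t, D t) by apply/graphU/subset_closure; exists t.
  have [|M [M0 hM]] := @bounds_along (within `[t0, t1] (nbhs t)) t (D t) _ _ (cx tT) DT Ut.
    exact: cvg_within.
  exists M; move: hM; rewrite near_withinE; apply: filterS => s h sT; split=> // _.
  by apply: h; rewrite /= in_itv.
have [/andP[tt0 tt1] /cvg_ex[l ll] /cvg_ex[r rr]] := SP tS.
have tl : t0 < t <= t1 by rewrite tt0 ltW.
have tr : t0 <= t < t1 by rewrite tt1 ltW.
have nl := near_left_T tl; have nr := near_right_T tr.
have Dl : D @ t^'- --> c0 *: l.
  apply: (@cvg_trans _ ((fun s => c0 *: psi s) @ t^'-)); last exact: cvgZl_tmp.
  by apply: near_eq_cvg; apply: filterS nl => s [sT sS]; rewrite caputo_off_jumps.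
have Dr : D @ t^'+ --> c0 *: r.
  apply: (@cvg_trans _ ((fun s => c0 *: psi s) @ t^'+)); last exact: cvgZl_tmp.
  by apply: near_eq_cvg; apply: filterS nr => s [sT sS]; rewrite caputo_off_jumps.
have xl : x @ t^'- --> x t by exact: cvg_left_of_in tl (cx tT).
have xr : x @ t^'+ --> x t by exact: cvg_right_of_in tr (cx tT).
have tfl : t^'- --> t by exact: cvg_within.
have tfr : t^'+ --> t by exact: cvg_within.
have Ul : U (t, x t, c0 *: l).
  apply: (@limit_in_U t^'-) => //.
  by apply: filterS nl => s [sT sS]; exact: continuity_off_jumps.
have Ur : U (t, x t, c0 *: r).
  apply: (@limit_in_U t^'+) => //.
  by apply: filterS nr => s [sT sS]; exact: continuity_off_jumps.
have [M1 [M10 h1]] := @bounds_along t^'- t (c0 *: l) _ tfl xl Dl Ul.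
have [M2 [M20 h2]] := @bounds_along t^'+ t (c0 *: r) _ tfr xr Dr Ur.
have [M3 h3] : exists M3, P M3 t.
  have [/at_pt//|nT] := pselect (T t).
  by exists 1; split.
have M30 := h3.1.
exists (M1 + M2 + M3); apply: near_sides => [||_].
- apply: filterS h1 => s h _; apply: (Pmono M1); first by rewrite -addrA lerDl addr_ge0 ?ltW.
  by split=> // _; exact: h.
- apply: filterS h2 => s h _; apply: (Pmono M2); first by rewrite addrAC lerDr addr_ge0 ?ltW.
  by split=> // _; exact: h.
- by apply: Pmono h3; rewrite lerDr addr_ge0 ?ltW.
Qed.

Variables (be : R) (x0 x1 : 'rV[R]_n).
Hypotheses (be0 : 0 < be) (al01 : 0 < al <= 1) (hx0 : x t0 = x0) (hx1 : x t1 = x1).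

Let al0 : 0 < al. Proof. by case/andP: al01. Qed.

Section one_needle.
Variables (a N h : R) (xi : 'rV[R]_n).
Hypotheses (t0a : t0 <= a) (h0 : 0 < h) (N1 : 1 <= N) (ct1 : a + h + N * h < t1).
Let N0 : 0 < N. Proof. exact: lt_le_trans N1. Qed.
Let Nh0 : 0 < N * h. Proof. exact: mulr_gt0. Qed.
Let ab : a < a + h. Proof. by rewrite ltrDl. Qed.
Let bc : a + h < a + h + N * h. Proof. by rewrite ltrDl. Qed.
Let at1 : a < t1. Proof. by rewrite (lt_trans ab)// (lt_trans bc). Qed.

Local Notation k := (needle_ratio al a t1 N h).
Local Notation kinks := [:: a; a + h; a + h + N * h].

(** The factor 1 / c0 cancels the c0 of [capE], so the variation has Caputo derivative exactly
    [profile] times xi off the kinks. *)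
Let dens := needle_density al a t1 N h (c0^-1 *: xi).

Definition profile (t : R) : R :=
  if t < a then 0 else if t < a + h then 1 else if t < a + h + N * h then - k else 0.

(** The factors 1 / Gamma, 1 / al and 1 / c0 come from [RLint], from integrating the power kernel
    and from [dens]. *)
Definition needle_shift (t : R) : 'rV[R]_n := (((Gamma al)^-1 / al / c0) * needle al a t1 N h t) *: xi.

Let densE t : c0 *: dens t = profile t *: xi.
Proof.
rewrite (_ : dens t = profile t *: (c0^-1 *: xi)); last exact: needle_densityE.
by rewrite !scalerA; congr (_ *: _); field; rewrite gt_eqF.
Qed.

Let PC_dens : PC t0 t1 dens. Proof. exact: PC_needle_density. Qed.

Let dens_near t : t \notin kinks -> \forall s \near t, dens s = dens t.
Proof. by rewrite !inE !negb_or => /and3P[ta tb tc]; exact: needle_density_near. Qed.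

Lemma needle_shiftE t : t <= t1 -> needle_shift t = RLint t0 al dens t.
Proof.
move=> tt1; rewrite /dens (RLint_needle_density al01 h0 N0 ct1 _ t0a tt1) scalerA.
by congr (_ *: _); ring.
Qed.

Lemma needle_shift_t0 : needle_shift t0 = 0.
Proof. by rewrite /needle_shift (needle_zero al01 t1 N0 h0 t0a) mulr0 scale0r. Qed.

Lemma needle_shift_t1 : needle_shift t1 = 0.
Proof. by rewrite /needle_shift (needle_end _ _ h0 ct1)// mulr0 scale0r. Qed.

Lemma needle_shift_continuous : continuous needle_shift.
Proof.
move=> t; apply: cvgZr_tmp; apply: cvgM; first exact: cvg_cst.
exact: needle_continuous.
Qed.

Lemma caputo_needle_shift t : t0 <= t <= t1 -> t \notin kinks ->
  caputo t0 t1 al needle_shift t = profile t *: xi.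
Proof.
move=> tT tk; rewrite -densE; apply: (capE PC_dens) => //.
  by move=> s /andP[_ st1]; rewrite needle_shift_t0 add0r needle_shiftE.
apply: cvg_within_filter; apply: cvg_near_cst; exact: dens_near.
Qed.

(** [caputo] is a [lim], not additive without convergence; the sum is handled by [capE] for the
    density psi + dens. *)
Lemma caputo_needle t : t0 <= t <= t1 -> t \notin S ++ kinks ->
  caputo t0 t1 al (fun s => x s + needle_shift s) t = D t + profile t *: xi.
Proof.
rewrite mem_cat negb_or => tT /andP[tS tk].
rewrite -densE caputo_off_jumps// -scalerDr.
apply: (capE (PC_add PC_psi PC_dens)) => //.
  move=> s /[dup] sT /andP[_ st1]; rewrite xE// needle_shift_t0 addr0.
  by rewrite (RLint_add al0 st1 PC_psi PC_dens) addrA needle_shiftE.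
apply: cvgD; first exact: Scont.
apply: cvg_within_filter; apply: cvg_near_cst; exact: dens_near.
Qed.

Lemma admissible_needle : admissible t0 t1 al x0 x1 (fun s => x s + needle_shift s).
Proof.
split; last 2 first.
- by rewrite needle_shift_t0 addr0.
- by rewrite needle_shift_t1 addr0.
split=> [t tT|].
  by apply: cvgD; [exact: cx|apply: cvg_within_filter; exact: needle_shift_continuous].
exists (fun s => psi s + dens s); first exact: PC_add PC_psi PC_dens.
move=> s /[dup] sT /andP[_ st1]; rewrite xE// needle_shift_t0 addr0.
by rewrite (RLint_add al0 st1 PC_psi PC_dens) addrA needle_shiftE.
Qed.

Lemma profile_le1 t : `|profile t| <= 1.
Proof.
have [k0 Nk1 _] := needle_ratio_bounds al01 at1 N0 h0 ct1.
rewrite /profile; case: ifP => _; first by rewrite normr0.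
case: ifP => _; first by rewrite normr1.
case: ifP => _; last by rewrite normr0.
by rewrite normrN gtr0_norm// (le_trans _ Nk1)// ler_peMl// ltW.
Qed.

Lemma normLinfty_needle_shift :
  (normLinfty t0 t1 (caputo t0 t1 al needle_shift) <= (normv xi)%:E)%E.
Proof.
apply/ess_supP.
exists [set` kinks]; split; [exact: measurable_seq|exact: lebesgue_measure_seq|].
move=> t /= h1; apply: contrapT => /negP tk; apply: h1.
rewrite lee_fin patchE; case: ifPn => [|_]; last exact: normv_ge0.
rewrite inE/= in_itv/= => tT; rewrite caputo_needle_shift// normvZ.
by rewrite ler_piMl ?normv_ge0// profile_le1.
Qed.

Lemma caputo_needle_continuous t : t0 <= t <= t1 -> t \notin S ++ kinks ->
  caputo t0 t1 al (fun s => x s + needle_shift s) @ within `[t0, t1] (nbhs t) -->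
  D t + profile t *: xi.
Proof.
move=> tT tF; have := tF; rewrite mem_cat negb_or => /andP[tS tk].
apply: (@cvg_trans _ ((fun s => D s + c0 *: dens s) @ within `[t0, t1] (nbhs t))).
  apply: near_eq_cvg; rewrite near_withinE; apply: filterS (near_notin_seq tF) => s sF.
  by rewrite /= in_itv/= => sT; rewrite caputo_needle// densE.
rewrite -densE; apply: cvgD; first by have [] := continuity_off_jumps tT tS.
apply: cvg_within_filter; apply: cvg_near_cst.
by apply: filterS (dens_near tk) => s ->.
Qed.

End one_needle.

Local Notation w := (fun t => (t1 - t) `^ (be - 1)).

(** One radius for all local estimates at a. The products with the weight are compared directly, as
    they occur in J. Near D a + xi only continuity of L is assumed, so continuity and a bound at
    nearby points are recorded for the integrability of the varied integrand. *)
Lemma local_control (a e e1 : R) (xi : 'rV[R]_n) : T a -> a < t1 -> 0 < e -> 0 < e1 ->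
  (\forall q \near (a, x a, D a + xi), {for q, continuous (Defs.Lfun L)}) ->
  exists2 r : R, 0 < r & forall t y v, `|t - a| < r -> `|y - x a| < r -> `|v - D a| < r ->
    [/\ {for (t, y, v + xi), continuous (Defs.Lfun L)},
        `|L t y (v + xi)| <= `|L a (x a) (D a + xi)| + 1,
        `|w t * L t y (v + xi) - w a * L a (x a) (D a + xi)| <= e &
        `|w t * L t y v - w a * L a (x a) (D a)| <= e] /\
    [/\ C1_at L (t, y, v),
        forall i, `|Ly L t y v 0 i - Ly L a (x a) (D a) 0 i| <= e1 & `|w t - w a| <= e1].
Proof.
move=> Ta at1 e0 e10 cxi.
have wcont (q : R * 'rV[R]_n * 'rV[R]_n) : q.1.1 = a -> w p.1.1 @[p --> q] --> w a.
  move=> qa; apply: (@cvg_comp _ _ _ (fun p : R * 'rV[R]_n * 'rV[R]_n => p.1.1) w _ (nbhs a)).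
    apply: (@cvg_comp _ _ _ fst fst _ (nbhs q.1)); first exact: cvg_fst.
    by rewrite -qa; exact: cvg_fst.
  apply: (@continuous_comp _ _ _ (fun u => t1 - u) (fun u => u `^ (be - 1))).
    by apply: cvgB; [exact: cvg_cst|exact: cvg_id].
  by apply: powR_continuous_gt0; rewrite subr_gt0.
set q0 : R * 'rV[R]_n * 'rV[R]_n := (a, x a, D a).
set qx : R * 'rV[R]_n * 'rV[R]_n := (a, x a, D a + xi).
have U0 : U q0 by apply/graphU/subset_closure; exists a.
have [_ _ cL0 _ cLy] := UC1 U0.
have cLx := nbhs_singleton cxi.
have n1 : \forall p \near qx, `|Defs.Lfun L qx - Defs.Lfun L p| <= 1.
  by move/cvgrPdist_le : cLx; exact.
have n2 : \forall p \near qx, `|w a * Defs.Lfun L qx - w p.1.1 * Defs.Lfun L p| <= e.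
  have c : w p.1.1 * Defs.Lfun L p @[p --> qx] --> w a * Defs.Lfun L qx.
    by apply: cvgM; [exact: wcont|exact: cLx].
  by move/cvgrPdist_le : c; exact.
have n3 : \forall p \near q0, `|w a * Defs.Lfun L q0 - w p.1.1 * Defs.Lfun L p| <= e.
  have c : w p.1.1 * Defs.Lfun L p @[p --> q0] --> w a * Defs.Lfun L q0.
    by apply: cvgM; [exact: wcont|exact: cL0].
  by move/cvgrPdist_le : c; exact.
have n4 : \forall p \near q0, `|w a - w p.1.1| <= e1.
  have c : w p.1.1 @[p --> q0] --> w a by exact: wcont.
  by move/cvgrPdist_le : c; exact.
have n5 : \forall p \near q0, `|Ly L q0.1.1 q0.1.2 q0.2 - Ly L p.1.1 p.1.2 p.2| <= e1.
  by move/cvgrPdist_le : cLy; exact.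
have n6 : nbhs q0 U by exact: open_nbhs_nbhs.
have [r1 /= r10 h1] := (nbhs_ballP _ _).1 (filterI cxi (filterI n1 n2)).
have [r2 /= r20 h2] := (nbhs_ballP _ _).1 (filterI (filterI n3 n4) (filterI n5 n6)).
exists (Num.min r1 r2); first by rewrite lt_min r10 r20.
move=> t y v; rewrite !lt_min => /andP[t_1 t_2] /andP[y_1 y_2] /andP[v_1 v_2].
have [|g1 [g2 g3]] := h1 (t, y, v + xi).
  split; [split|]; rewrite -ball_normE /ball_/= distrC//.
  by rewrite opprD addrACA subrr addr0.
have [|[g4 g5] [g6 g7]] := h2 (t, y, v).
  by split; [split|]; rewrite -ball_normE /ball_/= distrC.
split; split.
- exact: g1.
- have := ler_normB (Defs.Lfun L qx) (Defs.Lfun L qx - Defs.Lfun L (t, y, v + xi)).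
  by rewrite subKr => /le_trans; apply; rewrite lerD2l.
- by rewrite distrC.
- by rewrite distrC.
- exact: UC1.
- move=> i; rewrite (le_trans _ g6)// distrC (le_trans _ (le_entry_mx_norm _ i))//.
  by rewrite !mxE.
- by rewrite distrC.
Qed.

(* With N large the second interval carries a density of norm at most |xi| / N, so L can be
   linearised there: it contributes - (t1 - a)^(be - 1) * <Ly, xi> * h to the increment of J, while
   the first interval contributes the increment of L in its last argument times the same weight.
   The displacement of x itself costs only o(h). *)
Lemma weierstrass_before_end (a delta : R) (xi : 'rV[R]_n) : T a -> a < t1 -> 0 < delta ->
  (\forall q \near (a, x a, D a + xi), {for q, continuous (Defs.Lfun L)}) ->
  (forall y : R -> 'rV[R]_n, (forall t, t0 <= t <= t1 -> normv (y t) <= delta) ->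
     (normLinfty t0 t1 (caputo t0 t1 al y) <= (normv xi)%:E)%E ->
     let z := fun t => x t + y t in
     admissible t0 t1 al x0 x1 z -> J_defined t0 t1 al be L z ->
     J t0 t1 al be L x <= J t0 t1 al be L z) ->
  0 <= weierstrass L a (x a) (D a) (D a + xi).
Proof.
move=> Ta at1 delta0 cxi minx.
have [/andP[t0a _] cD] := Ta.
set E := weierstrass _ _ _ _ _.
pose p := Ly L a (x a) (D a); pose G := dotv p xi.
pose La := L a (x a) (D a); pose Lxi := L a (x a) (D a + xi).
pose wa : R := (t1 - a) `^ (be - 1).
have EE : E = Lxi - La - G
  by rewrite /E /weierstrass (_ : D a + xi - D a = xi)// addrAC subrr add0r.
have wa0 : 0 < wa by rewrite powR_gt0// subr_gt0.
suff main e : 0 < e -> 0 <= wa * E + e.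
  rewrite -(pmulr_rge0 _ wa0); apply/ler_addgt0Pr => e /main; exact.
(* Four errors share e: the displacement of x, the approximation on each of the two intervals, and
   the defect 1 - N k. *)
move=> e_gt0; pose e' := e / 4.
have e'0 : 0 < e' by rewrite divr_gt0.
have [M M0 hM] := bounds_near_graph.
pose k0 := (Gamma al)^-1 / al / c0.
have k00 : 0 < k0 by rewrite !divr_gt0// invr_gt0 Gamma_gt0.
pose nn : R := n%:R; have nn0 : 0 <= nn by [].
(* Q collects what multiplies e1 on the second interval: |G| for freezing the weight at a, and (wa +
   1) nn |xi| for freezing Ly. The 1 keeps Q positive. *)
pose Q := 1 + `|G| + (wa + 1) * nn * `|xi|.
have Q0 : 0 < Q by rewrite /Q -addrA ltr_wpDr// addr_ge0// !mulr_ge0// addr_ge0// ltW.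
pose e1 := Num.min 1 (e' / Q).
have e10 : 0 < e1 by rewrite lt_min ltr01 divr_gt0.
have e11 : e1 <= 1 by rewrite ge_min lexx.
have e1Q : e1 * Q <= e' by rewrite -ler_pdivlMr// ge_min lexx orbT.
(* Half of e' for each of the two values of w L compared on the first interval. *)
have e20 : 0 < e' / 2 by rewrite divr_gt0.
have [r r0 hr] := local_control Ta at1 e20 e10 cxi.
have r20 : 0 < r / 2 by rewrite divr_gt0.
(* Since k <= 1 / N, this N brings k |xi| below M^-1, inside the tube around the graph, and below r
   / 2, where Ly is nearly constant. *)
pose N := 1 + `|xi| * M + `|xi| / (r / 2).
have N1 : 1 <= N by rewrite /N -addrA lerDl addr_ge0// ?mulr_ge0 ?invr_ge0// ltW.
have N0 : 0 < N by exact: lt_le_trans N1.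
have xiN1 : `|xi| / N <= M^-1.
  rewrite ler_pdivrMr// ler_pdivlMl// mulrC /N -addrA addrC -addrA lerDl.
  by rewrite addr_ge0// divr_ge0// ltW.
have xiN2 : `|xi| / N <= r / 2.
  rewrite ler_pdivrMr// mulrC -ler_pdivrMr// /N lerDr.
  by rewrite addr_ge0// mulr_ge0// ltW.
(* The cost in L of the displacement y per unit of the scalar needle: n coordinates, |Lx| <= M and
   |y| = k0 |xi| |g|. *)
pose Lip := nn * M * (k0 * `|xi|).
have Lip0 : 0 <= Lip.
  by apply: mulr_ge0; apply: mulr_ge0 => //; exact: ltW.
have small (K b : R) : 0 <= K -> 0 < b -> \forall u \near 0^'+, K * u <= b.
  move=> K0 b0; near=> u.
  have u0 : 0 < u by near: u; exact: nbhs_right_gt.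
  have : u < b / (K + 1) by near: u; apply: nbhs_right_lt; rewrite divr_gt0// ltr_wpDl.
  rewrite ltr_pdivlMr ?ltr_wpDl// => /ltW; apply: le_trans.
  by rewrite mulrC ler_wpM2l ?lerDl// ltW.
have [d d0 hd] : exists2 d : R, 0 < d & forall t, t0 <= t <= t1 -> `|t - a| < d ->
    `|x t - x a| < r / 2 /\ `|D t - D a| < r / 2.
  have aT : t0 <= a <= t1 by rewrite t0a ltW.
  have n1 : \forall s \near within `[t0, t1] (nbhs a), `|x a - x s| < r / 2.
    by move/cvgrPdist_lt : (cx aT); exact.
  have n2 : \forall s \near within `[t0, t1] (nbhs a), `|D a - D s| < r / 2.
    by move/cvgrPdist_lt : cD; exact.
  rewrite near_withinE in n1; rewrite near_withinE in n2.
  have [d /= d0 hd] := filterI n1 n2; exists d => // t tT td.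
  have [|h1 h2] := hd t; first by rewrite /= distrC.
  by split; rewrite distrC; [apply: h1|apply: h2]; rewrite /= in_itv.
have kx0 : 0 <= k0 * `|xi| by rewrite mulr_ge0// ltW.
have [e2 [e2_gt0 E1 E2] [E3 E4 E5]] : exists2 e2 : R,
    [/\ 0 < e2, Lip * e2 <= e' & wa * `|G| * e2 <= e'] &
    [/\ k0 * `|xi| * e2 <= M^-1, k0 * `|xi| * e2 <= r / 2 / 2 & k0 * normv xi * e2 <= delta].
  near (0 : R)^'+ => u; exists u; split.
  - by near: u; exact: nbhs_right_gt.
  - by near: u; exact: small.
  - by near: u; apply: small => //; rewrite mulr_ge0// ltW.
  - by near: u; apply: small => //; rewrite invr_gt0.
  - by near: u; apply: small => //; rewrite divr_gt0.
  - by near: u; apply: small => //; rewrite mulr_ge0 ?normv_ge0// ltW.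
have [h [h0 hd'] [ct1 klow gsup gint]] : exists2 h : R,
   0 < h /\ (1 + N) * h <= Num.min d r / 2 &
   [/\ a + h + N * h < t1, 1 - e2 <= N * needle_ratio al a t1 N h,
   (forall t, `|needle al a t1 N h t| <= e2) &
   (\int[mu]_(t in `[t0, t1]) ((t1 - t) `^ (be - 1) * `|needle al a t1 N h t|)%:E <=
    (h * e2)%:E)%E].
  near (0 : R)^'+ => u; exists u; last by near: u; exact: needle_small.
  split; first by near: u; exact: nbhs_right_gt.
  near: u; apply: small; first by rewrite addr_ge0// ltW.
  by rewrite divr_gt0// lt_min d0.
have [k_gt0 Nk1 _] := needle_ratio_bounds al01 at1 N0 h0 ct1.
set k := needle_ratio al a t1 N h in klow k_gt0 Nk1.
pose g := needle al a t1 N h.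
pose y := needle_shift a N h xi.
pose z := fun t => x t + y t.
have ynorm t : `|y t| = k0 * `|xi| * `|g t|.
  by rewrite /y /needle_shift normrZ normrM (gtr0_norm k00) mulrAC.
have ysmall t : `|y t| <= k0 * `|xi| * e2.
  by rewrite ynorm ler_wpM2l ?gsup// mulr_ge0// ltW.
have yM t : `|y t| <= M^-1 := le_trans (ysmall t) E3.
have yr2 t : `|y t| < r / 2.
  by rewrite (le_lt_trans (ysmall t))// (le_lt_trans E4)// ltr_pdivrMr// ltr_pMr// ltr1n.
have ydelta t : t0 <= t <= t1 -> normv (y t) <= delta.
  move=> _; rewrite /y /needle_shift normvZ normrM (gtr0_norm k00) (le_trans _ E5)//.
  by rewrite mulrAC ler_wpM2l ?gsup// mulr_ge0 ?normv_ge0// ltW.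
have adm := admissible_needle xi t0a h0 N1 ct1.
have ynorminf := normLinfty_needle_shift xi t0a h0 N1 ct1.
pose f t := L t (x t) (D t).
pose fz t := L t (z t) (caputo t0 t1 al z t).
set F := S ++ [:: a; a + h; a + h + N * h].
have FS t : t \notin F -> t \notin S by rewrite mem_cat negb_or => /andP[].
have Dz t : t0 <= t <= t1 -> t \notin F -> caputo t0 t1 al z t = D t + profile a N h t *: xi.
  exact: caputo_needle.
have zE t : `|z t - x t| <= M^-1 by rewrite /z addrC addKr.
pose S1 t : R := \1_(`[a, a + h[%classic : set R) t.
pose S2 t : R := \1_(`[a + h, a + h + N * h[%classic : set R) t.
(* Upper bounds for the increment of the weighted integrand on the two intervals. The error e' / N
   on the second becomes e' h over its length N h. *)
pose P1 := wa * (Lxi - La) + e'; pose P2 := - (wa * k * G) + e' / N.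
pose Phi t := P1 * S1 t + P2 * S2 t.
have hc t : a <= t < a + h + N * h -> `|t - a| < d /\ `|t - a| < r.
  move=> /andP[at_ tc]; have m0 : 0 < Num.min d r by rewrite lt_min d0.
  suff : `|t - a| < Num.min d r by rewrite lt_min => /andP.
  by rewrite ger0_norm ?subr_ge0//; move: (Num.min d r) m0 hd' => m; lra.
have S1in t : a <= t < a + h -> S1 t = 1 /\ S2 t = 0.
  by move=> tab; rewrite /S1 /S2 !indicE !mem_setE !in_itv/= tab leNgt; case/andP: tab => _ ->.
have S2in t : a + h <= t < a + h + N * h -> S1 t = 0 /\ S2 t = 1.
  move=> tbc; rewrite /S1 /S2 !indicE !mem_setE !in_itv/= tbc ltNge; case/andP: tbc => -> _.
  by rewrite andbF.
have S3in t : (t < a) || (a + h + N * h <= t) -> S1 t = 0 /\ S2 t = 0.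
  rewrite /S1 /S2 !indicE !mem_setE !in_itv/= => /orP[ta|ct].
    by rewrite leNgt ta leNgt (lt_trans ta) ?ltrDl.
  have bt : a + h <= t by rewrite (le_trans _ ct)// lerDl mulr_ge0// ltW.
  by rewrite ltNge bt ltNge ct !andbF.
have lip t v : T t -> `|v - D t| <= M^-1 -> L t (z t) v <= L t (x t) v + Lip * `|g t|.
  move=> Tt vM.
  (* Taking 0 as approximate gradient turns the lemma into a Lipschitz estimate in x. *)
  have := @grad_increment _ _ (fun u => L t u v) (x t) 0 (y t) M^-1 M (yM t).
  have -> : dotv 0 (y t) = 0 by rewrite /dotv big1// => i _; rewrite mxE mul0r.
  rewrite subr0 ynorm => inc.
  rewrite -lerBlDl (le_trans (ler_norm _))// (le_trans (inc _))//; last by rewrite /Lip !mulrA.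
  move=> u uM; have [Uu _ Lxu] := hM t u v Tt uM vM.
  have [hg _ _ _ _] := UC1 Uu; split=> // i.
  by rewrite [X in _ - X]mxE subr0 (le_trans (le_entry_mx_norm _ _)).
have w0 t : 0 <= w t by exact: powR_ge0.
have half (v1 v2 : 'rV[R]_n) : `|v1 - v2| < r / 2 -> `|v1 - v2| < r.
  by move=> h2; rewrite (lt_trans h2)// ltr_pdivrMr// ltr_pMr// ltr1n.
have zr t : `|x t - x a| < r / 2 -> `|z t - x a| < r.
  move=> xd; rewrite /z addrAC (le_lt_trans (ler_normD _ _))// [ltRHS](splitr r).
  by rewrite ltrD// yr2.
have pw t : t0 <= t <= t1 -> t \notin F ->
    w t * fz t <= w t * f t + (Lip * (w t * `|g t|) + Phi t).
  move=> tT tF; have tS := FS t tF; have Tt := continuity_off_jumps tT tS.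
  (* Outside both intervals the derivative is unchanged, and only the displacement of x costs
     anything. *)
  have out : profile a N h t = 0 -> S1 t = 0 /\ S2 t = 0 ->
      w t * fz t <= w t * f t + (Lip * (w t * `|g t|) + Phi t).
    move=> pr0 [s1 s2]; rewrite /Phi s1 s2 !mulr0 !addr0 /fz Dz// pr0 scale0r addr0.
    rewrite (mulrCA Lip) -mulrDr ler_wpM2l//; apply: lip => //.
    by rewrite subrr normr0 invr_ge0 ltW.
  have [ta|ta] := ltP t a.
    by apply: out; [rewrite /profile ta|apply: S3in; rewrite ta].
  have [tb|tb] := ltP t (a + h).
    have [s1 s2] : S1 t = 1 /\ S2 t = 0 by apply: S1in; rewrite ta.
    have tac : a <= t < a + h + N * h.
      by rewrite ta (lt_trans tb)// ltrDl mulr_gt0.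
    have [td tr] := hc t tac; have [xd Dd] := hd t tT td.
    have [[_ _ q1 _] _] := hr t (z t) (D t) tr (zr t xd) (half _ _ Dd).
    have [[_ _ _ q2] _] := hr t (x t) (D t) tr (half _ _ xd) (half _ _ Dd).
    have pr1 : profile a N h t = 1 by rewrite /profile ltNge ta tb.
    rewrite /Phi s1 s2 mulr1 mulr0 addr0 /fz Dz// pr1 scale1r.
    have Lw : 0 <= Lip * (w t * `|g t|) by rewrite mulr_ge0// mulr_ge0.
    move: q1 q2 Lw; rewrite -/wa -/Lxi -/La -/(f t) /P1 !ler_norml mulrBr.
    move: (Lip * _) (_ * L _ _ _) (_ * f t) (wa * Lxi) (wa * La) => B1 B2 B3 B4 B5.
    by move=> /andP[? ?] /andP[? ?] ?; lra.
  have [tc|tc] := ltP t (a + h + N * h); last first.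
    apply: out; last by apply: S3in; rewrite tc orbT.
    by rewrite /profile !ltNge ta tb tc.
  have [s1 s2] : S1 t = 0 /\ S2 t = 1 by apply: S2in; rewrite tb.
  have tac : a <= t < a + h + N * h by rewrite ta.
  have [td tr] := hc t tac; have [xd Dd] := hd t tT td.
  have prk : profile a N h t = - k by rewrite /profile ltNge ta/= ltNge tb/= tc.
  rewrite /Phi s1 s2 mulr1 mulr0 add0r /fz Dz// prk.
  pose u := - k *: xi.
  have uE : `|u| = k * `|xi| by rewrite /u normrZ normrN gtr0_norm.
  have uN : `|u| <= `|xi| / N.
    by rewrite uE mulrC ler_wpM2l// -[leRHS]mul1r ler_pdivlMr// mulrC.
  have uM : `|u| <= M^-1 := le_trans uN xiN1.
  have u_r : `|u| <= r / 2 := le_trans uN xiN2.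
  have l1 := lip t (D t + u) Tt; rewrite addrAC subrr add0r in l1; have {}l1 := l1 uM.
  (* Linearisation with the gradient p taken at a; Ly differs from it by at most e1 throughout the
     ball of radius r. *)
  have l2 := @grad_increment _ _ (fun v => L t (x t) v) (D t) p u (r / 2) e1 u_r.
  have {}l2 := le_trans (ler_norm _) (l2 _).
  have [_ [_ _ wdist]] := hr t (x t) (D t) tr (half _ _ xd) (half _ _ Dd).
  have pu : dotv p u = - k * G by rewrite /u dotvZr.
  rewrite pu uE in l2.
  have {}l2 : L t (x t) (D t + u) - f t - - k * G <= nn * e1 * (k * `|xi|).
    apply: l2 => v vr.
    have vDa : `|v - D a| < r.
      rewrite (le_lt_trans (ler_distD (D t) _ _))// [ltRHS](splitr r).
      by rewrite ler_ltD.
    by have [_ [[_ hg _ _ _] hL _]] := hr t (x t) v tr (half _ _ xd) vDa.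
  rewrite (mulrCA Lip) -/u.
  have wwa : w t <= wa + 1.
    rewrite -lerBlDl (le_trans (ler_norm _))// (le_trans wdist)//.
  have kN : k <= N^-1 by rewrite -[leRHS]mul1r ler_pdivlMr// mulrC.
  (* Every error carries the factor k <= 1 / N, which compensates the length N h of this
     interval. *)
  have key : w t * (- k * G + nn * e1 * (k * `|xi|)) <= - (wa * k * G) + e' / N.
    have s3 : (wa - w t) * G <= e1 * `|G|.
      rewrite (le_trans (ler_norm _))// normrM ler_wpM2r// distrC//.
    have s4 : w t * (nn * `|xi|) <= (wa + 1) * (nn * `|xi|) by rewrite ler_wpM2r// mulr_ge0.
    have s5 : (wa - w t) * G + e1 * (w t * (nn * `|xi|)) <= e'.
      apply: le_trans e1Q; rewrite /Q mulrDr mulrDr -addrA.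
      apply: (@le_trans _ _ (e1 * `|G| + e1 * ((wa + 1) * nn * `|xi|))).
        by rewrite lerD// ler_wpM2l ?(ltW e10)// -mulrA.
      by rewrite mulr1 lerDr ltW.
    rewrite -lerBlDl (_ : _ - _ = k * ((wa - w t) * G + e1 * (w t * (nn * `|xi|)))); last by ring.
    apply: (@le_trans _ _ (k * e')); first by apply: ler_wpM2l => //; exact: ltW.
    by rewrite mulrC; apply: ler_wpM2l => //; exact: ltW.
  have w1 : w t * L t (z t) (D t + u) <= w t * (L t (x t) (D t + u) + Lip * `|g t|).
    exact: ler_wpM2l.
  have w2 : w t * L t (x t) (D t + u) <= w t * (f t + (- k * G + nn * e1 * (k * `|xi|))).
    by apply: ler_wpM2l => //; move: l2; lra.
  rewrite mulrDr in w1; rewrite mulrDr in w2.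
  rewrite (le_trans w1)// [leLHS]addrC [leRHS]addrCA lerD2l.
  by rewrite (le_trans w2)// lerD2l.
have cvgL (Y V : R -> 'rV[R]_n) t vt : {for (t, Y t, vt), continuous (Defs.Lfun L)} ->
    continuous_at_in t0 t1 Y t -> V @ within `[t0, t1] (nbhs t) --> vt -> V t = vt ->
    (fun s => L s (Y s) (V s)) @ within `[t0, t1] (nbhs t) --> L t (Y t) (V t).
  move=> c cY cV VE B; rewrite VE => /c.
  move=> nB.
  have trip := @cvg_triple R n (within `[t0, t1] (nbhs t)) Y V t (Y t) vt
    (fun q => B (Defs.Lfun L q)).
  have tc : within `[t0, t1] (nbhs t) --> t by exact: cvg_within.
  exact: (trip _ tc cY cV nB).
have M_ge0 : 0 <= M^-1 by rewrite invr_ge0 ltW.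
have int_x : mu.-integrable `[t0, t1] (EFin \o (fun t => w t * f t)).
  apply: (@integrable_powR_off_seq R be t0 t1 M S) => // t tT tS.
    have Tt := continuity_off_jumps tT tS; have [_ DT] := Tt.
    apply: (cvgL _ _ _ (D t)) => //; last exact: cx.
    have [Ut _ _] : [/\ U (t, x t, D t), `|L t (x t) (D t)| <= M & `|Lx L t (x t) (D t)| <= M].
      by apply: hM => //; rewrite subrr normr0.
    by have [] := UC1 Ut.
  have [_ + _] : [/\ U (t, x t, D t), `|L t (x t) (D t)| <= M & `|Lx L t (x t) (D t)| <= M].
    by apply: hM; rewrite ?subrr ?normr0//; exact: continuity_off_jumps.
  by [].
(* On the first interval D + xi may leave U and [hr] takes over; elsewhere the perturbation of D is
   at most M^-1 and the tube applies. *)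
have zpt t : t0 <= t <= t1 -> t \notin F ->
    {for (t, z t, D t + profile a N h t *: xi), continuous (Defs.Lfun L)} /\
    `|L t (z t) (D t + profile a N h t *: xi)| <= M + (`|Lxi| + 1).
  move=> tT tF; have Tt := continuity_off_jumps tT (FS t tF).
  have inU pr : `|pr *: xi| <= M^-1 ->
    {for (t, z t, D t + pr *: xi), continuous (Defs.Lfun L)} /\
    `|L t (z t) (D t + pr *: xi)| <= M + (`|Lxi| + 1).
    move=> prM; have [||Ut LM _] := hM t (z t) (D t + pr *: xi) Tt.
    - exact: zE.
    - by rewrite addrAC subrr add0r.
    by split; [have [] := UC1 Ut|rewrite (le_trans LM)// lerDl addr_ge0].
  have pr0M : `|0 *: xi| <= M^-1 by rewrite scale0r normr0.
  rewrite /profile; have [ta|ta] := ltP t a; first exact: inU.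
  have [tb|tb] := ltP t (a + h).
    have tac : a <= t < a + h + N * h.
      by rewrite ta (lt_trans tb)// ltrDl mulr_gt0.
    have [td tr] := hc t tac; have [xd Dd] := hd t tT td.
    have [[q1 q2 _ _] _] := hr t (z t) (D t) tr (zr t xd) (half _ _ Dd).
    by rewrite scale1r; split=> //; rewrite (le_trans q2)// lerDr ltW.
  have [tc|tc] := ltP t (a + h + N * h); last exact: inU.
  apply: inU; rewrite normrZ normrN gtr0_norm// (le_trans _ xiN1)//.
  by rewrite mulrC ler_wpM2l// -[leRHS]mul1r ler_pdivlMr// mulrC.
have int_z : mu.-integrable `[t0, t1] (EFin \o (fun t => w t * fz t)).
  apply: (@integrable_powR_off_seq R be t0 t1 (M + (`|Lxi| + 1)) F) => // t tT tF.
    have [q1 _] := zpt t tT tF.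
    apply: (cvgL _ _ _ (D t + profile a N h t *: xi)) => //.
    - by have [[+ _] _ _] := adm; apply.
    - exact: caputo_needle_continuous.
    - exact: Dz.
  by have [_ q2] := zpt t tT tF; rewrite /fz Dz.
have int_g : mu.-integrable `[t0, t1] (EFin \o (fun t => w t * `|g t|)).
  apply: (@integrable_powR_bounded R be t0 t1 e2) => // [|u _]; last by rewrite normr_id gsup.
  apply: measurable_funTS; apply: measurableT_comp => //.
  by apply: continuous_measurable_fun; exact: needle_continuous.
have indic (u v : R) : t0 <= u -> u < v -> v <= t1 ->
    mu.-integrable `[t0, t1] (EFin \o (fun t => \1_(`[u, v[%classic : set R) t)) /\
    \int[mu]_(t in `[t0, t1]) (\1_(`[u, v[%classic : set R) t) = v - u.
  move=> tu uv vt; split.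
    have mi : measurable_fun [set: R] (\1_(`[u, v[%classic : set R) : R -> R).
      by apply: measurable_indic; exact: measurable_itv.
    apply: (@bounded_integrable _ _ _ 1); first exact: measurable_funTS mi.
    by move=> t _; rewrite indicE; case: (_ \in _); rewrite ?normr0 ?normr1.
  rewrite /Rintegral integral_indic//.
  rewrite (_ : _ `&` _ = `[u, v[%classic); last first.
    apply/seteqP; split=> [t []//|t /= tuv]; split=> //.
    move: tuv; rewrite /= !in_itv/= => /andP[t1' t2'].
    by rewrite (le_trans tu t1') (le_trans (ltW t2') vt).
  have e3 : lebesgue_measure (`[u, v[%classic : set R) = (v - u)%:E.
    by rewrite lebesgue_measure_itv/= lte_fin uv.
  exact: (congr1 fine e3).
have aab : a < a + h by rewrite ltrDl.
have abc : a + h < a + h + N * h by rewrite ltrDl mulr_gt0.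
have [int_S1 I1'] := indic a (a + h) t0a aab (ltW (lt_trans abc ct1)).
have [int_S2 I2'] := indic (a + h) (a + h + N * h) (le_trans t0a (ltW aab)) abc (ltW ct1).
have I1 : \int[mu]_(t in `[t0, t1]) S1 t = h by rewrite I1' addrAC subrr add0r.
have I2 : \int[mu]_(t in `[t0, t1]) S2 t = N * h.
  by rewrite I2' addrAC subrr add0r.
have Ig : \int[mu]_(t in `[t0, t1]) (w t * `|g t|) <= h * e2.
  rewrite -lee_fin /Rintegral fineK; first exact: gint.
  exact: (integrable_fin_num _ int_g).
have int_Phi : mu.-integrable `[t0, t1] (EFin \o Phi).
  by have := integrableD _ (integrableZl _ P1 int_S1) (integrableZl _ P2 int_S2); apply.
have int_Lg : mu.-integrable `[t0, t1] (EFin \o (fun t => Lip * (w t * `|g t|))).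
  by have := integrableZl _ Lip int_g; apply.
have int_R2 : mu.-integrable `[t0, t1] (EFin \o (fun t => Lip * (w t * `|g t|) + Phi t)).
  by have := integrableD _ int_Lg int_Phi; apply.
have int_R : mu.-integrable `[t0, t1]
    (EFin \o (fun t => w t * f t + (Lip * (w t * `|g t|) + Phi t))).
  by have := integrableD _ int_x int_R2; apply.
have le1 := le_Rintegral_off_seq int_z int_R pw.
have le2 : J t0 t1 al be L x <= J t0 t1 al be L z := minx y ydelta ynorminf adm int_z.
have IPhi : \int[mu]_(t in `[t0, t1]) Phi t = P1 * h + P2 * (N * h).
  rewrite RintegralD//; last 2 first.
  - exact: (integrableZl _ P1 int_S1).
  - exact: (integrableZl _ P2 int_S2).
  by rewrite RintegralZl// RintegralZl// I1 I2.
have eR : \int[mu]_(t in `[t0, t1]) (w t * f t + (Lip * (w t * `|g t|) + Phi t)) =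
    J t0 t1 al be L x + (Lip * (\int[mu]_(t in `[t0, t1]) (w t * `|g t|)) +
    (P1 * h + P2 * (N * h))).
  rewrite RintegralD; [|exact: measurable_itv|exact: int_x|exact: int_R2].
  rewrite RintegralD; [|exact: measurable_itv|exact: int_Lg|exact: int_Phi].
  by rewrite IPhi RintegralZl; [|exact: measurable_itv|exact: int_g].
(* J x cancels between minimality and the integrated pointwise bound; what remains has the factor h,
   divided out next. *)
have {le1 le2} le : 0 <= Lip * (h * e2) + (P1 * h + P2 * (N * h)).
  rewrite eR in le1; have := le_trans le2 le1; rewrite lerDl => /le_trans; apply.
  by rewrite lerD2r; apply: ler_wpM2l.
have {}le : 0 <= h * (Lip * e2 + (P1 + P2 * N)).
  by rewrite (le_trans le)// le_eqVlt; apply/orP; left; apply/eqP; ring.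
rewrite pmulr_rge0// in le.
rewrite (le_trans le)// EE /P1 /P2 mulrDl divfK ?gt_eqF//.
(* Replacing N k by 1 costs at most wa |G| e2, because 0 <= 1 - N k <= e2. *)
have Gk : - (wa * k * G) * N <= - (wa * G) + e'.
  apply: le_trans (_ : - (wa * G) + wa * `|G| * e2 <= _); last by rewrite lerD2l.
  rewrite -subr_ge0 (_ : _ - _ = wa * (`|G| * e2 - G * (1 - N * k))); last by ring.
  rewrite mulr_ge0 ?(ltW wa0)// subr_ge0 (le_trans (ler_norm _))// normrM ler_wpM2l//.
  rewrite ger0_norm ?subr_ge0//; lra.
have : e' * 4 = e by rewrite /e' divfK.
by move: Gk E1; rewrite !mulrBr; move: (Lip * e2) (wa * Lxi) (wa * La) (wa * G) => A1 A2 A3 A4; lra.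
Unshelve. all: by end_near. Qed.

Lemma dotv_cvg (F : set_system R) (q : R -> 'rV[R]_n) (p u : 'rV[R]_n) : Filter F ->
  q @ F --> p -> (fun t => dotv (q t) u) @ F --> dotv p u.
Proof.
move=> FF qp; rewrite /dotv; apply: cvg_big => [|i _]; first exact: add_continuous.
apply: cvgM; last exact: cvg_cst.
apply: (@cvg_comp _ _ _ q (fun v : 'rV[R]_n => v 0 i) _ (nbhs p)) => //.
exact: coord_continuous.
Qed.

(** There is no room for a needle to the right of t1, and the weight may vanish or blow up there;
    the inequality is the left limit of those at points off S. *)
Lemma weierstrass_at_end (xi : 'rV[R]_n) : T t1 ->
  {for (t1, x t1, D t1 + xi), continuous (Defs.Lfun L)} ->
  (forall t, T t -> t < t1 -> 0 <= weierstrass L t (x t) (D t) (D t + xi)) ->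
  0 <= weierstrass L t1 (x t1) (D t1) (D t1 + xi).
Proof.
move=> Tt1 cxi pos; have [t1T Dt1] := Tt1.
have t01 : t0 < t1 <= t1 by rewrite ht lexx.
have Dl : D @ t1^'- --> D t1 by exact: cvg_left_of_in t01 Dt1.
have xl : x @ t1^'- --> x t1 by exact: cvg_left_of_in t01 (cx t1T).
have tl : t1^'- --> t1 by exact: cvg_within.
have U1 : U (t1, x t1, D t1) by apply/graphU/subset_closure; exists t1.
have [_ _ cL _ cLy] := UC1 U1.
have Dxi : (fun t => D t + xi) @ t1^'- --> D t1 + xi by apply: cvgD => //; exact: cvg_cst.
have l1 : (fun t => L t (x t) (D t + xi)) @ t1^'- --> L t1 (x t1) (D t1 + xi).
  move=> B nB; have trip := @cvg_triple R n t1^'- x (fun t => D t + xi) t1 (x t1) (D t1 + xi)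
    (fun q => B (Defs.Lfun L q)).
  exact: (trip _ tl xl Dxi (cxi B nB)).
have l2 : (fun t => L t (x t) (D t)) @ t1^'- --> L t1 (x t1) (D t1).
  move=> B nB; have trip := @cvg_triple R n t1^'- x D t1 (x t1) (D t1)
    (fun q => B (Defs.Lfun L q)).
  exact: (trip _ tl xl Dl (cL B nB)).
have l3 : (fun t => Ly L t (x t) (D t)) @ t1^'- --> Ly L t1 (x t1) (D t1).
  move=> B nB; have trip := @cvg_triple R n t1^'- x D t1 (x t1) (D t1)
    (fun q => B (Ly L q.1.1 q.1.2 q.2)).
  exact: (trip _ tl xl Dl (cLy B nB)).
have WE t : weierstrass L t (x t) (D t) (D t + xi) =
    L t (x t) (D t + xi) - L t (x t) (D t) - dotv (Ly L t (x t) (D t)) xi.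
  by rewrite /weierstrass (_ : D t + xi - D t = xi)// addrAC subrr add0r.
rewrite WE.
have lim : (fun t => L t (x t) (D t + xi) - L t (x t) (D t) - dotv (Ly L t (x t) (D t)) xi) @ t1^'-
    --> L t1 (x t1) (D t1 + xi) - L t1 (x t1) (D t1) - dotv (Ly L t1 (x t1) (D t1)) xi.
  by apply: cvgB; [exact: cvgB|exact: dotv_cvg].
rewrite -(cvg_lim (@Rhausdorff R) lim); apply: limr_ge; first by apply/cvg_ex; eexists; exact: lim.
have nT := near_left_T t01.
near=> t; rewrite -WE; apply: pos.
  have [tT tS] : t0 <= t <= t1 /\ t \notin S by near: t.
  exact: continuity_off_jumps.
by near: t; exact: nbhs_left_lt.
Unshelve. all: by end_near. Qed.

End extremal.

Theorem corollary2 (R : realType) (n : nat) (t0 t1 alpha beta : R)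
    (x0 x1 : 'rV[R]_n) (L : R -> 'rV[R]_n -> 'rV[R]_n -> R)
    (x : R -> 'rV[R]_n)
    (ht : t0 < t1) (halpha : 0 < alpha <= 1) (hbeta : 0 < beta)
    (hx : admissible t0 t1 alpha x0 x1 x)
    (hL : C1_near_graph t0 t1 alpha L x) :
  let D := caputo t0 t1 alpha x in
  let T := continuity_points t0 t1 alpha x in
  (continuous_over t0 t1 L x ->
   strong_local_minimum t0 t1 alpha beta x0 x1 L x ->
   forall (tau : R) (xi : 'rV[R]_n), T tau ->
     0 <= weierstrass L tau (x tau) (D tau) (D tau + xi)) /\
  (weak_local_minimum t0 t1 alpha beta x0 x1 L x ->
   exists2 delta : R, 0 < delta &
     forall (tau : R) (xi : 'rV[R]_n), T tau -> normv xi <= delta / 2 ->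
       0 <= weierstrass L tau (x tau) (D tau) (D tau + xi)).
Proof.
move=> D T.
have [c0 c00 capE] := @caputo_density R n alpha t0 t1 ht halpha.
have [[cx [psi PCpsi xE]] hx0 hx1] := hx.
have [S [SP Scont]] := PCpsi.
have [U [oU graphU UC1]] := hL.
(* With xi fixed, the endpoint needs the inequality for the same xi at all earlier continuity
   points, which is why tau is quantified inside. *)
have reduce (xi : 'rV[R]_n) : (forall tau, T tau ->
      \forall q \near (tau, x tau, D tau + xi), {for q, continuous (Defs.Lfun L)}) ->
    (forall tau, T tau -> tau < t1 -> 0 <= weierstrass L tau (x tau) (D tau) (D tau + xi)) ->
    forall tau, T tau -> 0 <= weierstrass L tau (x tau) (D tau) (D tau + xi).
  move=> cL interior tau Ttau; have [/andP[_ le_t1] _] := Ttau.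
  move: le_t1; rewrite le_eqVlt => /predU1P[tE|]; last exact: interior.
  rewrite tE in Ttau *; apply: (weierstrass_at_end ht capE cx xE SP Scont graphU UC1) => //.
  exact: nbhs_singleton (cL _ Ttau).
have shift (y : R -> 'rV[R]_n) : (fun t => x t + y t) \- x = y.
  by apply/funext => t /=; rewrite addrAC subrr add0r.
have normC_le (y : R -> 'rV[R]_n) e :
    (forall t, t0 <= t <= t1 -> normv (y t) <= e) -> (normC t0 t1 y <= e%:E)%E.
  move=> ye; apply: ub_ereal_sup => _ [t /= + <-]; rewrite in_itv/= => tT.
  by rewrite lee_fin ye.
split.
  move=> [V [oV VU cV]] [_ [delta d0 minx]] tau xi; apply: reduce => {}tau Ttau.
    have Vq : nbhs (tau, x tau, D tau + xi) V.
      by apply: open_nbhs_nbhs; split=> //; apply: VU; case: Ttau.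
    by apply: filterS Vq.
  (* Half of delta, because a pointwise bound gives only a weak inequality for the supremum and a
     strict one is required. *)
  move=> tau1; have d20 : 0 < delta / 2 by rewrite divr_gt0.
  apply: (weierstrass_before_end c00 capE cx xE SP Scont oU graphU UC1 hbeta halpha hx0 hx1 Ttau tau1 d20).
    have Vq : nbhs (tau, x tau, D tau + xi) V.
      by apply: open_nbhs_nbhs; split=> //; apply: VU; case: Ttau.
    by apply: filterS Vq.
  move=> y ydelta _ z adm Jz; apply: minx => //.
  rewrite shift (le_lt_trans (normC_le _ _ ydelta))// lte_fin ltr_pdivrMr//.
  by rewrite ltr_pMr// ltr1n.
move=> [_ [delta d0 minx]].
have [M M0 hM] := bounds_near_graph capE cx xE SP Scont oU graphU UC1.
have dM0 : 0 < Num.min delta M^-1 by rewrite lt_min d0 invr_gt0.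
(* The bound M^-1 keeps D tau + xi in U, so that L is continuous there without [continuous_over]. *)
exists (Num.min delta M^-1) => // tau xi Ttau xi_le; move: tau Ttau.
have xi_half : normv xi < Num.min delta M^-1.
  by rewrite (le_lt_trans xi_le)// ltr_pdivrMr// ltr_pMr// ltr1n.
have nearL tau : T tau ->
    \forall q \near (tau, x tau, D tau + xi), {for q, continuous (Defs.Lfun L)}.
  move=> Ttau; have [||Uq _ _] := hM tau (x tau) (D tau + xi) Ttau.
  - by rewrite subrr normr0 invr_ge0 ltW.
  - rewrite addrAC subrr add0r (le_trans (le_mx_norm_normv _))// ltW//.
    by rewrite (lt_le_trans xi_half)// ge_min lexx orbT.
  have Unear : nbhs (tau, x tau, D tau + xi) U by exact: open_nbhs_nbhs.
  by apply: filterS Unear => q /UC1[].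
apply: reduce => // tau Ttau tau1.
(* The displacement takes delta / 4 and its Caputo derivative at most delta / 2, which together stay
   below delta. *)
have d40 : 0 < delta / 4 by rewrite divr_gt0.
apply: (weierstrass_before_end c00 capE cx xE SP Scont oU graphU UC1 hbeta halpha hx0 hx1 Ttau tau1 d40).
  exact: nearL.
move=> y ydelta ynorm z adm Jz; apply: minx => //.
rewrite shift /normPCalpha (le_lt_trans (leeD (normC_le _ _ ydelta) ynorm))//.
rewrite -EFinD lte_fin; have := xi_le.
have : Num.min delta M^-1 <= delta by rewrite ge_min lexx.
by move: (Num.min delta M^-1) (normv xi) d0 => m v; lra.
Qed.
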